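(* For every $\tau>0$ let $E_\tau=A_\tau-iB_\tau$ be a Hermite–Biehler entire function of exponential type $\tau$ without real zeros, with phase $\varphi_\tau$, and suppose there is $C>0$ such that $|\varphi_\tau'(x)-\tau|\le C$ for all $x\in\mathbb{R}$ and all $\tau>0$. Consider the following two conditions on a function $f:\mathbb{R}\to\mathbb{C}$. (i) For every $\varepsilon>0$ there exist $\delta>0$ and $\tau_0>0$ such that for all $x,t\in\mathbb{R}$ and all $\tau\ge\tau_0$, $$|x-t|<\delta\ \Longrightarrow\ \left|\frac{f(x)}{|E_\tau(x)|^2}-\frac{f(t)}{|E_\tau(t)|^2}\right|<\varepsilon .$$ (ii) There exists $M>0$ such that $\dfrac{|f(x)|}{|E_\tau(x)|^2}\le M$ for all $x\in\mathbb{R}$ and all $\tau>0$. Define $$G_\tau f(z)=\sum_{t\in\mathcal{T}_\tau}f(t)\frac{A_\tau^2(z)}{A_\tau'(t)^2(z-t)^2},$$ where $\mathcal{T}_\tau$ is the set of zeros of $A_\tau$. Then: (a) If $f:\mathbb{R}\to\mathbb{C}$ satisfies (i) and (ii), then the series $G_\tau f$ converges uniformly on compact sets, $G_\tau f\in\mathcal{H}^\infty(E_\tau^2)$, and $$\lim_{\tau\to\infty}\|(G_\tau f-f)E_\tau^{-2}\|_\infty=0.$$ (b) If in addition $w$ is a weight on $\mathbb{R}$ for which there exist constants $c>0$, $d>0$ and $\tau_0>0$ with $c\le|E_\tau(x)|^2w(x)\le d$ for all real $x$ and all $\tau\ge\tau_0$, then $$\lim_{\tau\to\infty}\|(G_\tau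 f-f)w\|_\infty=0.$$
   Context: A weight is a measurable nonnegative function on $\mathbb{R}$. The exponential type of an entire function $F\not\equiv 0$ is $\limsup_{|z|\to\infty}|z|^{-1}\log|F(z)|$ (when finite). An entire function $E$ is Hermite–Biehler if $|E(z)|>|E(\bar z)|$ whenever $\Im z>0$. For an entire function $F$ put $F^*(z)=\overline{F(\bar z)}$. Write $E=A-iB$ with $A=\frac12(E+E^* )$ and $B=\frac{i}{2}(E-E^* )$; these are entire and real on $\mathbb{R}$, and all zeros of $A$ are real. A phase of $E$ (with no real zeros) is a real-valued function $\varphi_E$ on $\mathbb{R}$ such that $E(x)e^{i\varphi_E(x)}\in\mathbb{R}$ for all real $x$; it is chosen to be analytic on an open set containing $\mathbb{R}$. Here $\varphi_\tau=\varphi_{E_\tau}$. For a Hermite–Biehler function $E$, $\mathcal{H}^\infty(E)$ is the set of entire functions $F$ such that $F/E$ and $F^*/E$ are bounded and analytic in the upper half plane; $\mathcal{H}^\infty(E_\tau^2)$ is this space for the function $E_\tau^2$. Each summand of $G_\tau f$ is an entire function of $z$, its value at $z=t$ being defined by continuity. $\|\cdot\|_\infty$ is the norm of $L^\infty(\mathbb{R})$.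
   Formalization: Convergence of the series and membership of G_τ f in H^∞(E_τ²) are stated for every τ > C, with C any admissible constant of the phase bound, instead of for every τ > 0; for τ ≤ C they can fail, as φ_τ' need not be bounded away from 0. *)

(* Defs.v *)
(* MathComp-Analysis, with the complex numbers [R[i]] of mathcomp-real-closed. *)
From HB Require Import structures.
From mathcomp Require Import all_boot all_order all_algebra.
From mathcomp Require Import finmap.
From mathcomp Require Import all_classical all_reals all_analysis.
From mathcomp Require Import complex.

Set Implicit Arguments.
Unset Strict Implicit.
Unset Printing Implicit Defensive.

Import Order.TTheory GRing.Theory Num.Theory.
Import numFieldNormedType.Exports.

Local Open Scope classical_set_scope.
Local Open Scope ring_scope.
Local Open Scope complex_scope.

(* [R[i]] carries no topology; [R[i]^o], the complex numbers as a normed module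
   over themselves, does, and makes [derivable _ z 1] and [derive1] complex
   differentiability and the complex derivative. *)
Notation "'Cplx' R" := (GRing.regular (complex R)) (at level 10, R at level 9).

(* The norm [`|z|] of MathComp is [R[i]]-valued; this modulus is [R]-valued. *)
Notation cmod := Normc.normc.

Section EntireFunctions.
Context {R : realType}.
Local Notation C := (Cplx R).
Implicit Types (F E : C -> C).

Definition entire F := forall z : C, derivable F z 1.

Definition cinfty_nbhs : set_system C :=
  filter_from setT (fun r : R => [set z : C | r < cmod z]).

(* [lne 0 = -oo], so zeros of [F] do not contribute. *)
Definition exp_type F : \bar R :=
  limf_esup (fun z : C => (((cmod z)^-1)%:E * lne (cmod (F z))%:E)%E)
            cinfty_nbhs.

Definition has_exp_type (tau : R) F :=
  (exists z, F z != 0) /\ exp_type F = tau%:E.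

Definition star F : C -> C := fun z => (F (z^*))^*.

Definition hermite_biehler E :=
  entire E /\ forall z : C, 0 < complex.Im z -> cmod (E z^*) < cmod (E z).

(* The function [A] of the decomposition [E = A - i B]. *)
Definition partA E : C -> C := fun z => 2^-1 * (E z + star E z).

Lemma zeros_partA_real E (z : C) :
  hermite_biehler E -> partA E z = 0 -> complex.Im z = 0.
Proof.
move=> [_ H] /eqP.
rewrite /partA mulf_eq0 invr_eq0 pnatr_eq0 /= addr_eq0 => /eqP e.
have nE : cmod (E z) = cmod (E z^*).
  by rewrite e /star; case: (E _) => a b /=; rewrite /= !sqrrN.
apply/eqP; case: (ltgtP (complex.Im z) 0) => // h.
- have := H (z^*); rewrite conjcK nE ltxx.
  by case: (z) h => a b /=; rewrite oppr_gt0 => -> /(_ isT).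
- by have := H z h; rewrite nE ltxx.
Qed.

Definition is_phase E (phi : R -> R) :=
  (forall x : R,
     complex.Im (E x%:C * (cos (phi x) +i* sin (phi x)) : C) = 0) /\
  exists (U : set C) (Phi : C -> C),
    [/\ open U, forall x : R, U x%:C,
        forall z, U z -> derivable Phi z 1
      & forall x : R, Phi x%:C = (phi x)%:C].

Definition uhp : set C := [set z : C | 0 < complex.Im z].

Definition bounded_analytic_uhp F :=
  (forall z, uhp z -> derivable F z 1) /\
  exists M : R, forall z, uhp z -> cmod (F z) <= M.

Definition Hinf E : set (C -> C) :=
  [set F | [/\ entire F,
               bounded_analytic_uhp (fun z => F z / E z)
             & bounded_analytic_uhp (fun z => star F z / E z)]].

End EntireFunctions.

(* The net of all finite subsets of [A], directed by inclusion; limits along it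
   are sums of unordered series indexed by [A]. *)
Definition finite_subsets {I : choiceType} (A : set I) : set_system {fset I} :=
  filter_from [set J0 : {fset I} | [set` J0] `<=` A]
    (fun J0 => [set J : {fset I} | [set` J0] `<=` [set` J] /\ [set` J] `<=` A]).

#[global] Instance finite_subsets_filter {I : choiceType} (A : set I) :
  ProperFilter (finite_subsets A).
Proof.
eapply filter_from_proper; last by move=> J0 J0A; exists J0; split.
apply: filter_from_filter; first by exists fset0 => t /=; rewrite inE.
move=> J K JA KA; exists (J `|` K)%fset => [t|L] /=.
  by rewrite inE => /orP[/JA|/KA].
by move=> [JKL LA]; split; split=> // t /= tJ; apply: JKL; rewrite /= inE tJ ?orbT.
Qed.

Section InterpolationSeries.
Context {R : realType}.
Local Notation C := (Cplx R).
Implicit Types (E : C -> C) (f : R -> C).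

(* By [zeros_partA_real], these are all the zeros of [partA E]. *)
Definition nodes E : set R := [set t : R | partA E t%:C = 0].

Definition Gterm E f (t : R) : C -> C :=
  let g (z : C) : C :=
    f t * (partA E z ^+ 2 /
           (derive1 (partA E : C -> C) (t%:C : C) ^+ 2 * (z - t%:C) ^+ 2)) in
  fun z => if z == t%:C then lim (g w @[w --> (t%:C : C)^']) else g z.

Definition Gpartial E f (J : {fset R}) : C -> C :=
  fun z => \sum_(t <- J) Gterm E f t z.

Definition G E f : C -> C :=
  fun z => lim (Gpartial E f J z @[J --> finite_subsets (nodes E)]).

Definition Linfty_norm (h : R -> C) : \bar R :=
  Lnorm lebesgue_measure +oo%E (fun x : R => (cmod (h x))%:E).

Definition weight (w : R -> R) :=
  measurable_fun [set: R] w /\ forall x, 0 <= w x.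

End InterpolationSeries.

(* Main.v *)
Require Import Defs.
From HB Require Import structures.
From mathcomp Require Import all_boot all_order all_algebra.
From mathcomp Require Import finmap.
From mathcomp Require Import all_classical all_reals all_analysis.
From mathcomp Require Import complex ess_sup_inf.
From mathcomp Require Import ring lra zify.

Import Order.TTheory GRing.Theory Num.Theory.
Import numFieldNormedType.Exports.

Local Open Scope classical_set_scope.
Local Open Scope ring_scope.
Local Open Scope complex_scope.

Set Implicit Arguments.
Unset Strict Implicit.

(** Fix [tau], drop it from the notation, and put [a = f / |E|^2]. On the real line
    [A^2 = |E|^2 cos^2 phi], so the nodes are the zeros of [cos phi], and at a node
    [A'^2 = |E|^2 phi'^2] ([sqr_dA]). For real [x] that is not a node, the term of the series at the
    node [t] is therefore [|E(x)|^2 a(t) l(x,t) w(x,t)], where [w(x,t) = cos^2 phi(x) / (phi(x) -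
    phi(t))^2] and [l(x,t)] is the square of the mean slope of [phi] between [t] and [x] divided by
    [phi'(t)] ([Gterm_realE]).

    When [tau > C], the derivative of [phi] lies between [L1 = tau - C > 0] and [L2 = tau + C]. Then
    [phi] is a bijection of the line, it takes each value [pi/2 + k pi] at exactly one node, and the
    partial fraction expansion of [1/sin^2] says that the weights [w(x,t)] sum to 1 over the nodes.
    Quantitatively, the nodes at phase distance at least [2^N pi] from [x] carry total weight at
    most [2^-N] ([node_window], [sum_far_nodes]). So [G f / |E|^2] is almost a weighted mean of [a]:
    the factor [l] differs from 1 by at most [kappa - 1] with [kappa = (L2/L1)^2]; nodes within [d]
    of [x] have [a(t)] close to [a(x)] by (i); the other nodes are at phase distance at least
    [L1 d], have little weight, and [a] is bounded there by (ii). [G_error] adds these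
    contributions. As [tau] grows, [kappa] tends to 1 and [L1 d] to infinity, so the error is small
    uniformly in [x].

    On a disc, the terms of remote nodes are dominated by their weights seen from one fixed real
    point ([Gterm_tail]), so the series converges uniformly there, and its sum is entire by
    Weierstrass' theorem. For membership in the space of [E^2], the weights bound every finite sum
    by [M kappa |E|^2] on the real line. Divided by [E^2], a finite sum tends to 0 at infinity in
    the closed upper half plane, because [|A| <= |E|] there; the maximum principle extends the bound
    to the half plane, with a constant independent of the finite sum, and the bound passes to the
    limit ([Gsum_uhp_le]).

    The complex analysis is derived from Goursat's theorem on rectangles. The exponential map
    carries it to annuli, which gives the mean value property, then a Cauchy formula, removable
    singularities, limits of entire functions and the maximum principle. *)

Local Arguments Normc.normc : simpl never.
Local Arguments real_complex_def : simpl never.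

(** * The real-valued modulus and coordinates of complex numbers *)

Section ComplexModulus.
Context {R : realType}.
Local Notation C := (Cplx R).
Implicit Types z w : C.

Lemma cmodE z : `|z| = (cmod z)%:C. Proof. by []. Qed.

Lemma cmod_ge0 z : 0 <= cmod z.
Proof. by rewrite -ler0c -cmodE normr_ge0. Qed.

Lemma cmodM z w : cmod (z * w) = cmod z * cmod w.
Proof. exact: Normc.normcM. Qed.

Lemma cmodD z w : cmod (z + w) <= cmod z + cmod w.
Proof. exact: le_normcD. Qed.

Lemma cmodN z : cmod (- z) = cmod z.
Proof. exact: normcN. Qed.

Lemma cmod0 : cmod (0 : C) = 0.
Proof. exact: Normc.normc0. Qed.

Lemma cmod1 : cmod (1 : C) = 1.
Proof. exact: Normc.normc1. Qed.

Lemma cmodV z : cmod z^-1 = (cmod z)^-1.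
Proof. exact: Normc.normcV. Qed.

Lemma cmod_div z w : cmod (z / w) = cmod z / cmod w.
Proof. by rewrite cmodM cmodV. Qed.

Lemma cmodX z n : cmod (z ^+ n) = cmod z ^+ n.
Proof.
elim: n => [|n IH]; first by rewrite !expr0 cmod1.
by rewrite !exprS cmodM IH.
Qed.

Lemma cmod_eq0 z : (cmod z == 0) = (z == 0).
Proof.
by apply/eqP/eqP => [/Normc.eq0_normc //|->]; rewrite cmod0.
Qed.

Lemma cmod_gt0 z : (0 < cmod z) = (z != 0).
Proof. by rewrite lt_def cmod_ge0 andbT cmod_eq0. Qed.

Lemma cmodB z w : cmod (z - w) = cmod (w - z).
Proof. by rewrite -cmodN opprB. Qed.

Lemma cmodR (x : R) : cmod (x%:C : C) = `|x|.
Proof. by rewrite /Normc.normc /= expr0n addr0 sqrtr_sqr. Qed.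

Lemma cmod_conj z : cmod (z^* : C) = cmod z.
Proof. by case: z => a b; rewrite /Normc.normc /= sqrrN. Qed.

Lemma cmod_sqr z : cmod z ^+ 2 = complex.Re z ^+ 2 + complex.Im z ^+ 2.
Proof. by case: z => a b; rewrite /Normc.normc /= sqr_sqrtr // addr_ge0 ?sqr_ge0. Qed.

Lemma le_Re_cmod z : `|complex.Re z| <= cmod z.
Proof.
rewrite -(@ler_pXn2r _ 2) ?nnegrE ?normr_ge0 ?cmod_ge0 // cmod_sqr.
by rewrite real_normK ?num_real // lerDl sqr_ge0.
Qed.

Lemma le_Im_cmod z : `|complex.Im z| <= cmod z.
Proof.
rewrite -(@ler_pXn2r _ 2) ?nnegrE ?normr_ge0 ?cmod_ge0 // cmod_sqr.
by rewrite real_normK ?num_real // lerDr sqr_ge0.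
Qed.

Lemma cmod_le_ReIm z : cmod z <= `|complex.Re z| + `|complex.Im z|.
Proof.
rewrite -(@ler_pXn2r _ 2) ?nnegrE ?addr_ge0 ?cmod_ge0 // cmod_sqr sqrrD.
rewrite !real_normK ?num_real // -addrA lerD2l lerDr.
by rewrite mulrn_wge0 ?mulr_ge0.
Qed.

Lemma le_cmodB z w : cmod z - cmod w <= cmod (z - w).
Proof. by rewrite lerBlDr; have := cmodD (z - w) w; rewrite subrK. Qed.

Lemma cmod_sum (I : Type) (s : seq I) (P : pred I) (F : I -> C) :
  cmod (\sum_(i <- s | P i) F i) <= \sum_(i <- s | P i) cmod (F i).
Proof.
elim/big_rec2: _ => [|i x y _ h]; first by rewrite cmod0.
by apply: (le_trans (cmodD _ _)); rewrite lerD2l.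
Qed.

Lemma realc (z : C) : complex.Im z = 0 -> z = (complex.Re z)%:C.
Proof. by case: z => a b /= ->. Qed.

Lemma realcD (x y : R) : ((x + y)%:C : C) = (x%:C : C) + (y%:C : C).
Proof. exact: rmorphD. Qed.

Lemma realcB (x y : R) : ((x - y)%:C : C) = (x%:C : C) - (y%:C : C).
Proof. exact: rmorphB. Qed.

Lemma realcM (x y : R) : ((x * y)%:C : C) = (x%:C : C) * (y%:C : C).
Proof. exact: rmorphM. Qed.

Lemma realcV (x : R) : ((x^-1)%:C : C) = (x%:C : C)^-1.
Proof. exact: fmorphV. Qed.

Lemma cReD z w : complex.Re (z + w) = complex.Re z + complex.Re w.
Proof. by case: z; case: w. Qed.

Lemma cImD z w : complex.Im (z + w) = complex.Im z + complex.Im w.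
Proof. by case: z; case: w. Qed.

Lemma cReB z w : complex.Re (z - w) = complex.Re z - complex.Re w.
Proof. by case: z; case: w. Qed.

Lemma cImB z w : complex.Im (z - w) = complex.Im z - complex.Im w.
Proof. by case: z; case: w. Qed.

Lemma cReM z w :
  complex.Re (z * w) = complex.Re z * complex.Re w - complex.Im z * complex.Im w.
Proof. by case: z; case: w. Qed.

Lemma cImM z w :
  complex.Im (z * w) = complex.Re z * complex.Im w + complex.Im z * complex.Re w.
Proof. by case: z; case: w => a b c d /=; rewrite (addrC (c * b)). Qed.

Lemma cconjM z w : ((z * w)^* : C) = (z^* : C) * (w^* : C).
Proof. exact: (rmorphM conjc). Qed.

Lemma cconjD z w : ((z + w)^* : C) = (z^* : C) + (w^* : C).
Proof. exact: (rmorphD conjc). Qed.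

Lemma cconjB z w : ((z - w)^* : C) = (z^* : C) - (w^* : C).
Proof. exact: (rmorphB conjc). Qed.

Lemma complex_eq z w :
  complex.Re z = complex.Re w -> complex.Im z = complex.Im w -> z = w.
Proof. by case: z; case: w => a b c d /= -> ->. Qed.

End ComplexModulus.

(** * Limits of complex-valued functions along a filter *)

Section ComplexConvergence.
Context {R : realType}.
Local Notation C := (Cplx R).
Context {T : Type}.
Implicit Types (F : set_system T) (u v : T -> C) (a b : C).

(** Convergence with real tolerances. The norm of [C] takes values in [R[i]], where a positive
    tolerance is a complex number with zero imaginary part; here all estimates stay in the ordered
    field [R]. *)
Definition ccvg F u a :=
  forall e : R, 0 < e -> F [set x | cmod (u x - a) < e].

Lemma ccvgP F {FF : Filter F} u a : u @ F --> a <-> ccvg F u a.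
Proof.
split=> [/cvgrPdist_lt h e e0|h].
  have := h e%:C; rewrite ltcR => /(_ e0); apply: filterS => x.
  by rewrite cmodE ltcR cmodB.
apply/cvgrPdist_lt => -[e i] /=; rewrite ltcE /= => /andP[/eqP -> e0].
have := h e e0; apply: filterS => x hx.
by rewrite cmodE ltcR cmodB.
Qed.

Lemma ccvg_sub F G u a : F `<=` G -> ccvg F u a -> ccvg G u a.
Proof. by move=> FG h e e0; apply: FG; exact: h. Qed.

Lemma ccvg_near F {FF : Filter F} u v a :
  F [set x | u x = v x] -> ccvg F u a -> ccvg F v a.
Proof. by move=> uv h e e0; apply: filterS2 uv (h e e0) => x /= ->. Qed.

Lemma ccvg_cst F {FF : Filter F} a : ccvg F (fun=> a) a.
Proof. by move=> e e0; apply: filterE => x /=; rewrite subrr cmod0. Qed.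

Lemma ccvg_real F {FF : Filter F} (u : T -> R) (a : R) :
  u @ F --> a -> ccvg F (fun x => (u x)%:C) (a%:C).
Proof.
move=> /cvgrPdist_lt h e e0; have := h e e0.
by apply: filterS => x /=; rewrite -realcB cmodR distrC.
Qed.

Lemma ccvg_conj F {FF : Filter F} u a :
  ccvg F u a -> ccvg F (fun x => (u x)^*) (a^*).
Proof.
move=> h e e0; have := h e e0.
by apply: filterS => x /=; rewrite -raddfB cmod_conj.
Qed.

Lemma ccvg_Re F {FF : Filter F} u a :
  ccvg F u a -> (fun x => complex.Re (u x)) @ F --> complex.Re a.
Proof.
move=> h; apply/cvgrPdist_lt => e e0; have := h e e0.
apply: filterS => x /=; rewrite cmodB; apply: le_lt_trans.
by rewrite -cReB le_Re_cmod.
Qed.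

Lemma ccvg_Im F {FF : Filter F} u a :
  ccvg F u a -> (fun x => complex.Im (u x)) @ F --> complex.Im a.
Proof.
move=> h; apply/cvgrPdist_lt => e e0; have := h e e0.
apply: filterS => x /=; rewrite cmodB; apply: le_lt_trans.
by rewrite -cImB le_Im_cmod.
Qed.

Lemma ccvg_ReIm F {FF : Filter F} (x y : T -> R) (a b : R) :
  x @ F --> a -> y @ F --> b -> ccvg F (fun t => x t +i* y t) (a +i* b).
Proof.
move=> /cvgrPdist_lt hr /cvgrPdist_lt hi e e0.
have e2 : 0 < e / 2 by rewrite divr_gt0.
have := hr _ e2; have := hi _ e2; apply: filterS2 => t /=.
rewrite distrC => h1; rewrite distrC => h2.
by apply: (le_lt_trans (cmod_le_ReIm (_ +i* _))); rewrite [e]splitr ltrD.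
Qed.

Lemma ccvg_cmod F {FF : Filter F} u a :
  ccvg F u a -> (fun x => cmod (u x)) @ F --> cmod a.
Proof.
move=> h; apply/cvgrPdist_lt => e e0; have := h e e0.
apply: filterS => x /=; apply: le_lt_trans.
by rewrite ler_norml lerNl opprB le_cmodB (cmodB (u x)) le_cmodB.
Qed.

Lemma ccvgD F {FF : Filter F} u v a b :
  ccvg F u a -> ccvg F v b -> ccvg F (fun x => u x + v x) (a + b).
Proof. by move=> /ccvgP ua /ccvgP vb; apply/ccvgP; exact: cvgD ua vb. Qed.

Lemma ccvgB F {FF : Filter F} u v a b :
  ccvg F u a -> ccvg F v b -> ccvg F (fun x => u x - v x) (a - b).
Proof. by move=> /ccvgP ua /ccvgP vb; apply/ccvgP; exact: cvgB ua vb. Qed.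

Lemma ccvgM F {FF : Filter F} u v a b :
  ccvg F u a -> ccvg F v b -> ccvg F (fun x => u x * v x) (a * b).
Proof. by move=> /ccvgP ua /ccvgP vb; apply/ccvgP; exact: cvgM ua vb. Qed.

Lemma ccvgV F {FF : Filter F} u a :
  a != 0 -> ccvg F u a -> ccvg F (fun x => (u x)^-1) (a^-1).
Proof. by move=> a0 /ccvgP ua; apply/ccvgP; exact: cvgV a0 ua. Qed.

Lemma ccvgX F {FF : Filter F} u a n :
  ccvg F u a -> ccvg F (fun x => u x ^+ n) (a ^+ n).
Proof.
move=> ua; elim: n => [|n IH].
  by under [X in ccvg _ X _]eq_fun do rewrite expr0; exact: ccvg_cst.
by rewrite exprS; under [X in ccvg _ X _]eq_fun do rewrite exprS; exact: ccvgM.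
Qed.

End ComplexConvergence.

(** * Complex differentiability *)

Section ComplexDerivative.
Context {R : realType}.
Local Notation C := (Cplx R).
Implicit Types (F G : C -> C) (z w d : C).

Lemma nbhsCP z (P : set C) :
  nbhs z P <-> exists2 e : R, 0 < e & forall w, cmod (w - z) < e -> P w.
Proof.
split=> [/nbhs_ballP[[e i] /=]|[e e0 h]].
  rewrite ltcE /= => /andP[/eqP -> e0] h; exists e => // w wz; apply: h.
  by rewrite -ball_normE /ball_ /= cmodE ltcR cmodB.
apply/nbhs_ballP; exists e%:C => /=; first by rewrite ltcR.
by move=> w; rewrite -ball_normE /ball_ /= cmodE ltcR cmodB => /h.
Qed.

(* Caratheodory's form of differentiability: the rules of calculus reduce to
   those of continuity. *)
Definition cdiff F z d := exists q : C -> C,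
  [/\ ccvg (nbhs z) q (q z), q z = d & forall w, F w - F z = q w * (w - z)].

Lemma ccvg_nbhs F z (a : C) : ccvg (nbhs z) F a <->
  forall e : R, 0 < e -> exists2 r : R, 0 < r &
    forall w, cmod (w - z) < r -> cmod (F w - a) < e.
Proof.
by split=> h e e0; [have /nbhsCP := h e e0|apply/nbhsCP; exact: h].
Qed.

Lemma ccvg_id z : ccvg (nbhs z) (fun w => w) z.
Proof. by apply/ccvg_nbhs => e e0; exists e. Qed.

Lemma ccvg_comp (T : Type) (A : set_system T) (u : T -> C) F z a :
  ccvg A u z -> Filter A -> ccvg (nbhs z) F a -> ccvg A (fun t => F (u t)) a.
Proof.
move=> uz FA /ccvg_nbhs Fa e e0; have [r r0 h] := Fa e e0.
by apply: filterS (uz r r0) => t /=; exact: h.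
Qed.

Lemma cdiff_derivable F z d :
  cdiff F z d -> derivable F z 1 /\ derive1 F z = d.
Proof.
move=> [q [qc <- qE]].
have h : (fun h : C => h^-1 *: (F (h *: 1 + z) - F z)) @ 0^' --> q z.
  apply/ccvgP => e e0; have /ccvg_nbhs/(_ e e0)[r r0 hr] := qc.
  apply/nbhsCP; exists r => // w.
  rewrite subr0 => wr w0 /=; rewrite qE scaler1 addrK.
  rewrite (_ : _ *: _ = q (w + z)); last first.
    by rewrite -[LHS]/(w^-1 * (q (w + z) * w)) mulrCA mulVf // mulr1.
  by apply: hr; rewrite addrK.
by split; [apply/cvg_ex; exists (q z)|rewrite derive1E; exact/cvg_lim].
Qed.

Lemma derivable_cdiff F z : derivable F z 1 -> cdiff F z (derive1 F z).
Proof.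
move=> Fz.
exists (fun w => if w == z then derive1 F z else (F w - F z) / (w - z)).
split; last 1 first.
- move=> w; have [wz|wz] := eqVneq w z; first by rewrite wz !subrr mulr0.
  by rewrite divfK // subr_eq0.
- rewrite eqxx; apply/ccvg_nbhs => e e0.
  have : (fun h : C => h^-1 *: (F (h *: 1 + z) - F z)) @ 0^' --> derive1 F z.
    by rewrite derive1E; exact: Fz.
  move=> /ccvgP/(_ e e0)/nbhsCP[r r0 hr].
  exists r => // w wz.
  have [_|wz'] := eqVneq w z; first by rewrite subrr cmod0.
  have := hr (w - z); rewrite subr0 subr_eq0 /= => /(_ wz wz').
  by rewrite scaler1 subrK -[_ *: _]/(_ * _) (mulrC (_^-1)).
- by rewrite eqxx.
Qed.

Lemma cdiff_uniq F z a b : cdiff F z a -> cdiff F z b -> a = b.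
Proof. by move=> /cdiff_derivable[_ <-] /cdiff_derivable[_ <-]. Qed.

Lemma cdiff_ccvg F z d : cdiff F z d -> ccvg (nbhs z) F (F z).
Proof.
move=> [q [qc _ qE]].
have -> : F = (fun w => q w * (w - z) + F z) by apply/funext => w; rewrite -qE subrK.
apply: ccvgD; last exact: ccvg_cst.
by apply: ccvgM => //; apply: ccvgB; [exact: ccvg_id|exact: ccvg_cst].
Qed.

Lemma cdiff_near F G z d :
  nbhs z [set w | F w = G w] -> cdiff F z d -> cdiff G z d.
Proof.
move=> FG [q [qc qz qE]].
have FGz : F z = G z := nbhs_singleton FG.
(* The slope function has to factor [G w - G z] for every [w], also where [F] and [G] differ, so it
   is rebuilt from [G]. *)
exists (fun w => if w == z then d else (G w - G z) / (w - z)); split.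
- rewrite eqxx -qz; apply: ccvg_near qc; apply: filterS FG => w /= FGw.
  case: eqVneq => [wz|wz]; first by rewrite wz qz.
  by rewrite -FGz -FGw qE mulfK // subr_eq0.
- by rewrite eqxx.
- move=> w; have [wz|wz] := eqVneq w z; first by rewrite wz !subrr mulr0.
  by rewrite divfK // subr_eq0.
Qed.

Lemma cdiff_cst c z : cdiff (fun=> c) z 0.
Proof.
by exists (fun=> 0); split=> // [|w]; [exact: ccvg_cst|rewrite subrr mul0r].
Qed.

Lemma cdiff_id z : cdiff (fun w => w) z 1.
Proof.
by exists (fun=> 1); split=> // [|w]; [exact: ccvg_cst|rewrite mul1r].
Qed.

Lemma cdiffD F G z a b :
  cdiff F z a -> cdiff G z b -> cdiff (fun w => F w + G w) z (a + b).
Proof.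
move=> [p [pc <- pE]] [q [qc <- qE]].
exists (fun w => p w + q w); split=> //; first exact: ccvgD.
by move=> w; rewrite opprD addrACA pE qE mulrDl.
Qed.

Lemma cdiffM F G z a b : cdiff F z a -> cdiff G z b ->
  cdiff (fun w => F w * G w) z (a * G z + F z * b).
Proof.
move=> Fa [q [qc <- qE]]; have [p [pc <- pE]] := Fa.
exists (fun w => p w * G z + F w * q w); split=> //.
  apply: ccvgD; first by apply: ccvgM => //; exact: ccvg_cst.
  by apply: ccvgM => //; exact: cdiff_ccvg Fa.
by move=> w; rewrite mulrDl mulrAC -pE -mulrA -qE; ring.
Qed.

Lemma cdiffZ c F z a : cdiff F z a -> cdiff (fun w => c * F w) z (c * a).
Proof. by move=> Fa; have := cdiffM (cdiff_cst c z) Fa; rewrite mul0r add0r. Qed.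

Lemma cdiffB F G z a b :
  cdiff F z a -> cdiff G z b -> cdiff (fun w => F w - G w) z (a - b).
Proof.
move=> Fa Gb; have := cdiffD Fa (cdiffZ (-1) Gb); rewrite mulN1r.
by under eq_fun do rewrite mulN1r.
Qed.

Lemma cdiffV F z a :
  F z != 0 -> cdiff F z a -> cdiff (fun w => (F w)^-1) z (- a / F z ^+ 2).
Proof.
move=> Fz Fa; have [q [qc <- qE]] := Fa.
have Fc := cdiff_ccvg Fa.
have Fn : nbhs z [set w | F w != 0].
  have F0 : 0 < cmod (F z) by rewrite cmod_gt0.
  apply: filterS (Fc _ F0) => w /=; apply: contraTneq => ->.
  by rewrite sub0r cmodN ltxx.
(* Where [F] vanishes, the inverse is 0 by convention and [p] does not factor its increment. [H]
   corrects the function at those points, which stay away from [z]. *)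
pose p w := - 1 * q w / (F w * F z).
pose H w := if F w == 0 then (F z)^-1 + p w * (w - z) else (F w)^-1.
apply: (@cdiff_near H); first by apply: filterS Fn => w /=; rewrite /H => /negbTE ->.
exists p; split.
- apply: ccvgM; first by apply: ccvgM => //; exact: ccvg_cst.
  by apply: ccvgV; [rewrite mulf_neq0|apply: ccvgM => //; exact: ccvg_cst].
- by rewrite /p mulN1r expr2.
- move=> w; rewrite /H (negbTE Fz); case: eqP => [_|/eqP Fw].
    by rewrite addrAC subrr add0r.
  rewrite /p mulrAC -(mulrA (-1)) -qE mulN1r opprB invfM mulrA mulrBl divff //.
  by rewrite mulrBl mul1r mulrAC divff // mul1r.
Qed.

Lemma cdiff_div F G z a b : G z != 0 -> cdiff F z a -> cdiff G z b ->
  cdiff (fun w => F w / G w) z (a / G z + F z * (- b / G z ^+ 2)).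
Proof. by move=> G0 Fa Gb; exact: cdiffM Fa (cdiffV G0 Gb). Qed.

Lemma cdiff_comp F G z a b :
  cdiff G z b -> cdiff F (G z) a -> cdiff (fun w => F (G w)) z (a * b).
Proof.
move=> Gb [p [pc <- pE]]; have [q [qc <- qE]] := Gb.
exists (fun w => p (G w) * q w); split=> //.
  by apply: ccvgM => //; exact: ccvg_comp (cdiff_ccvg Gb) _ pc.
by move=> w; rewrite pE qE mulrA.
Qed.

Lemma cdiffX F z a n :
  cdiff F z a -> exists d, cdiff (fun w => F w ^+ n) z d.
Proof.
move=> Fa; elim: n => [|n [d IH]]; first by exists 0; exact: cdiff_cst.
exists (a * F z ^+ n + F z * d).
by under eq_fun do rewrite exprS; exact: cdiffM.
Qed.

Lemma cdiff_sum (I : Type) (s : seq I) (F : I -> C -> C) z :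
  (forall i, exists d, cdiff (F i) z d) ->
  exists d, cdiff (fun w => \sum_(i <- s) F i w) z d.
Proof.
move=> Fd; elim: s => [|i s [d IH]].
  by exists 0; under eq_fun do rewrite big_nil; exact: cdiff_cst.
have [a Fa] := Fd i; exists (a + d).
by under eq_fun do rewrite big_cons; exact: cdiffD.
Qed.

Lemma cdiff_star F z d : cdiff F (z^*) d -> cdiff (star F) z (d^*).
Proof.
move=> [q [qc <- qE]]; exists (fun w => (q (w^*))^*); split=> //.
  by apply: ccvg_conj; apply: ccvg_comp (ccvg_conj _) _ qc; exact: ccvg_id.
move=> w; rewrite /star -cconjB qE -cconjB cconjM.
by congr (_ * _); exact: conjcK.
Qed.

End ComplexDerivative.

(** * Integrals of continuous real functions, through primitives *)

Section RealIntegral.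
Context {R : realType}.
Implicit Types (u v U V : R -> R) (a b c x : R).

Lemma derive0_constant U a b : a <= b ->
  (forall x, a <= x <= b -> is_derive x 1 U 0) -> U a = U b.
Proof.
move=> ab h.
have [||c _] := @MVT_segment R U (fun=> 0) a b ab.
- by move=> x; rewrite in_itv /= => /andP[/ltW ax /ltW xb]; apply: h; rewrite ax.
- apply: derivable_within_continuous => x; rewrite in_itv /= => /h.
  by case.
- by rewrite mul0r => /eqP; rewrite subr_eq0 => /eqP.
Qed.

Lemma exists_primitive u :
  continuous u -> exists U : R -> R, forall x, is_derive x 1 U (u x).
Proof.
move=> uc.
(* The fundamental theorem gives the derivative of [W m] only to the right of [m]. Primitives with
   different base points [m] differ by a constant, so after normalisation at 0 they glue to one on
   the whole line. *)
pose W m x := (\int[lebesgue_measure]_(t in `[m, x]) u t)%R.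
have Wd m x : m < x -> is_derive x 1 (W m) (u x).
  move=> mx; have x1 : x < x + 1 by rewrite ltrDl.
  have ui : (lebesgue_measure : measure _ _).-integrable `[m, x + 1] (EFin \o u).
    apply: continuous_compact_integrable; first exact: segment_compact.
    exact: continuous_subspaceT.
  have [d e] := @continuous_FTC1_closed R u m x _ x1 ui mx (uc x).
  by apply: DeriveDef; rewrite // -derive1E.
have W2 m m' x : m < x -> m' < x -> m < 0 -> m' < 0 ->
    W m x - W m 0 = W m' x - W m' 0.
  move=> mx m'x m0 m'0.
  have D t : m < t -> m' < t -> is_derive t 1 (fun s => W m s - W m' s) 0.
    by move=> mt m't; rewrite -(subrr (u t)); apply: is_deriveB; exact: Wd.
  suff : W m 0 - W m' 0 = W m x - W m' x by lra.
  have [x0|/ltW x0] := lerP 0 x.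
    apply: (@derive0_constant (fun s => W m s - W m' s)) => // t /andP[t0 _].
    by apply: D; exact: lt_le_trans t0.
  symmetry; apply: (@derive0_constant (fun s => W m s - W m' s)) => // t /andP[t0 _].
  by apply: D; exact: lt_le_trans t0.
(* The base point lies to the left of both [x] and 0; around a given [x] the fixed base point
   [mm x - 1] serves all nearby points. *)
pose mm x := Num.min x 0 - 1.
exists (fun x => W (mm x) x - W (mm x) 0) => x.
have mx : mm x - 1 < x.
  by rewrite /mm; have := ge_min x x 0; rewrite lexx /=; lra.
have m0 : mm x - 1 < 0.
  by rewrite /mm; have := ge_min 0 x 0; rewrite lexx orbT; lra.
have -> : u x = u x - 0 by rewrite subr0.
have d0 : is_derive x 1 (fun y => W (mm x - 1) y - W (mm x - 1) 0) (u x - 0).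
  by apply: is_deriveB; exact: Wd.
apply: (near_eq_is_derive _ d0).
near=> y; apply: W2 => //.
+ near: y; exact: lt_nbhsr.
+ by rewrite /mm; have := ge_min y y 0; rewrite lexx /=; lra.
+ by rewrite /mm; have := ge_min 0 y 0; rewrite lexx orbT; lra.
Unshelve. all: by end_near. Qed.

Definition primitive u : R -> R := get [set U | forall x, is_derive x 1 U (u x)].

Lemma primitiveP u : continuous u -> forall x, is_derive x 1 (primitive u) (u x).
Proof.
move=> uc; have [U Ud] := exists_primitive uc.
exact: (@getPex _ [set U | forall x, is_derive x 1 U (u x)] (ex_intro _ U Ud)).
Qed.

(** As an increment of a primitive the integral is oriented, and splitting an interval is mere
    cancellation. *)
Definition rint u a b := primitive u b - primitive u a.

Lemma rint_primitive u U a b : continuous u ->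
  (forall x, is_derive x 1 U (u x)) -> rint u a b = U b - U a.
Proof.
move=> uc Ud.
suff h c d : c <= d -> primitive u c - U c = primitive u d - U d.
  rewrite /rint; case: (lerP a b) => [/h|/ltW/h]; lra.
move=> cd; apply: (@derive0_constant (fun x => primitive u x - U x)) => // x _.
by rewrite -(subrr (u x)); apply: is_deriveB => //; exact: primitiveP.
Qed.

Lemma rintD u v a b : continuous u -> continuous v ->
  rint (fun x => u x + v x) a b = rint u a b + rint v a b.
Proof.
move=> uc vc.
have Ud x : is_derive x 1 (fun x => primitive u x + primitive v x) (u x + v x).
  by apply: is_deriveD; exact: primitiveP.
rewrite (rint_primitive _ _ _ Ud); first by rewrite /rint; ring.
by move=> x; apply: cvgD; [exact: uc|exact: vc].
Qed.

Lemma rintZ k u a b : continuous u -> rint (fun x => k * u x) a b = k * rint u a b.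
Proof.
move=> uc.
have Ud x : is_derive x 1 (fun x => k * primitive u x) (k * u x).
  by have := is_deriveZ k (primitiveP uc x).
rewrite (rint_primitive _ _ _ Ud); first by rewrite /rint; ring.
by move=> x; apply: cvgMr; exact: uc.
Qed.

Lemma rint_mean u a b : continuous u -> a <= b ->
  exists2 c, a <= c <= b & rint u a b = u c * (b - a).
Proof.
move=> uc ab; have [||c] := @MVT_segment R (primitive u) u a b ab.
- by move=> x _; exact: primitiveP.
- by apply: derivable_within_continuous => x _; have [] := primitiveP uc x.
- by rewrite in_itv /= => cab e; exists c.
Qed.

Lemma rint_cst k a b : rint (fun=> k) a b = k * (b - a).
Proof.
have Ud x : is_derive x 1 (fun x => k * x) k.
  by have := is_deriveZ k (is_derive_id x (1 : R)); rewrite /GRing.scale /= mulr1.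
rewrite (rint_primitive _ _ _ Ud); first by ring.
by move=> x; exact: cvg_cst.
Qed.

Lemma rint_id a b : rint (fun x => x) a b = (b ^+ 2 - a ^+ 2) / 2.
Proof.
have Ud x : is_derive x 1 (fun x => 2^-1 * (x * x)) x.
  have h := is_deriveZ (2^-1) (is_deriveM (is_derive_id x (1 : R)) (is_derive_id x (1 : R))).
  by apply: (is_derive_eq h); rewrite /GRing.scale /=; field.
rewrite (rint_primitive _ _ _ Ud); first by field.
by move=> x; exact: cvg_id.
Qed.

Lemma rint_bound u M a b : continuous u -> a <= b ->
  (forall x, a <= x <= b -> `|u x| <= M) -> `|rint u a b| <= M * (b - a).
Proof.
move=> uc ab uM; have [c cab ->] := rint_mean uc ab.
by rewrite normrM (ger0_norm (_ : 0 <= b - a)) ?subr_ge0 // ler_wpM2r ?subr_ge0 ?uM.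
Qed.

Lemma rint_ge0_eq0 u a b : continuous u ->
  (forall x, a <= x <= b -> 0 <= u x) -> rint u a b = 0 ->
  forall x, a < x < b -> u x = 0.
Proof.
move=> uc u0 I0 x /andP[ax xb].
have h c d : a <= c -> c <= d -> d <= b -> 0 <= rint u c d.
  move=> ac cd db; have [y /andP[cy yd] ->] := rint_mean uc cd.
  by rewrite mulr_ge0 ?subr_ge0 // u0 // (le_trans ac) // (le_trans yd).
apply/eqP; rewrite eq_le u0 ?(ltW ax) ?(ltW xb) // andbT leNgt; apply/negP => ux.
(* If [u x] were positive, a small interval around [x] would contribute a positive amount, and the
   two remaining pieces a nonnegative one. *)
have : \forall y \near x, a < y < b /\ 0 < u y.
  near=> y; split; [apply/andP; split|].
  - near: y; exact: lt_nbhsr.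
  - near: y; exact: lt_nbhsl.
  - near: y; exact: (cvgr_gt (u x) (uc x)).
move=> /nbhs_ballP[e /= e0 he].
pose d := e / 2; have d0 : 0 < d by rewrite divr_gt0.
have de : d < e by rewrite /d; lra.
have B y : x - d <= y <= x + d -> a < y < b /\ 0 < u y.
  move=> yd; apply: he; rewrite /ball /= distrC ltr_norml; lra.
have [/andP[a1 _] _] : a < x - d < b /\ 0 < u (x - d) by apply: B; lra.
have [/andP[_ b1] _] : a < x + d < b /\ 0 < u (x + d) by apply: B; lra.
have xdd : x - d <= x + d by lra.
have [y yd e1] := rint_mean uc xdd.
have [_ uy] := B _ yd.
have : 0 < rint u (x - d) (x + d) by rewrite e1 mulr_gt0 //; lra.
have := h _ _ (lexx a) (ltW a1) (ltac:(lra)).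
have := h (x + d) b (ltac:(lra)) (ltW b1) (lexx b).
move: I0; rewrite /rint; lra.
Unshelve. all: by end_near. Qed.

End RealIntegral.

(** * Integrals along segments and Goursat's theorem on rectangles *)

Section ComplexIntegral.
Context {R : realType}.
Local Notation C := (Cplx R).
Implicit Types (u v : R -> C) (F : C -> C) (a b c x y M : R).

Definition cpath u := forall t, ccvg (nbhs t) u (u t).

Definition ccontinuous F := forall z, ccvg (nbhs z) F (F z).

Lemma cpath_Re u : cpath u -> continuous (fun t => complex.Re (u t)).
Proof. by move=> uc t; exact: ccvg_Re (uc t). Qed.

Lemma cpath_Im u : cpath u -> continuous (fun t => complex.Im (u t)).
Proof. by move=> uc t; exact: ccvg_Im (uc t). Qed.

Lemma cpath_comp F u : ccontinuous F -> cpath u -> cpath (fun t => F (u t)).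
Proof. by move=> Fc uc t; apply: ccvg_comp (uc t) _ (Fc _). Qed.

Lemma cpathD u v : cpath u -> cpath v -> cpath (fun t => u t + v t).
Proof. by move=> uc vc t; exact: ccvgD. Qed.

Lemma cpathM u v : cpath u -> cpath v -> cpath (fun t => u t * v t).
Proof. by move=> uc vc t; exact: ccvgM. Qed.

Lemma cpath_cst (c : C) : cpath (fun=> c).
Proof. by move=> t; exact: ccvg_cst. Qed.

Lemma cpath_hor y : cpath (fun t => t +i* y).
Proof. by move=> t; apply: ccvg_ReIm; [exact: cvg_id|exact: cvg_cst]. Qed.

Lemma cpath_ver x : cpath (fun t => x +i* t).
Proof. by move=> t; apply: ccvg_ReIm; [exact: cvg_cst|exact: cvg_id]. Qed.

Definition cint u a b : C :=
  rint (fun t => complex.Re (u t)) a b +i* rint (fun t => complex.Im (u t)) a b.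

Lemma cintD u v a b : cpath u -> cpath v ->
  cint (fun t => u t + v t) a b = cint u a b + cint v a b.
Proof.
move=> uc vc; apply: complex_eq; rewrite /cint ?cReD ?cImD /=.
  under eq_fun do rewrite cReD.
  by apply: rintD; exact: cpath_Re.
under eq_fun do rewrite cImD.
by apply: rintD; exact: cpath_Im.
Qed.

Lemma cintZ (k : C) u a b : cpath u ->
  cint (fun t => k * u t) a b = k * cint u a b.
Proof.
move=> uc.
have rc := cpath_Re uc; have ic := cpath_Im uc.
have kc (h : R) (g : R -> R) : continuous g -> continuous (fun t => h * g t).
  by move=> gc t; apply: cvgMr; exact: gc.
apply: complex_eq; rewrite /cint ?cReM ?cImM /=.
  under eq_fun do rewrite cReM -mulNr.
  by rewrite rintD ?rintZ ?mulNr //; exact: kc.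
under eq_fun do rewrite cImM.
by rewrite rintD ?rintZ //; exact: kc.
Qed.

Lemma cint_cst (k : C) a b : cint (fun=> k) a b = k * (b - a)%:C.
Proof.
by apply: complex_eq; rewrite /cint ?cReM ?cImM /= rint_cst ?mulr0 ?subr0 ?add0r.
Qed.

Lemma cint_split u a b c : cint u a b + cint u b c = cint u a c.
Proof. by apply: complex_eq; rewrite /cint ?cReD ?cImD /= /rint; ring. Qed.

(** The factor 2 comes from bounding the real and imaginary parts separately. *)
Lemma cint_bound u M a b : cpath u -> a <= b ->
  (forall t, a <= t <= b -> cmod (u t) <= M) ->
  cmod (cint u a b) <= 2 * M * (b - a).
Proof.
move=> uc ab uM; apply: (le_trans (cmod_le_ReIm _)).
rewrite -mulrA mulr_natl mulr2n; apply: lerD; rewrite /cint /=.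
  apply: rint_bound => // [|t /uM]; first exact: cpath_Re.
  by apply: le_trans; exact: le_Re_cmod.
apply: rint_bound => // [|t /uM]; first exact: cpath_Im.
by apply: le_trans; exact: le_Im_cmod.
Qed.

(** The contour integral of [F(z) dz] around the rectangle, counterclockwise from its lower left
    corner; [dz] is [i dt] on the vertical sides. *)
Definition bdry F x0 x1 y0 y1 : C :=
  cint (fun t => F (t +i* y0)) x0 x1 + 'i * cint (fun t => F (x1 +i* t)) y0 y1
  - cint (fun t => F (t +i* y1)) x0 x1 - 'i * cint (fun t => F (x0 +i* t)) y0 y1.

Lemma bdryD F G x0 x1 y0 y1 : ccontinuous F -> ccontinuous G ->
  bdry (fun z => F z + G z) x0 x1 y0 y1 = bdry F x0 x1 y0 y1 + bdry G x0 x1 y0 y1.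
Proof.
move=> Fc Gc; rewrite /bdry !cintD; first by ring.
all: by apply: cpath_comp => //; [exact: cpath_hor || exact: cpath_ver].
Qed.

Lemma bdryZ (k : C) F x0 x1 y0 y1 : ccontinuous F ->
  bdry (fun z => k * F z) x0 x1 y0 y1 = k * bdry F x0 x1 y0 y1.
Proof.
move=> Fc; rewrite /bdry !cintZ; first by ring.
all: by apply: cpath_comp => //; [exact: cpath_hor || exact: cpath_ver].
Qed.

Lemma bdry_cst (k : C) x0 x1 y0 y1 : bdry (fun=> k) x0 x1 y0 y1 = 0.
Proof. by rewrite /bdry !cint_cst; ring. Qed.

Lemma bdry_id x0 x1 y0 y1 : bdry (fun z => z) x0 x1 y0 y1 = 0.
Proof.
rewrite /bdry /cint /=; apply: complex_eq.
  by rewrite !(cReB, cReD, cReM) /= !rint_cst !rint_id; field.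
by rewrite !(cImB, cImD, cImM) /= !rint_cst !rint_id; field.
Qed.

Lemma bdry_bound F M x0 x1 y0 y1 : ccontinuous F -> x0 <= x1 -> y0 <= y1 ->
  (forall z, x0 <= complex.Re z <= x1 -> y0 <= complex.Im z <= y1 ->
    cmod (F z) <= M) ->
  cmod (bdry F x0 x1 y0 y1) <= 4 * M * ((x1 - x0) + (y1 - y0)).
Proof.
move=> Fc x01 y01 FM.
have i1 : cmod ('i : C) = 1.
  by rewrite /Normc.normc /= expr0n add0r expr1n sqrtr1.
have h1 y : y0 <= y <= y1 ->
    cmod (cint (fun t => F (t +i* y)) x0 x1) <= 2 * M * (x1 - x0).
  move=> yy; apply: cint_bound => //; first by apply: cpath_comp => //; exact: cpath_hor.
  by move=> t tx; exact: FM.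
have h2 x : x0 <= x <= x1 ->
    cmod (cint (fun t => F (x +i* t)) y0 y1) <= 2 * M * (y1 - y0).
  move=> xx; apply: cint_bound => //; first by apply: cpath_comp => //; exact: cpath_ver.
  by move=> t ty; exact: FM.
have a1 := h1 y0; have a2 := h1 y1; have a3 := h2 x0; have a4 := h2 x1.
rewrite !lexx ?x01 ?y01 /= in a1 a2 a3 a4.
rewrite /bdry.
apply: (le_trans (cmodD _ _)); rewrite cmodN cmodM i1 mul1r.
have := cmodD (cint (fun t => F (t +i* y0)) x0 x1 + 'i * cint (fun t => F (x1 +i* t)) y0 y1)
  (- cint (fun t => F (t +i* y1)) x0 x1).
have := cmodD (cint (fun t => F (t +i* y0)) x0 x1) ('i * cint (fun t => F (x1 +i* t)) y0 y1).
rewrite cmodN cmodM i1 mul1r.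
move: (a1 isT) (a2 isT) (a3 isT) (a4 isT). lra.
Qed.

Lemma bdry_split_hor F x0 x x1 y0 y1 :
  bdry F x0 x y0 y1 + bdry F x x1 y0 y1 = bdry F x0 x1 y0 y1.
Proof. by rewrite /bdry -!(cint_split _ x0 x x1); ring. Qed.

Lemma bdry_split_ver F x0 x1 y0 y y1 :
  bdry F x0 x1 y0 y + bdry F x0 x1 y y1 = bdry F x0 x1 y0 y1.
Proof. by rewrite /bdry -!(cint_split _ y0 y y1); ring. Qed.

Lemma nested_intervals (a b : nat -> R) :
  (forall n, a n <= a n.+1) -> (forall n, b n.+1 <= b n) ->
  (forall n, a n <= b n) -> exists c, forall n, a n <= c <= b n.
Proof.
move=> ai bd ab.
have am m n : (m <= n)%N -> a m <= a n by move=> mn; exact: (homo_leq (@lexx _ _) (@le_trans _ _) ai).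
have bm m n : (m <= n)%N -> b n <= b m.
  by move=> mn; apply: (homo_leq (r := fun x y => y <= x)) mn => // x y z h1 h2; exact: le_trans h2 h1.
have h m n : a m <= b n.
  apply: (le_trans (am _ _ (leq_maxl m n))); apply: (le_trans (ab _)).
  exact: bm (leq_maxr m n).
exists (sup (range a)) => n; apply/andP; split.
  by apply: ub_le_sup; [exists (b 0%N) => _ [m _ <-]|exists n].
by apply: ge_sup; [exists (a 0%N); exists 0%N|move=> _ [m _ <-]].
Qed.

(** Goursat's argument: if the integral had modulus [K > 0], repeated quartering would give nested
    rectangles of linear size [2^-n] with integrals at least [K 4^-n]. Near their common point [F]
    is affine up to a small multiple of the distance, and affine functions integrate to 0, so the
    integrals must be smaller. *)
Theorem goursat_rectangle F x0 x1 y0 y1 : ccontinuous F -> x0 <= x1 -> y0 <= y1 ->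
  (forall z, x0 <= complex.Re z <= x1 -> y0 <= complex.Im z <= y1 ->
    exists d, cdiff F z d) ->
  bdry F x0 x1 y0 y1 = 0.
Proof.
move=> Fc x01 y01 Fd; apply/eqP; rewrite -cmod_eq0; apply/negPn/negP => K0'.
set K := cmod _ in K0'.
have K0 : 0 < K by rewrite lt_def K0' cmod_ge0.
pose p := x1 - x0; pose q := y1 - y0.
have p0 : 0 <= p by rewrite /p; lra.
have q0 : 0 <= q by rewrite /q; lra.
pose h (n : nat) : R := 2^-1 ^+ n.
have hS n : h n = 2 * h n.+1 by rewrite /h exprS mulrA divff // mul1r.
have h0 n : 0 < h n by rewrite exprn_gt0.
(* A rectangle of the [n]-th generation is encoded by its lower left corner [s], its sides being
   [p h n] and [q h n]. *)
pose Q n (s : R * R) := bdry F s.1 (s.1 + p * h n) s.2 (s.2 + q * h n).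
pose P n s := K * h n ^+ 2 <= cmod (Q n s).
pose S n s s' := [/\ P n.+1 s', s.1 <= s'.1, s'.1 + p * h n.+1 <= s.1 + p * h n,
  s.2 <= s'.2 & s'.2 + q * h n.+1 <= s.2 + q * h n].
have step n s : P n s -> exists s', S n s s'.
  move=> Ps; apply: contrapT => /forallNP nS.
  have ph := mulr_ge0 p0 (ltW (h0 n.+1)); have qh := mulr_ge0 q0 (ltW (h0 n.+1)).
  have eP : p * h n = p * h n.+1 + p * h n.+1 by rewrite hS; ring.
  (* If none of the four quarters kept a quarter of the lower bound, the triangle inequality would
     contradict [P n s]. *)
  have eQ : q * h n = q * h n.+1 + q * h n.+1 by rewrite hS; ring.
  have B i j : (i = s.1 \/ i = s.1 + p * h n.+1) ->
      (j = s.2 \/ j = s.2 + q * h n.+1) -> cmod (Q n.+1 (i, j)) < K * h n.+1 ^+ 2.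
    move=> hi hj; rewrite ltNge; apply/negP => Pij.
    by apply: (nS (i, j)); split => //=; case: hi => hi; case: hj => hj; lra.
  have := B _ _ (or_introl erefl) (or_introl erefl).
  have := B _ _ (or_introl erefl) (or_intror erefl).
  have := B _ _ (or_intror erefl) (or_introl erefl).
  have := B _ _ (or_intror erefl) (or_intror erefl).
  move: Ps; rewrite /P /Q /= eP eQ !addrA.
  set a1 := s.1 + p * h n.+1; set b1 := s.2 + q * h n.+1.
  set A := bdry F s.1 (a1 + _) _ _.
  rewrite (hS n) => hA h1 h2 h3 h4.
  have AE : A = bdry F s.1 a1 s.2 b1 + bdry F s.1 a1 b1 (b1 + q * h n.+1) +
     (bdry F a1 (a1 + p * h n.+1) s.2 b1 + bdry F a1 (a1 + p * h n.+1) b1 (b1 + q * h n.+1)).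
    by rewrite !bdry_split_ver bdry_split_hor.
  move: hA; rewrite AE exprMn.
  move: (cmodD (bdry F s.1 a1 s.2 b1 + bdry F s.1 a1 b1 (b1 + q * h n.+1))
     (bdry F a1 (a1 + p * h n.+1) s.2 b1 + bdry F a1 (a1 + p * h n.+1) b1 (b1 + q * h n.+1))).
  move: (cmodD (bdry F s.1 a1 s.2 b1) (bdry F s.1 a1 b1 (b1 + q * h n.+1))).
  move: (cmodD (bdry F a1 (a1 + p * h n.+1) s.2 b1) (bdry F a1 (a1 + p * h n.+1) b1 (b1 + q * h n.+1))).
  lra.
pose next n s := get [set s' | S n s s'].
pose fix st n : R * R := if n is m.+1 then next m (st m) else (x0, y0).
have stP n : P n (st n).
  elim: n => [|n IH]; first by rewrite /P /Q /h /= !expr0 expr1n !mulr1 /p /q !subrKC.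
  have [] // : S n (st n) (st n.+1).
  exact: (@getPex _ [set s' | S n (st n) s'] (step _ _ IH)).
have stS n : S n (st n) (st n.+1).
  exact: (@getPex _ [set s' | S n (st n) s'] (step _ _ (stP n))).
have [cx hx] : exists c, forall n, (st n).1 <= c <= (st n).1 + p * h n.
  apply: nested_intervals => n; [by case: (stS n)|by case: (stS n)|].
  by rewrite lerDl mulr_ge0 // ltW.
have [cy hy] : exists c, forall n, (st n).2 <= c <= (st n).2 + q * h n.
  apply: nested_intervals => n; [by case: (stS n)|by case: (stS n)|].
  by rewrite lerDl mulr_ge0 // ltW.
have xb n : x0 <= (st n).1 /\ (st n).1 + p * h n <= x1.
  elim: n => [|n [IH1 IH2]]; first by rewrite /h /= expr0 mulr1 /p subrKC.
  by case: (stS n) => _ *; split; [exact: le_trans IH1 _|exact: le_trans IH2].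
have yb n : y0 <= (st n).2 /\ (st n).2 + q * h n <= y1.
  elim: n => [|n [IH1 IH2]]; first by rewrite /h /= expr0 mulr1 /q subrKC.
  by case: (stS n) => _ *; split; [exact: le_trans IH1 _|exact: le_trans IH2].
pose z : C := cx +i* cy.
have [d Fzd] : exists d, cdiff F z d.
  apply: Fd => /=.
    by have := hx 0%N; have := xb 0%N; lra.
  by have := hy 0%N; have := yb 0%N; lra.
have [f [fc fz fE]] := Fzd.
pose L := p + q; have L0 : 0 <= L by rewrite addr_ge0.
(* Chosen so that [4 e L^2 < K]: [bdry_bound] yields [4 (e L h) (L h)] on the [n]-th rectangle. *)
pose e := K / (4 * L ^+ 2 + 1).
have D0 : 0 < 4 * L ^+ 2 + 1 by have := sqr_ge0 L; lra.
have e0 : 0 < e by rewrite divr_gt0.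
have /ccvg_nbhs/(_ e e0)[r r0 hr] := fc.
have [n Lr] : exists n, L * h n < r.
  have hc : (fun n => L * h n) @ \oo --> L * 0.
    apply: cvgMr; apply: cvg_expr; rewrite ger0_norm; lra.
  rewrite mulr0 in hc; have /cvgrPdist_lt/(_ r r0)[n _ hn] := hc.
  exists n; have := hn n (leqnn n); rewrite sub0r normrN ger0_norm // mulr_ge0 // ltW //.
(* [F] minus its first-order expansion at [z]; it has the same boundary integral as [F]. *)
pose G w : C := F w + (-1 * (F z - d * z) + (- d) * w).
have idc : ccontinuous (fun w => w) by move=> ?; exact: ccvg_id.
have cc k : ccontinuous (fun=> k) by move=> ?; exact: ccvg_cst.
have Zc k g : ccontinuous g -> ccontinuous (fun w => k * g w).
  by move=> gc w; apply: ccvgM => //; exact: cc.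
have Dc g g' : ccontinuous g -> ccontinuous g' -> ccontinuous (fun w => g w + g' w).
  by move=> gc gc' w; exact: ccvgD.
have QG : Q n (st n) = bdry G (st n).1 ((st n).1 + p * h n) (st n).2 ((st n).2 + q * h n).
  rewrite /G bdryD //; last by apply: Dc; [exact: cc|exact: Zc].
  rewrite bdryD ?bdryZ ?bdry_cst ?bdry_id ?mulr0 ?addr0 //; exact: Zc.
have := stP n; rewrite /P QG => hK.
have GE w : G w = (f w - d) * (w - z).
  by rewrite /G -fz mulrBl -fE; rewrite fz; ring.
have Gb : cmod (bdry G (st n).1 ((st n).1 + p * h n) (st n).2 ((st n).2 + q * h n)) <=
    4 * (e * (L * h n)) * (((st n).1 + p * h n - (st n).1) + ((st n).2 + q * h n - (st n).2)).
  apply: bdry_bound.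
  - by apply: (Dc) => //; apply: (Dc); [exact: cc|exact: Zc].
  - by rewrite lerDl mulr_ge0 // ltW.
  - by rewrite lerDl mulr_ge0 // ltW.
  - move=> w wx wy; rewrite GE cmodM.
    have wz : cmod (w - z) <= L * h n.
      apply: (le_trans (cmod_le_ReIm _)); rewrite cReB cImB /= mulrDl.
      have := hx n; have := hy n; move: wx wy => /=.
      by move=> wx wy hyn hxn; apply: lerD; rewrite ler_norml; lra.
    have := hr w (le_lt_trans wz Lr); rewrite fz => /ltW he.
    by apply: ler_pM => //; exact: cmod_ge0.
have : K * h n ^+ 2 <= 4 * e * L ^+ 2 * h n ^+ 2.
  apply: (le_trans hK); apply: (le_trans Gb).
  by rewrite le_eqVlt; apply/orP; left; apply/eqP; rewrite /L; ring.
rewrite ler_pM2r ?exprn_gt0 // /e.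
have -> : 4 * (K / (4 * L ^+ 2 + 1)) * L ^+ 2 = K * (4 * L ^+ 2) / (4 * L ^+ 2 + 1).
  by field; lra.
by rewrite ler_pdivlMr // ler_pM2l //; lra.
Qed.

End ComplexIntegral.

(** * The complex exponential and the mean value property on circles *)

Section CircleMean.
Context {R : realType}.
Local Notation C := (Cplx R).
Implicit Types (F g : C -> C) (z w : C) (r t : R).

Definition cis t : C := cos t +i* sin t.

Lemma cmod_cis t : cmod (cis t) = 1.
Proof. by rewrite /Normc.normc /= cos2Dsin2 sqrtr1. Qed.

Lemma cpath_cis : cpath cis.
Proof. by move=> t; apply: ccvg_ReIm; [exact: continuous_cos|exact: continuous_sin]. Qed.

Lemma cisD s t : cis (s + t) = cis s * cis t.
Proof. by apply: complex_eq; rewrite ?cReM ?cImM /= ?cosD ?sinD //; ring. Qed.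

Definition cexp z : C := (expR (complex.Re z))%:C * cis (complex.Im z).

Lemma cexpD z w : cexp (z + w) = cexp z * cexp w.
Proof. by rewrite /cexp cReD cImD expRD cisD realcM; ring. Qed.

Lemma cexpE x y : cexp (x +i* y) = (expR x)%:C * cis y.
Proof. by []. Qed.

Lemma cexp0 : cexp 0 = 1.
Proof. by apply: complex_eq; rewrite /cexp cReM /= || rewrite /cexp cImM /=; rewrite expR0 cos0 sin0; ring. Qed.

Lemma cvg_Re z : (fun w : C => complex.Re w) @ nbhs z --> complex.Re z.
Proof. exact: ccvg_Re (ccvg_id z). Qed.

Lemma cvg_Im z : (fun w : C => complex.Im w) @ nbhs z --> complex.Im z.
Proof. exact: ccvg_Im (ccvg_id z). Qed.

Lemma ccvg_bounded0 (T : Type) (A : set_system T) (FA : Filter A) (u v : T -> C) :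
  (forall s : T, cmod (v s) <= 1) -> ccvg A u 0 -> ccvg A (fun s => u s * v s) 0.
Proof.
move=> v1 u0 e e0; apply: filterS (u0 e e0) => x /=.
rewrite !subr0 cmodM; apply: le_lt_trans.
by rewrite -[leRHS]mulr1 ler_wpM2l ?cmod_ge0.
Qed.

(** With the real slope functions [a], [b], [c] of [expR], [cos], [sin] at 0, one has
    [exp h - 1 = h + P(h) Im h + Q(h) Re h], where [P] and [Q] tend to 0. Dividing by [h] is
    harmless because [Re h / h] and [Im h / h] have modulus at most 1. *)
Lemma cdiff_cexp0 : cdiff cexp 0 1.
Proof.
have [a [aE ac a0]] := (is_derive1_caratheodory _ _ _).1 (is_derive_expR (0 : R)).
have [b [bE bc b0]] := (is_derive1_caratheodory _ _ _).1 (is_derive_cos (0 : R)).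
have [c [cE cc c0]] := (is_derive1_caratheodory _ _ _).1 (is_derive_sin (0 : R)).
rewrite expR0 in a0; rewrite sin0 oppr0 in b0; rewrite cos0 in c0.
pose X h : C := (complex.Re h)%:C / h; pose Y h : C := (complex.Im h)%:C / h.
have X1 h : cmod (X h) <= 1.
  rewrite cmod_div cmodR; have [->|h0] := eqVneq h 0; first by rewrite cmod0 invr0 mulr0.
  by rewrite ler_pdivrMr ?cmod_gt0 // mul1r le_Re_cmod.
have Y1 h : cmod (Y h) <= 1.
  rewrite cmod_div cmodR; have [->|h0] := eqVneq h 0; first by rewrite cmod0 invr0 mulr0.
  by rewrite ler_pdivrMr ?cmod_gt0 // mul1r le_Im_cmod.
have expc : (fun w : C => expR (complex.Re w)) @ nbhs (0 : C) --> expR 0.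
  by apply: (@continuous_cvg _ _ _ _ _ _ expR); [exact: continuous_expR|exact: cvg_Re].
have bc' : (fun w : C => b (complex.Im w)) @ nbhs (0 : C) --> b 0.
  by apply: (@continuous_cvg _ _ _ _ _ _ b); [exact: bc|exact: cvg_Im].
have cc' : (fun w : C => c (complex.Im w)) @ nbhs (0 : C) --> c 0.
  by apply: (@continuous_cvg _ _ _ _ _ _ c); [exact: cc|exact: cvg_Im].
have ac' : (fun w : C => a (complex.Re w)) @ nbhs (0 : C) --> a 0.
  by apply: (@continuous_cvg _ _ _ _ _ _ a); [exact: ac|exact: cvg_Re].
pose P h : C := (expR (complex.Re h))%:C * (b (complex.Im h))%:C
   + 'i * ((expR (complex.Re h))%:C * (c (complex.Im h))%:C - 1).
pose Q h : C := (a (complex.Re h))%:C - 1.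
have P0 : ccvg (nbhs (0 : C)) P 0.
  have e : (expR 0)%:C * (b 0)%:C + 'i * ((expR 0)%:C * (c 0)%:C - 1) = 0 :> C.
    by rewrite b0 c0 expR0; ring.
  rewrite -[X in ccvg _ _ X]e /P.
  apply: ccvgD; first by apply: ccvgM; exact: ccvg_real.
  apply: ccvgM; first exact: ccvg_cst.
  by apply: ccvgB; [apply: ccvgM; exact: ccvg_real|exact: ccvg_cst].
have Q0 : ccvg (nbhs (0 : C)) Q 0.
  have e : (a 0)%:C - 1 = 0 :> C by rewrite a0; ring.
  rewrite -[X in ccvg _ _ X]e /Q.
  by apply: ccvgB; [exact: ccvg_real|exact: ccvg_cst].
exists (fun h => 1 + (P h * Y h + Q h * X h)); split.
- have -> : 1 + (P 0 * Y 0 + Q 0 * X 0) = 1 + (0 + 0) :> C.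
    by rewrite /X /Y /= !mul0r !mulr0.
  by apply: ccvgD; [exact: ccvg_cst|apply: ccvgD; exact: ccvg_bounded0].
- by rewrite /X /Y /= !mul0r !mulr0 !addr0.
- move=> h; have [->|h0] := eqVneq h 0; first by rewrite !subrr mulr0.
  rewrite cexp0 subr0.
  have -> : (1 + (P h * Y h + Q h * X h)) * h = h + (P h * (Y h * h) + Q h * (X h * h)).
    by ring.
  have -> : Y h * h = (complex.Im h)%:C by rewrite /Y divfK.
  have -> : X h * h = (complex.Re h)%:C by rewrite /X divfK.
  have eE := aE (complex.Re h); have ccE := bE (complex.Im h); have sE := cE (complex.Im h).
  rewrite expR0 cos0 sin0 !subr0 in eE ccE sE.
  have e1 : expR (complex.Re h) = 1 + a (complex.Re h) * complex.Re h by rewrite -eE; ring.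
  have e2 : cos (complex.Im h) = 1 + b (complex.Im h) * complex.Im h by rewrite -ccE; ring.
  by apply: complex_eq; rewrite /cexp /P /Q !(cReD, cReB, cReM, cImD, cImB, cImM) /=
    e2 sE; move: e1; set E := expR _; set A := a _ => e1;
    rewrite ?(cReD, cReB, cReM, cImD, cImB, cImM) /=; nra.
Qed.

Lemma cdiff_cexp z : cdiff cexp z (cexp z).
Proof.
have h : cdiff (fun w => cexp z * cexp (w - z)) z (cexp z * (1 * (1 - 0))).
  apply: cdiffZ; apply: (@cdiff_comp _ cexp (fun w => w - z)).
    by apply: cdiffB; [exact: cdiff_id|exact: cdiff_cst].
  by rewrite subrr; exact: cdiff_cexp0.
rewrite subr0 !mulr1 in h; apply: cdiff_near h.
by apply: filterE => w /=; rewrite -cexpD subrKC.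
Qed.

(** Passage to the limit under the integral sign: convergence jointly in the parameter and in [t]
    near each point of the segment is uniform on the segment by compactness. *)
Lemma cint_cvg (T : Type) (A : set_system T) (FA : Filter A) (u : T -> R -> C)
    (v : R -> C) (a b : R) : a <= b ->
  A [set x | cpath (u x)] -> cpath v ->
  (forall t, a <= t <= b ->
    ccvg (filter_prod (nbhs t) A) (fun p => u p.2 p.1) (v t)) ->
  ccvg A (fun x => cint (u x) a b) (cint v a b).
Proof.
move=> ab uc vc uv e e0.
pose d := e / (2 * (b - a) + 1).
have D0 : 0 < 2 * (b - a) + 1 by lra.
have d0 : 0 < d by rewrite divr_gt0.
have d2 : 0 < d / 2 by rewrite divr_gt0.
have cK : compact `[a, b]%classic by exact: segment_compact.
have near_lt t : `[a, b]%classic t ->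
    \forall t' \near t & x \near A, cmod (u x t' - v t') < d.
  rewrite /= in_itv /= => tab.
  have h1 := uv t tab _ d2.
  have h2 : filter_prod (nbhs t) A [set p | cmod (v p.1 - v t) < d / 2].
    exact: (@cvg_fst _ _ (nbhs t) A FA _ (vc t _ d2)).
  apply: filterS2 h1 h2 => -[t' x] /= h1 h2.
  have -> : u x t' - v t' = (u x t' - v t) - (v t' - v t) by ring.
  by apply: (le_lt_trans (cmodD _ _)); rewrite cmodN; lra.
have := (compact_near_coveringP _).1 cK T A (fun x t => cmod (u x t - v t) < d) FA near_lt.
apply: filterS2 uc => x ux h /=.
have -> : cint (u x) a b - cint v a b = cint (fun t => u x t + -1 * v t) a b.
  rewrite cintD ?cintZ ?mulN1r //.
  by apply: cpathM => //; exact: cpath_cst.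
apply: (@le_lt_trans _ _ (2 * d * (b - a))).
  apply: cint_bound => //.
    by apply: cpathD => //; apply: cpathM => //; exact: cpath_cst.
  by move=> t tab; rewrite mulN1r; apply/ltW; apply: h; rewrite /= in_itv.
rewrite /d.
have -> : 2 * (e / (2 * (b - a) + 1)) * (b - a) = e * (2 * (b - a)) / (2 * (b - a) + 1).
  by field; lra.
by rewrite ltr_pdivrMr // ltr_pM2l //; lra.
Qed.

Definition circle z0 r t : C := z0 + r%:C * cis t.

(** This is [2 pi] times the mean of [g] over the circle. *)
Definition circle_mean g z0 r := cint (fun t => g (circle z0 r t)) 0 (pi *+ 2).

Lemma pi2_ge0 : 0 <= (pi *+ 2 : R).
Proof. by rewrite mulrn_wge0 // ltW // pi_gt0. Qed.

Lemma cpath_circle z0 r : cpath (circle z0 r).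
Proof.
apply: cpathD; first exact: cpath_cst.
by apply: cpathM; [exact: cpath_cst|exact: cpath_cis].
Qed.

Lemma circle_mean_cvg g z0 r : ccontinuous g ->
  ccvg (nbhs r) (circle_mean g z0) (circle_mean g z0 r).
Proof.
move=> gc; apply: cint_cvg; first exact: pi2_ge0.
- by apply: filterE => s /=; apply: cpath_comp => //; exact: cpath_circle.
- by apply: cpath_comp => //; exact: cpath_circle.
- move=> t _; apply: ccvg_comp (gc _).
  apply: ccvgD; first exact: ccvg_cst.
  apply: ccvgM.
    by apply: (@ccvg_real _ _ _ _ snd); exact: cvg_snd.
  move=> e e0; exact: (@cvg_fst _ _ (nbhs t) (nbhs r) _ _ (cpath_cis t e0)).
Qed.

(** The map [z0 + exp] sends the rectangle with sides [[ln r1, ln r2]] and [[0, 2 pi]] onto the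
    annulus. In Goursat's theorem for the composed function the horizontal sides cancel by
    periodicity, and the vertical sides give [i] times the difference of the two means. *)
Lemma circle_mean_annulus g z0 r1 r2 : ccontinuous g -> 0 < r1 -> r1 <= r2 ->
  (forall z, r1 <= cmod (z - z0) <= r2 -> exists d, cdiff g z d) ->
  circle_mean g z0 r1 = circle_mean g z0 r2.
Proof.
move=> gc r10 r12 gd.
have r20 : 0 < r2 by exact: lt_le_trans r12.
pose F z := g (z0 + cexp z).
have Ed z : exists d, cdiff (fun z => z0 + cexp z) z d.
  by exists (0 + cexp z); apply: cdiffD; [exact: cdiff_cst|exact: cdiff_cexp].
have Fc : ccontinuous F.
  by move=> z; have [d /cdiff_ccvg h] := Ed z; apply: ccvg_comp h _ (gc _).
have := @goursat_rectangle R F (ln r1) (ln r2) 0 (pi *+ 2) Fc _ pi2_ge0 _.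
rewrite ler_ln ?posrE // => /(_ r12).
rewrite /bdry.
have -> : (fun t => F (t +i* (pi *+ 2))) = (fun t => F (t +i* 0)).
  apply/funext => t; rewrite /F !cexpE /cis cos2pi sin2pi cos0 sin0 //.
have E r : 0 < r -> (fun t => F (ln r +i* t)) = (fun t => g (circle z0 r t)).
  by move=> r0; apply/funext => t; rewrite /F cexpE lnK.
rewrite (E _ r10) (E _ r20) => h.
have {h} /eqP : 'i * (circle_mean g z0 r2 - circle_mean g z0 r1) = 0.
  rewrite -[RHS]h; first by rewrite /circle_mean; ring.
  move=> z zr _; have [d1 h1] := Ed z.
  have [|d2 h2] := gd (z0 + cexp z).
    have -> : z0 + cexp z - z0 = cexp z by ring.
    rewrite /cexp cmodM cmod_cis mulr1 cmodR ger0_norm ?expR_ge0 //.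
    rewrite -[r1](lnK r10) -[r2](lnK r20) !ler_expR. exact: zr.
  by exists (d2 * d1); exact: cdiff_comp h1 h2.
rewrite mulf_eq0 subr_eq0 => /orP[/eqP[]|/eqP -> //].
by move=> /eqP; rewrite oner_eq0.
Qed.

Lemma ccvg_const_right (m : R -> C) (a b : R) (c : C) : a < b ->
  ccvg (nbhs a) m (m a) -> (forall r, a < r < b -> m r = c) -> m a = c.
Proof.
move=> ab mc h; apply/eqP; rewrite -subr_eq0 -cmod_eq0; apply/negPn/negP => n0.
have e0 : 0 < cmod (m a - c) by rewrite lt_def n0 cmod_ge0.
have := mc _ e0; rewrite /= => /nbhs_ballP[d /= d0 hd].
pose s := Num.min (a + d / 2) ((a + b) / 2).
have s1 : s <= a + d / 2 by rewrite ge_min lexx.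
have s2 : s <= (a + b) / 2 by rewrite ge_min lexx orbT.
have s3 : a < s by rewrite lt_min; apply/andP; split; lra.
have := hd s; rewrite /ball /= h; last by apply/andP; split; lra.
by rewrite cmodB ltxx => hh; apply: notF; apply: hh; rewrite ltr_norml; lra.
Qed.

Lemma ccvg_const_left (m : R -> C) (a b : R) (c : C) : a < b ->
  ccvg (nbhs b) m (m b) -> (forall r, a < r < b -> m r = c) -> m b = c.
Proof.
move=> ab mc h.
have := @ccvg_const_right (fun r => m (- r)) (- b) (- a) c; rewrite opprK; apply.
- by rewrite ltrN2.
- move=> e e0; have := mc e e0; rewrite /= => /nbhs_ballP[d /= d0 hd].
  apply/nbhs_ballP; exists d => //= s; rewrite /ball /= => hs.
  by apply: hd; rewrite /ball /= opprK addrC -normrN opprD addrC -opprD addrC; move: hs; rewrite opprD addrC.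
- by move=> r rab; apply: h; move: rab; lra.
Qed.

(** As a function of the radius the mean is continuous, equals [2 pi g(z0)] at radius 0, and is
    constant on intervals of radii that avoid [|w - z0|]. Continuity carries it across that radius,
    so [g] may be merely continuous at [z0] and at [w]. *)
Theorem circle_mean_value g z0 w r : ccontinuous g -> 0 < r ->
  (forall z, cmod (z - z0) <= r -> z != z0 -> z != w -> exists d, cdiff g z d) ->
  circle_mean g z0 r = (pi *+ 2)%:C * g z0.
Proof.
move=> gc r0 gd.
have mc := fun s => circle_mean_cvg z0 s gc.
have m0 : circle_mean g z0 0 = (pi *+ 2)%:C * g z0.
  rewrite /circle_mean /circle.
  by under [X in cint X]eq_fun do rewrite mul0r addr0; rewrite cint_cst subr0 mulrC.
rewrite -m0; set m := circle_mean g z0 in mc *.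
have K r1 r2 : 0 < r1 -> r1 <= r2 -> r2 <= r ->
    (cmod (w - z0) < r1 \/ r2 < cmod (w - z0)) -> m r1 = m r2.
  move=> r10 r12 r2r hw; apply: circle_mean_annulus => // z /andP[z1 z2].
  apply: gd; first exact: le_trans r2r.
    by apply: contraTneq z1 => ->; rewrite subrr cmod0 -ltNge.
  by apply/negP => /eqP zw; move: z1 z2; rewrite zw; case: hw; lra.
set p := cmod (w - z0) in K.
have p0 : 0 <= p by exact: cmod_ge0.
have right : p < r -> m p = m r.
  move=> pr; apply: (ccvg_const_right pr (mc p)) => s /andP[ps sr].
  by apply: K; rewrite ?(ltW sr) //; [exact: le_lt_trans ps|left].
have left b : 0 < b -> b <= r -> b <= p -> m 0 = m b.
  move=> b0 br bp.
  have b2 : 0 < b / 2 by lra.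
  have c1 s : 0 < s < b -> m s = m (b / 2).
    move=> /andP[s0 sb]; case: (lerP s (b / 2)) => hs; first by apply: K => //; [lra|right; lra].
    by symmetry; apply: K => //; [lra|lra|right; lra].
  rewrite (ccvg_const_right b0 (mc 0) c1).
  by rewrite (ccvg_const_left b0 (mc b) c1).
case: (ltrP p r) => pr; last by symmetry; apply: left.
rewrite -right //; case: (ltrP 0 p) => p00; first by symmetry; apply: left => //; exact: ltW.
by congr m; apply/eqP; rewrite eq_le p00.
Qed.

End CircleMean.

(** * Cauchy's formula, removable singularities and Weierstrass' theorem *)

Section CauchyFormula.
Context {R : realType}.
Local Notation C := (Cplx R).
Implicit Types (F g : C -> C) (z w : C) (r t : R).

Lemma ccvg_eq (T : Type) (A : set_system T) (u : T -> C) (a b : C) :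
  a = b -> ccvg A u a -> ccvg A u b.
Proof. by move=> ->. Qed.

Lemma cintB (u v : R -> C) (a b : R) : cpath u -> cpath v ->
  cint (fun t => u t - v t) a b = cint u a b - cint v a b.
Proof.
move=> uc vc; rewrite -[X in _ = _ + X]mulN1r -cintZ // -cintD //.
  by congr cint; apply/funext => t; rewrite mulN1r.
by apply: cpathM => //; exact: cpath_cst.
Qed.

Lemma cdiff_slope g (q : C -> C) z d : ccvg (nbhs z) q d ->
  nbhs z [set w | g w - g z = q w * (w - z)] -> cdiff g z d.
Proof.
move=> qd h.
pose p w := if w == z then d else q w.
pose H w := g z + p w * (w - z).
apply: (@cdiff_near _ H).
  apply: filterS h => w /=; rewrite /H /p; case: eqVneq => [-> _|_ <-].
    by rewrite subrr mulr0 addr0.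
  by rewrite subrKC.
exists p; split.
- rewrite /p eqxx => e e0; apply: filterS (qd e e0) => w /=; case: eqP => // _ _.
  by rewrite subrr cmod0.
- by rewrite /p eqxx.
- by move=> w; rewrite /H subrr mulr0 addr0 addrC addKr.
Qed.

Lemma circle_neq z0 r t w : cmod (w - z0) < r -> circle z0 r t - w != 0.
Proof.
move=> wr; rewrite subr_eq0; apply: contraTneq wr => <-.
rewrite /circle addrC addKr cmodM cmod_cis mulr1 cmodR.
by rewrite -leNgt ler_norm.
Qed.

(** With [zeta = circle z0 r t], this is the integrand of [d zeta / (i (zeta - w))]. *)
Definition cauchy_kernel z0 r w t : C := r%:C * cis t / (circle z0 r t - w).

Lemma cpath_kernel z0 r w : cmod (w - z0) < r -> cpath (cauchy_kernel z0 r w).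
Proof.
move=> wr t; apply: ccvgM.
  by apply: ccvgM; [exact: ccvg_cst|exact: cpath_cis].
apply: ccvgV; first exact: circle_neq.
by apply: ccvgB; [exact: cpath_circle|exact: ccvg_cst].
Qed.

Definition cauchy_integral g z0 r w :=
  cint (fun t => g (circle z0 r t) * cauchy_kernel z0 r w t) 0 (pi *+ 2).

(** The difference quotient of the kernel in [w] is explicit, with denominator
    [(zeta - w') (zeta - w)], and [cint_cvg] gives the continuity of its integral at [w' = w]. *)
Lemma cauchy_integral_cdiff g z0 r w : ccontinuous g -> cmod (w - z0) < r ->
  exists d, cdiff (cauchy_integral g z0 r) w d.
Proof.
move=> gc wr.
have wN : nbhs w [set w' : C | cmod (w' - z0) < r].
  apply/nbhsCP; exists (r - cmod (w - z0)) => [|w' hw' /=]; first by lra.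
  have -> : w' - z0 = (w' - w) + (w - z0) by ring.
  by apply: (le_lt_trans (cmodD _ _)); lra.
pose phi t := g (circle z0 r t) * (r%:C * cis t).
have phic : cpath phi.
  apply: cpathM; first by apply: cpath_comp => //; exact: cpath_circle.
  by apply: cpathM; [exact: cpath_cst|exact: cpath_cis].
pose u w' t := phi t * ((circle z0 r t - w')^-1 * (circle z0 r t - w)^-1).
have invc w' : cmod (w' - z0) < r -> cpath (fun t => (circle z0 r t - w')^-1).
  move=> hw t; apply: ccvgV; first exact: circle_neq.
  by apply: ccvgB; [exact: cpath_circle|exact: ccvg_cst].
have uc w' : cmod (w' - z0) < r -> cpath (u w').
  by move=> hw; apply: cpathM => //; apply: cpathM; exact: invc.
exists (cint (u w) 0 (pi *+ 2)).
apply: (@cdiff_slope _ (fun w' => cint (u w') 0 (pi *+ 2))).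
  apply: cint_cvg; [exact: pi2_ge0|exact: filterS uc wN|exact: uc|].
  move=> t _.
  have fstc v : cpath v -> ccvg (filter_prod (nbhs t) (nbhs w)) (fun p => v p.1) (v t).
    by move=> vc e e0; exact: (@cvg_fst _ _ (nbhs t) (nbhs w) _ _ (vc t e e0)).
  apply: ccvgM; first exact: fstc.
  apply: ccvgM; last exact: (fstc _ (invc _ wr)).
  apply: ccvgV; first exact: circle_neq.
  apply: ccvgB; first by apply: fstc; exact: cpath_circle.
  by move=> e e0; exact: (@cvg_snd _ _ (nbhs t) (nbhs w) _ _ (ccvg_id w e0)).
apply: filterS wN => w' hw' /=.
have kc w1 : cmod (w1 - z0) < r ->
    cpath (fun t => g (circle z0 r t) * cauchy_kernel z0 r w1 t).
  move=> h1; apply: cpathM; last exact: cpath_kernel.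
  by apply: cpath_comp => //; exact: cpath_circle.
rewrite mulrC -cintZ; last exact: uc.
rewrite /cauchy_integral -cintB; [|exact: kc|exact: kc].
congr cint; apply/funext => t; rewrite /u /phi /cauchy_kernel.
have n1 := circle_neq t hw'; have n2 := circle_neq t wr.
set c := circle z0 r t in n1 n2 *; set k := _ * cis t.
have -> : w' - w = (c - w) - (c - w') by ring.
by field; rewrite n1 n2.
Qed.

(** The kernel is [1 + v] with [|v| <= (r/4) / (3r/4) = 1/3], so the integral differs from [2 pi] by
    at most two thirds of [2 pi]. Being nonzero, it can serve as a denominator, in place of the
    exact constant of Cauchy's formula. *)
Lemma cauchy_integral1_neq0 z0 r w : 0 < r -> cmod (w - z0) <= r / 4 ->
  cauchy_integral (fun=> 1) z0 r w != 0.
Proof.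
move=> r0 wr; have wr' : cmod (w - z0) < r by lra.
rewrite /cauchy_integral.
pose v t : C := (w - z0) / (circle z0 r t - w).
have kE : (fun t => 1 * cauchy_kernel z0 r w t) = (fun t => 1 + v t).
  apply/funext => t; rewrite /cauchy_kernel /v mul1r.
  have n2 := circle_neq t wr'.
  have -> : r%:C * cis t = (circle z0 r t - w) + (w - z0) by rewrite /circle; ring.
  by rewrite mulrDl divff.
have vc : cpath v.
  move=> t; apply: ccvgM; first exact: ccvg_cst.
  apply: ccvgV; first exact: circle_neq.
  by apply: ccvgB; [exact: cpath_circle|exact: ccvg_cst].
rewrite kE cintD //; last exact: cpath_cst.
rewrite cint_cst mul1r subr0.
have p0 := pi_gt0 R.
have vb : cmod (cint v 0 (pi *+ 2)) <= 2 * (1 / 3) * (pi *+ 2 - 0).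
  apply: cint_bound => //; first exact: pi2_ge0.
  move=> t _; rewrite /v cmod_div.
  have lb : 3 * (r / 4) <= cmod (circle z0 r t - w).
    have -> : circle z0 r t - w = r%:C * cis t - (w - z0) by rewrite /circle; ring.
    have := le_cmodB (r%:C * cis t) (w - z0).
    rewrite cmodM cmod_cis mulr1 cmodR ger0_norm ?(ltW r0) //; lra.
  rewrite ler_pdivrMr; lra.
apply/negP => /eqP h.
have := vb; have -> : cint v 0 (pi *+ 2) = - (pi *+ 2)%:C.
  by apply/eqP; rewrite -addr_eq0 addrC; apply/eqP.
rewrite cmodN cmodR ger0_norm ?pi2_ge0 // -mulr_natl; lra.
Qed.

(* The mean value property of [z |-> (z - z0) (g z - g w) / (z - w)], which
   vanishes at [z0]. *)
Theorem cauchy_formula g z0 r w : ccontinuous g -> 0 < r ->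
  (forall z, cmod (z - z0) <= r -> z != z0 -> exists d, cdiff g z d) ->
  cmod (w - z0) <= r / 4 ->
  g w * cauchy_integral (fun=> 1) z0 r w = cauchy_integral g z0 r w.
Proof.
move=> gc r0 gd wr.
have wr' : cmod (w - z0) < r by lra.
have kc := cpath_kernel wr'.
have onec : ccontinuous (fun=> 1 : C) by move=> z; exact: ccvg_cst.
(* At the centre the kernel is constantly 1 and the formula is the mean value property. Elsewhere
   [g] is differentiable at [w], so the quotient [q] extends continuously there. *)
have [wz|wz] := eqVneq w z0.
  have mv := @circle_mean_value R g z0 z0 r gc r0.
  have k1 : cauchy_kernel z0 r w = fun=> 1.
    apply/funext => t; rewrite /cauchy_kernel -wz.
    have := circle_neq t wr'; rewrite -wz /circle addrAC subrr add0r => n.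
    by rewrite divff.
  rewrite /cauchy_integral k1 cintZ; last exact: cpath_cst.
  under [X in _ = cint X _ _]eq_fun do rewrite mulr1.
  rewrite cint_cst !mul1r subr0 wz mulrC.
  by rewrite -/(circle_mean g z0 r) mv // => z zr zz _; exact: gd.
have [d [q [qc qd qE]]] : exists d, cdiff g w d by apply: gd => //; exact: ltW.
pose Q z := (z - z0) * q z.
have gq z : z != w -> q z = (g z - g w) / (z - w).
  by move=> zw; rewrite qE mulfK // subr_eq0.
have qcc : ccontinuous q.
  move=> z; have [->//|zw] := eqVneq z w.
  have zN : nbhs z [set x : C | x != w].
    apply/nbhsCP; exists (cmod (z - w)); first by rewrite cmod_gt0 subr_eq0.
    by move=> x; apply: contraTneq => ->; rewrite cmodB ltxx.
  rewrite (gq z) //; apply: (@ccvg_near _ _ _ _ (fun x => (g x - g w) / (x - w))).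
    by apply: filterS zN => x /= xw; rewrite gq.
  apply: ccvgM; first by apply: ccvgB; [exact: gc|exact: ccvg_cst].
  apply: ccvgV; first by rewrite subr_eq0.
  by apply: ccvgB; [exact: ccvg_id|exact: ccvg_cst].
have Qc : ccontinuous Q.
  move=> z; apply: ccvgM => //.
  by apply: ccvgB; [exact: ccvg_id|exact: ccvg_cst].
have : circle_mean Q z0 r = 0.
  rewrite (@circle_mean_value R Q z0 w r Qc r0); first by rewrite /Q subrr mul0r mulr0.
  move=> z zr zz zw; have [a ga] := gd z zr zz.
  have [b hb] : exists b, cdiff (fun x => (g x - g w) / (x - w)) z b.
    eexists; apply: cdiff_div; first by rewrite subr_eq0.
      by apply: cdiffB; [exact: ga|exact: cdiff_cst].
    by apply: cdiffB; [exact: cdiff_id|exact: cdiff_cst].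
  eexists; apply: cdiffM; first by apply: cdiffB; [exact: cdiff_id|exact: cdiff_cst].
  apply: cdiff_near hb; apply/nbhsCP; exists (cmod (z - w)); first by rewrite cmod_gt0 subr_eq0.
  move=> x xz /=; rewrite gq //; apply: contraTneq xz => ->; by rewrite cmodB ltxx.
have QE t : Q (circle z0 r t) = g (circle z0 r t) * cauchy_kernel z0 r w t
    + (- g w) * (1 * cauchy_kernel z0 r w t).
  have n := circle_neq t wr'.
  rewrite /Q gq; last by rewrite -subr_eq0.
  rewrite /cauchy_kernel; have -> : circle z0 r t - z0 = r%:C * cis t.
    by rewrite /circle; ring.
  by ring.
rewrite /circle_mean; under [X in cint X _ _]eq_fun do rewrite QE.
rewrite cintD.
- rewrite cintZ; last by apply: cpathM => //; exact: cpath_cst.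
  by rewrite mulNr => /eqP; rewrite subr_eq0 => /eqP h; symmetry; exact: h.
- by apply: cpathM => //; apply: cpath_comp => //; exact: cpath_circle.
- by apply: cpathM; [exact: cpath_cst|apply: cpathM => //; exact: cpath_cst].
Qed.

Lemma cauchy_quotient_cdiff g z0 r w : ccontinuous g -> 0 < r ->
  cmod (w - z0) <= r / 4 -> exists d,
  cdiff (fun w => cauchy_integral g z0 r w / cauchy_integral (fun=> 1) z0 r w) w d.
Proof.
move=> gc r0 wr; have wr' : cmod (w - z0) < r by lra.
have [a ha] := cauchy_integral_cdiff gc wr'.
have [b hb] : exists d, cdiff (cauchy_integral (fun=> 1) z0 r) w d.
  by apply: cauchy_integral_cdiff => // z; exact: ccvg_cst.
eexists; apply: cdiff_div ha hb; exact: cauchy_integral1_neq0.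
Qed.

(** By [cauchy_formula], which tolerates a bad centre, [g] coincides near [z0] with a quotient of
    two Cauchy integrals, and this quotient is differentiable at [z0] as well. *)
Theorem removable_singularity g z0 : ccontinuous g ->
  (forall z, z != z0 -> exists d, cdiff g z d) -> exists d, cdiff g z0 d.
Proof.
move=> gc gd.
have [|d hd] := @cauchy_quotient_cdiff g z0 1 z0 gc ltr01.
  by rewrite subrr cmod0; lra.
exists d; apply: cdiff_near hd; apply/nbhsCP; exists (1 / 4); first by lra.
move=> w /ltW wz /=.
have := @cauchy_formula g z0 1 w gc ltr01 _ wz => <-; last by move=> z _; exact: gd.
by rewrite mulfK // cauchy_integral1_neq0.
Qed.

(** Cauchy's formula on a unit circle passes to uniform limits, so [g] is locally a quotient of
    Cauchy integrals. *)
Theorem weierstrass_limit (T : Type) (A : set_system T) (u : T -> C -> C) g :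
  ProperFilter A ->
  (forall x z, exists d, cdiff (u x) z d) ->
  (forall r e : R, 0 < e ->
    A [set x | forall z, cmod z <= r -> cmod (u x z - g z) <= e]) ->
  forall z, exists d, cdiff g z d.
Proof.
move=> PA ud ug z0.
have uc x : ccontinuous (u x) by move=> z; have [d /cdiff_ccvg] := ud x z.
have gc : ccontinuous g.
  move=> z e e0; have e3 : 0 < e / 4 by lra.
  have /filter_ex[x hx] := ug (cmod z + 1) _ e3.
  have /ccvg_nbhs/(_ _ e3)[d d0 hd] := uc x z.
  apply/nbhsCP; exists (Num.min d 1); first by rewrite lt_min d0 ltr01.
  move=> w; rewrite lt_min => /andP[wd w1] /=.
  have h1 : cmod (u x w - g w) <= e / 4.
    apply: hx; rewrite -[w](subrK z) addrC; apply: (le_trans (cmodD _ _)).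
    by rewrite lerD2l ltW.
  have h2 : cmod (u x z - g z) <= e / 4 by apply: hx; rewrite lerDl ler01.
  have h3 := hd w wd.
  have -> : g w - g z = (u x w - u x z) - (u x w - g w) + (u x z - g z) by ring.
  apply: (le_lt_trans (cmodD _ _)); have := cmodD (u x w - u x z) (- (u x w - g w)).
  rewrite cmodN /=; lra.
have [|d hd] := @cauchy_quotient_cdiff g z0 1 z0 gc ltr01.
  by rewrite subrr cmod0; lra.
exists d; apply: cdiff_near hd; apply/nbhsCP; exists (1 / 4); first by lra.
move=> w /ltW wz /=.
have c0 := cauchy_integral1_neq0 ltr01 wz.
suff <- : g w * cauchy_integral (fun=> 1) z0 1 w = cauchy_integral g z0 1 w.
  by rewrite mulfK.
have wr' : cmod (w - z0) < 1 by lra.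
set c := cauchy_integral (fun=> 1) z0 1 w in c0 *.
apply/eqP; rewrite -subr_eq0 -cmod_eq0; apply/negPn/negP => n0.
set D := cmod _ in n0.
have D0 : 0 < D by rewrite lt_def n0 cmod_ge0.
have p0 := pi_gt0 R.
(* If the two sides differ by [D], approximating [g] within [e] gives [D <= e K]: the term [e |c|]
   comes from the value at [w], and [2 (4 e) 2 pi] from the integral, the kernel being at most
   [4/3 <= 4]. The choice [e = D / (2K)] is then absurd. *)
pose K := cmod c + 8 * (pi *+ 2).
have K0 : 0 < K by rewrite /K ltr_wpDl ?cmod_ge0 // -mulr_natl; lra.
have e0 : 0 < D / (2 * K) by rewrite divr_gt0 // mulr_gt0.
have /filter_ex[x hx] := ug (cmod z0 + 1) _ e0.
set e := D / (2 * K) in e0 hx.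
have xf : u x w * c = cauchy_integral (u x) z0 1 w.
  by apply: cauchy_formula => // z _ _; exact: ud.
have kc := cpath_kernel wr'.
have h1 : cmod (u x w - g w) <= e.
  by apply: hx; have := cmodD z0 (w - z0); rewrite subrKC; lra.
have h2 : cmod (cauchy_integral (u x) z0 1 w - cauchy_integral g z0 1 w) <=
    2 * (e * 4) * (pi *+ 2 - 0).
  have circ (h : C -> C) : ccontinuous h -> cpath (fun t => h (circle z0 1 t)).
    by move=> hc; apply: cpath_comp => //; exact: cpath_circle.
  rewrite /cauchy_integral -cintB; try by apply: cpathM => //; exact: circ.
  apply: cint_bound; last 1 first.
  - move=> t _.
    rewrite -mulrBl.
    have rc : cmod ((1 : R)%:C * cis t) = 1 by rewrite cmodM cmod_cis cmodR normr1 mulr1.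
    rewrite cmodM; apply: ler_pM; rewrite ?cmod_ge0 //.
      by apply: hx; rewrite /circle; apply: (le_trans (cmodD _ _)); rewrite rc.
    rewrite /cauchy_kernel cmod_div rc.
    have lb : 3 / 4 <= cmod (circle z0 1 t - w).
      have -> : circle z0 1 t - w = (1 : R)%:C * cis t - (w - z0) by rewrite /circle; ring.
      have := le_cmodB ((1 : R)%:C * cis t) (w - z0); rewrite rc; lra.
    by rewrite ler_pdivrMr; lra.
  - by move=> t; apply: ccvgB; apply: ccvgM; [exact: circ|exact: kc|exact: circ|exact: kc].
  - exact: pi2_ge0.
have : D <= e * K.
  rewrite /D; have -> : g w * c - cauchy_integral g z0 1 w =
    (cauchy_integral (u x) z0 1 w - cauchy_integral g z0 1 w) - (u x w - g w) * c.
    by rewrite -xf; ring.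
  apply: (le_trans (cmodD _ _)); rewrite cmodN cmodM /K.
  have : cmod (u x w - g w) * cmod c <= e * cmod c by rewrite ler_wpM2r ?cmod_ge0.
  rewrite subr0 in h2; lra.
have -> : e * K = D / 2 by rewrite /e; field; rewrite ?gt_eqF //; lra.
lra.
Qed.

End CauchyFormula.

(** * The maximum principle in the upper half plane *)

Section MaximumModulus.
Context {R : realType}.
Local Notation C := (Cplx R).
Implicit Types (F h : C -> C) (z w : C).

Lemma rectangle_cmod_max F (a b c d : R) : ccontinuous F -> a <= b -> c <= d ->
  exists z0 : C, [/\ a <= complex.Re z0 <= b, c <= complex.Im z0 <= d &
    forall z, a <= complex.Re z <= b -> c <= complex.Im z <= d ->
      cmod (F z) <= cmod (F z0)].
Proof.
move=> Fc ab cd.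
pose f (p : R * R) := cmod (F (p.1 +i* p.2)).
have fc : continuous f.
  move=> p; apply: (@ccvg_cmod _ _ (nbhs p)).
  apply: ccvg_comp (Fc _).
  by apply: ccvg_ReIm; [exact: cvg_fst|exact: cvg_snd].
have [|||[x y]] := @compact_EVT_max (R * R)%type R f (`[a, b]%classic `*` `[c, d]%classic).
- by exists (a, c); split; rewrite /= in_itv /= lexx ?ab ?cd.
- by apply: compact_setX; exact: segment_compact.
- exact: continuous_subspaceT.
rewrite inE /= !in_itv /= => -[xab ycd] hf; exists (x +i* y); split=> // -[x' y'] /= xz yz.
by apply: (hf (x', y')); rewrite inE; split; rewrite /= in_itv.
Qed.

Lemma bounded_on_disc F r : ccontinuous F ->
  exists B, forall z, cmod z <= r -> cmod (F z) <= B.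
Proof.
move=> Fc; have [r0|r0] := lerP 0 r; last first.
  by exists 0 => z zr; have := cmod_ge0 z; lra.
have rr : - r <= r by lra.
have [z0 [_ _ h]] := rectangle_cmod_max Fc rr rr.
exists (cmod (F z0)) => z zr.
have := le_Re_cmod z; have := le_Im_cmod z; rewrite !ler_norml => h1 h2.
by apply: h; lra.
Qed.

Lemma circle_bottom z0 (r : R) : circle z0 r (pi + pi / 2) = z0 - 'i * r%:C.
Proof.
rewrite /circle; congr (_ + _); apply: complex_eq; rewrite ?cReM ?cImM /=.
  by rewrite cosDpihalf sinpi; ring.
by rewrite sinDpihalf cospi; ring.
Qed.

(* The mean value property on the disc that touches the real line from above
   forces the maximum to be attained on the real line as well; the function is
   first extended continuously below it, constantly along vertical lines. *)
Theorem maximum_modulus_halfplane h (B : R) :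
  (forall z, 0 <= complex.Im z -> exists d, cdiff h z d) ->
  (forall e : R, 0 < e ->
    exists r, forall z, 0 <= complex.Im z -> r < cmod z -> cmod (h z) <= e) ->
  (forall x : R, cmod (h x%:C) <= B) ->
  forall z, 0 <= complex.Im z -> cmod (h z) <= B.
Proof.
move=> hd hoo hB z1 z1i; rewrite leNgt; apply/negP => Bz1.
pose k z : C := complex.Re z +i* Num.max (complex.Im z) 0.
have kid z : 0 <= complex.Im z -> k z = z.
  by case: z => a b /= b0; rewrite /k /= max_l.
have kim z : 0 <= complex.Im (k z) by rewrite /k /= le_max lexx orbT.
pose H z := h (k z).
have Hc : ccontinuous H.
  move=> z; have [d /cdiff_ccvg hc] := hd _ (kim z).
  apply: ccvg_comp hc; apply: ccvg_ReIm; first exact: cvg_Re.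
  apply: (@continuous_max _ _ (fun w : C => complex.Im w) (fun=> 0) z); first exact: cvg_Im.
  exact: cst_continuous.
have HE z : 0 <= complex.Im z -> H z = h z by move=> z0; rewrite /H kid.
set S := cmod (h z1) in Bz1.
have S0 : 0 < S by apply: le_lt_trans Bz1; exact: le_trans (cmod_ge0 _) (hB 0).
have S2 : 0 < S / 2 by lra.
have [r hr] := hoo _ S2.
have z1r : cmod z1 <= r by rewrite leNgt; apply/negP => /(hr _ z1i); rewrite -/S; lra.
have r0 : 0 <= r by apply: le_trans z1r; exact: cmod_ge0.
have rr : - r <= r by lra.
have [z0 [z0x z0y z0max]] := rectangle_cmod_max Hc rr r0.
have z0i : 0 <= complex.Im z0 by case/andP: z0y.
have Sz0 : S <= cmod (h z0).
  rewrite -(HE _ z0i) /S -(HE _ z1i); apply: z0max.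
    by have := le_Re_cmod z1; rewrite ler_norml; lra.
  by have := le_Im_cmod z1; rewrite ler_norml z1i; lra.
have hmax z : cmod (H z) <= cmod (h z0).
  have := kim z; rewrite /H; set y := k z => y0.
  have [yr|ry] := lerP (cmod y) r; last by have := hr _ y0 ry; lra.
  rewrite -(HE _ z0i) -(HE _ y0); apply: z0max.
    by have := le_Re_cmod y; rewrite ler_norml; lra.
  by have := le_Im_cmod y; rewrite ler_norml y0; lra.
pose x0 := complex.Re z0; pose y0 := complex.Im z0.
have y00 : 0 < y0.
  rewrite lt_def z0i andbT; apply/negP => /eqP y00.
  have := hB x0; rewrite -(realc y00); lra.
have mv : circle_mean H z0 y0 = (pi *+ 2)%:C * H z0.
  (* The closed disc of radius [Im z0] about [z0] meets the real line only at [x0]. There the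
     extension [H] is only known to be continuous, so [x0] is taken as the second exceptional
     point. *)
  apply: (@circle_mean_value _ H z0 x0%:C) => // z zz0 _ zx0.
  have zi : 0 < complex.Im z.
    have := le_Im_cmod (z - z0); rewrite cImB -/y0 ler_norml => hi.
    rewrite lt_neqAle; apply/andP; split; last by lra.
    apply: contraNneq zx0 => zi0.
    have : cmod (z - z0) ^+ 2 <= y0 ^+ 2 by rewrite ler_pXn2r ?nnegrE ?cmod_ge0 //; exact: z0i.
    rewrite cmod_sqr cReB cImB -zi0 -/y0 sub0r sqrrN -lerBrDr subrr => hx.
    have /eqP : (complex.Re z - x0) ^+ 2 == 0 by rewrite eq_le hx sqr_ge0.
    move=> /eqP; rewrite sqrf_eq0 subr_eq0 => /eqP zx.
    by apply/eqP; apply: complex_eq; rewrite /= -?zi0.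
  have [d hzd] := hd z (ltW zi); exists d; apply: cdiff_near hzd.
  apply/nbhsCP; exists (complex.Im z) => // w wz /=; rewrite HE //.
  by have := le_Im_cmod (w - z); rewrite cImB ler_norml; lra.
pose a := (h z0)^*.
have aH : cint (fun t => a * H (circle z0 y0 t)) 0 (pi *+ 2) = (pi *+ 2 * cmod (h z0) ^+ 2)%:C.
  rewrite cintZ; last by apply: cpath_comp => //; exact: cpath_circle.
  rewrite -/(circle_mean H z0 y0) mv HE // realcM mulrCA; congr (_ * _).
  by apply: complex_eq; rewrite ?cReM ?cImM /a ?cmod_sqr; case: (h z0) => p q /=; ring.
(* By maximality [u] is nonnegative, and by the mean value property its integral is 0. Hence [u]
   vanishes at the angle [3 pi / 2], where the circle touches the real line. *)
pose u t := cmod (h z0) ^+ 2 + (-1) * complex.Re (a * H (circle z0 y0 t)).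
have pc : cpath (fun t => a * H (circle z0 y0 t)).
  by apply: cpathM; [exact: cpath_cst|apply: cpath_comp => //; exact: cpath_circle].
have rc : continuous (fun t => (-1) * complex.Re (a * H (circle z0 y0 t))).
  by move=> t; apply: cvgMr; exact: (cpath_Re pc).
have kc : continuous ((fun=> cmod (h z0) ^+ 2) : R -> R) by move=> t; exact: cvg_cst.
have uc : continuous u by move=> t; apply: cvgD; [exact: kc|exact: rc].
have u0 t : 0 <= u t.
  have : complex.Re (a * H (circle z0 y0 t)) <= cmod (a * H (circle z0 y0 t)).
    by apply: le_trans (ler_norm _) _; exact: le_Re_cmod.
  rewrite cmodM cmod_conj.
  have := ler_wpM2l (cmod_ge0 (h z0)) (hmax (circle z0 y0 t)).
  rewrite /u expr2; lra.
have ui : rint u 0 (pi *+ 2) = 0.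
  have rc' := cpath_Re pc.
  rewrite rintD; [rewrite rint_cst rintZ; last exact: rc'|exact: kc|exact: rc].
  have := congr1 (@complex.Re R) aH; rewrite /cint /= => ->; ring.
have p0 := pi_gt0 R.
have pin : 0 < (pi : R) + pi / 2 < pi *+ 2.
  by rewrite (mulr2n (pi : R)); lra.
have := rint_ge0_eq0 uc (fun t _ => u0 t) ui pin.
rewrite /u circle_bottom.
have -> : z0 - 'i * y0%:C = x0%:C.
  by apply: complex_eq; rewrite ?cReB ?cImB ?cReM ?cImM /= -/x0 -/y0; ring.
rewrite HE //= => e.
have : cmod (h z0) ^+ 2 <= cmod (h z0) * B.
  have -> : cmod (h z0) ^+ 2 = complex.Re (a * h x0%:C) by lra.
  apply: le_trans (ler_norm _) _; apply: le_trans (le_Re_cmod _) _.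
  by rewrite cmodM cmod_conj ler_wpM2l ?cmod_ge0.
by rewrite expr2 ler_pM2l; lra.
Qed.

End MaximumModulus.

(** * Partial fractions of the squared cosecant, with explicit remainder *)

Section CosecantSquared.
Context {R : realType}.
Implicit Types (x y t : R) (n N : nat).

Lemma cos_sqrDpin n y : cos (y + n%:R * pi) ^+ 2 = cos y ^+ 2.
Proof.
elim: n => [|n IH]; first by rewrite mul0r addr0.
by rewrite -natr1 mulrDl mul1r addrA cosDpi sqrrN.
Qed.

Lemma cos_sqrDpiz (m : int) y : cos (y + m%:~R * pi) ^+ 2 = cos y ^+ 2.
Proof.
case: m => n; first by rewrite -pmulrn cos_sqrDpin.
by rewrite NegzE mulrNz mulNr -(cos_sqrDpin n.+1 (y - _)) -pmulrn subrK.
Qed.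

Lemma sin_sqrDpiz (m : int) y : sin (y + m%:~R * pi) ^+ 2 = sin y ^+ 2.
Proof.
have := cos_sqrDpiz m y; have := cos2Dsin2 y; have := cos2Dsin2 (y + m%:~R * pi).
lra.
Qed.

Lemma cos_eq0P y : cos y = 0 -> exists m : int, y = pi / 2 + m%:~R * pi.
Proof.
move=> cy; have p0 := pi_gt0 R.
pose m : int := Num.floor (y / pi).
have /andP[m1 m2] : m%:~R <= y / pi < (m + 1)%:~R by apply: floor_itv.
exists m; pose r := y - m%:~R * pi.
have yE : y = r + m%:~R * pi by rewrite /r subrK.
have r0 : 0 <= r by rewrite /r subr_ge0 -ler_pdivlMr.
have r1 : r < pi.
  rewrite /r ltrBlDl; move: m2; rewrite ltr_pdivrMr // intrD mulrDl mul1r //.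
have cr : cos r = 0.
  by apply/eqP; rewrite -sqrf_eq0 -(cos_sqrDpiz m) -yE cy expr0n.
suff -> : pi / 2 = r by [].
apply: cos_inj; rewrite ?cos_pihalf // in_itv /=; apply/andP; split; lra.
Qed.

Lemma sin_le y : 0 <= y -> sin y <= y.
Proof.
move=> y0; have [|c _] := @MVT_segment R sin cos 0 y y0 (fun x _ => is_derive_sin x).
- by apply: continuous_subspaceT; exact: continuous_sin.
- by rewrite sin0 !subr0 => ->; rewrite -[leRHS]mul1r ler_wpM2r // cos_le1.
Qed.

Lemma mul_cos_le_sin y : 0 <= y <= pi -> y * cos y <= sin y.
Proof.
move=> /andP[y0 y1].
have D x : is_derive x 1 (fun z => sin z - z * cos z) (x * sin x).
  have h := is_deriveB (is_derive_sin x) (is_deriveM (is_derive_id x (1 : R)) (is_derive_cos x)).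
  by apply: (is_derive_eq h); rewrite /GRing.scale /=; ring.
have [|c] := @MVT_segment R _ _ 0 y y0 (fun x _ => D x).
- by apply: derivable_within_continuous => x _; have [] := D x.
- rewrite in_itv /= sin0 mul0r !subr0 => /andP[c0 cy] e.
  rewrite -subr_ge0 e !mulr_ge0 // sin_ge0_pi //.
  by rewrite c0 (le_trans cy).
Qed.

(** Both bounds come from [y cos y <= sin y <= y]; squaring the left inequality gives
    [y^2 (1 - sin^2 y) <= sin^2 y]. *)
Lemma csc_sqr_bounds y : 0 < `|y| < pi / 2 ->
  y ^- 2 <= sin y ^- 2 <= 1 + y ^- 2.
Proof.
wlog y0 : y / 0 < y.
  move=> h hy; have [y0|y0|y0] := ltrgtP y 0; last by move: hy; rewrite y0 normr0 ltxx.
    by have := h (- y); rewrite sinN !sqrrN normrN oppr_gt0; apply.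
  exact: h.
rewrite gtr0_norm // => /andP[_ y1].
have p0 := pi_gt0 R.
have s0 : 0 < sin y by rewrite sin_gt0_pi // y0 /=; lra.
have c0 : 0 < cos y by rewrite cos_gt0_pihalf //; apply/andP; split; lra.
have h1 := sin_le (ltW y0).
have h2 : y * cos y <= sin y by apply: mul_cos_le_sin; apply/andP; split; lra.
apply/andP; split.
  by rewrite lef_pV2 ?posrE ?exprn_gt0 // ler_pXn2r ?nnegrE // ltW.
have h3 : (y * cos y) ^+ 2 <= sin y ^+ 2.
  by rewrite ler_pXn2r ?nnegrE ?(ltW s0) // mulr_ge0 ?ltW.
have y20 : 0 < y ^+ 2 by rewrite exprn_gt0.
have s20 : 0 < sin y ^+ 2 by rewrite exprn_gt0.
have -> : 1 + y ^- 2 = (y ^+ 2 + 1) / y ^+ 2 by rewrite mulrDl divff ?gt_eqF // mul1r.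
rewrite ler_pdivlMr // mulrC ler_pdivrMr //.
have := cos2Dsin2 y; rewrite exprMn in h3; nra.
Qed.

Lemma sin_pow2_eq0 N y : sin y = 0 -> sin (2 ^+ N * y) = 0.
Proof.
move=> sy; elim: N => [|N IH]; first by rewrite expr0 mul1r.
by rewrite exprS -mulrA mulr_natl sin_mulr2n IH mulr0 mul0rn.
Qed.

Lemma sum_nat_double n (F : nat -> R) :
  \sum_(0 <= k < n + n) F k = \sum_(0 <= k < n) (F k + F (k + n)%N).
Proof.
rewrite (@big_cat_nat _ _ _ n) ?leq_addr //= big_split /=; congr (_ + _).
by rewrite -{1}[n]add0n big_addn addnK.
Qed.

(** Iteration of the duplication identity [4 / sin^2 y = 1 / sin^2 (y/2) + 1 / sin^2 ((y + pi)/2)];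
    the terms [k] and [k + 2^N] of one level come from the term [k] of the previous one. *)
Lemma csc_sqr_sum N t : sin t != 0 ->
  sin t ^- 2 = \sum_(0 <= k < 2 ^ N) (4 ^+ N * sin ((t + k%:R * pi) / 2 ^+ N) ^+ 2)^-1.
Proof.
move=> st; elim: N => [|N IH].
  by rewrite expn0 big_nat1 mul0r addr0 !expr0 divr1 mul1r.
rewrite IH expnS mul2n -addnn sum_nat_double.
apply: eq_bigr => k _.
set y := (t + k%:R * pi) / 2 ^+ N.
have n2 : (2 ^+ N : R) != 0 by rewrite expf_neq0.
have e1 : (t + k%:R * pi) / 2 ^+ N.+1 = y / 2.
  by rewrite /y exprS invfM; ring.
have e2 : (t + (k + 2 ^ N)%:R * pi) / 2 ^+ N.+1 = y / 2 + pi / 2.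
  by rewrite /y exprS natrD natrX; field.
have sy : sin y != 0.
  apply: contraNneq st => /(sin_pow2_eq0 N); rewrite /y mulrC divfK // => h.
  by rewrite -sqrf_eq0 -(sin_sqrDpiz k%:Z) -pmulrn h expr0n.
rewrite e1 e2 sinDpihalf.
have yE : sin y = 2 * (cos (y / 2) * sin (y / 2)).
  by rewrite mulr_natl -sin_mulr2n; congr sin; rewrite -mulr_natl; field.
move: sy; rewrite yE !mulf_eq0 !negb_or => /and3P[_ c0 s0].
have cs := cos2Dsin2 (y / 2).
rewrite (exprS (4 : R)); set c := cos _ in c0 cs *; set s := sin _ in s0 cs *.
have q4 : (4 ^+ N : R) != 0 by rewrite expf_neq0.
have -> : (4 * 4 ^+ N * s ^+ 2)^-1 + (4 * 4 ^+ N * c ^+ 2)^-1 =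
  (c ^+ 2 + s ^+ 2) / (4 * 4 ^+ N * (s * c) ^+ 2) by field; rewrite c0 s0 q4.
by rewrite cs; field; rewrite c0 s0 q4.
Qed.

(* The terms are indexed from the far left: [t + k pi - 2 ^ N pi] runs
   symmetrically through [] -2 ^ N pi, 2 ^ N pi [[]. *)
Lemma sum_inv_sqr N t : 0 < t < pi ->
  1 - 2^-1 ^+ N <=
    \sum_(0 <= k < 2 ^ N.+1) sin t ^+ 2 / (t + k%:R * pi - 2 ^+ N * pi) ^+ 2 <= 1.
Proof.
move=> tp; have p0 := pi_gt0 R.
have s0 : 0 < sin t by apply: sin_gt0_pi.
have s20 : 0 < sin t ^+ 2 by rewrite exprn_gt0.
have s1 : sin t ^+ 2 <= 1 by have := cos2Dsin2 t; have := sqr_ge0 (cos t); lra.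
pose t' := t - 2 ^+ N * pi.
have st' : sin t' ^+ 2 = sin t ^+ 2.
  rewrite -(sin_sqrDpiz (2 ^ N)%N%:Z t') -pmulrn natrX /t' subrK //.
have st'0 : sin t' != 0 by rewrite -sqrf_eq0 st' gt_eqF.
have := csc_sqr_sum N.+1 st'0; rewrite st' => E.
set P := \sum_(0 <= k < _) _.
have n0 : (0 : R) < 2 ^+ N by rewrite exprn_gt0.
(* By [csc_sqr_bounds] each partial fraction is within [4^-(N+1)] of the corresponding cosecant
   term. There are [2^(N+1)] terms, and the cosecant terms sum exactly to 1, so the loss is at most
   [2^-(N+1)]. *)
have B k : (k < 2 ^ N.+1)%N ->
  sin t ^+ 2 / (t + k%:R * pi - 2 ^+ N * pi) ^+ 2 <=
    sin t ^+ 2 * (4 ^+ N.+1 * sin ((t' + k%:R * pi) / 2 ^+ N.+1) ^+ 2)^-1 <=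
    sin t ^+ 2 / (t + k%:R * pi - 2 ^+ N * pi) ^+ 2 + (4 ^+ N.+1)^-1.
  move=> kN.
  have -> : t + k%:R * pi - 2 ^+ N * pi = t' + k%:R * pi by rewrite /t'; ring.
  set v := t' + k%:R * pi; pose y := v / 2 ^+ N.+1.
  have kN' : k%:R + 1 <= 2 * 2 ^+ N :> R.
    by rewrite natr1 -exprS -natrX ler_nat.
  have k0 : 0 <= k%:R :> R by [].
  have vlo : - (2 ^+ N * pi) < v.
    by rewrite /v /t'; have := mulr_ge0 k0 (ltW p0); lra.
  have vhi : v < 2 ^+ N * pi.
    rewrite /v /t'; have := ler_wpM2r (ltW p0) kN'; lra.
  have yE : v = y * 2 ^+ N.+1 by rewrite /y divfK // expf_neq0.
  have v0 : v != 0.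
    apply: contraTneq s20 => v0; rewrite -st' -(sin_sqrDpiz k%:Z) -pmulrn -/v v0.
    by rewrite sin0 expr0n ltxx.
  have y0 : 0 < `|y| < pi / 2.
    rewrite normr_gt0 mulf_neq0 ?invr_eq0 ?expf_neq0 //=.
    rewrite /y normrM normfV (ger0_norm (_ : 0 <= 2 ^+ N.+1)) ?exprn_ge0 //.
    rewrite ltr_pdivrMr ?exprn_gt0 // exprS ltr_norml.
    apply/andP; split; lra.
  have := csc_sqr_bounds y0.
  have n4 : (4 : R) ^+ N.+1 = (2 ^+ N.+1) ^+ 2.
    by rewrite -exprM mulnC exprM; congr (_ ^+ _); rewrite expr2; lra.
  have -> : v ^+ 2 = y ^+ 2 * 4 ^+ N.+1 by rewrite {1}yE n4 exprMn.
  rewrite -/y (invfM (y ^+ 2)) (invfM (4 ^+ N.+1)) => /andP[b1 b2].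
  have q0 : (0 : R) < 4 ^- N.+1 by rewrite invr_gt0 exprn_gt0.
  apply/andP; split.
    by rewrite (ler_wpM2l (ltW s20)) // [leLHS]mulrC (ler_wpM2l (ltW q0)).
  have : sin t ^+ 2 * (4 ^- N.+1 * sin y ^- 2) <= sin t ^+ 2 * (4 ^- N.+1 * (1 + y ^- 2)).
    by rewrite (ler_wpM2l (ltW s20)) // (ler_wpM2l (ltW q0)).
  have : sin t ^+ 2 * 4 ^- N.+1 <= 4 ^- N.+1 by rewrite -[leRHS]mul1r (ler_wpM2r (ltW q0)).
  lra.
have E1 : \sum_(0 <= k < 2 ^ N.+1)
    sin t ^+ 2 * (4 ^+ N.+1 * sin ((t' + k%:R * pi) / 2 ^+ N.+1) ^+ 2)^-1 = 1.
  by rewrite -mulr_sumr -E divff // gt_eqF.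
apply/andP; split.
  suff : 1 <= P + 2^-1 ^+ N.+1.
    have h0 : 0 <= (2^-1 : R) ^+ N.+1 by rewrite exprn_ge0.
    have e : (2^-1 : R) ^+ N = 2 * 2^-1 ^+ N.+1 by rewrite exprS mulrA divff // mul1r.
    lra.
  have -> : 2^-1 ^+ N.+1 = \sum_(0 <= k < 2 ^ N.+1) (4 ^+ N.+1)^-1 :> R.
    rewrite sumr_const_nat subn0 -[RHS]mulr_natl natrX.
    have -> : (4 : R) = 2 * 2 by lra.
    by rewrite exprMn invfM mulrA divff ?mul1r ?exprVn // expf_neq0.
  rewrite -[X in X <= _]E1 /P -big_split /= !big_nat; apply: ler_sum => k /andP[_ kN].
  by case/andP: (B k kN).
rewrite -[X in _ <= X]E1 /P !big_nat; apply: ler_sum => k /andP[_ kN].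
by case/andP: (B k kN).
Qed.

End CosecantSquared.

(** * Nodes of a bilipschitz phase and their weights *)

Section PhaseNodes.
Context {R : realType}.
Implicit Types (phi : R -> R) (x y t a b : R) (N : nat) (J D : seq R).

Definition bilipschitz phi a b :=
  forall x y, x <= y -> a * (y - x) <= phi y - phi x <= b * (y - x).

Lemma bilipschitz_dist phi a b x y : bilipschitz phi a b ->
  0 < a -> a * `|x - y| <= `|phi x - phi y| <= b * `|x - y|.
Proof.
move=> h a0; wlog xy : x y / x <= y.
  by move=> H; case/orP: (le_total x y) => /H //; rewrite (distrC y) (distrC (phi y)).
have /andP[h1 h2] := h _ _ xy.
rewrite distrC (distrC (phi x)) (ger0_norm (_ : 0 <= y - x)) ?subr_ge0 //.
rewrite ger0_norm ?h1 //; apply: le_trans h1.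
by rewrite mulr_ge0 ?(ltW a0) // subr_ge0.
Qed.

Lemma bilipschitz_inj phi a b : bilipschitz phi a b -> 0 < a -> injective phi.
Proof.
move=> h a0 x y e; have := bilipschitz_dist x y h a0.
rewrite e subrr normr0 => /andP[h1 _]; apply/eqP; rewrite -subr_eq0 -normr_eq0.
by rewrite eq_le normr_ge0 andbT -(pmulr_rle0 _ a0).
Qed.

Lemma bilipschitz_continuous phi a b : bilipschitz phi a b -> 0 < a ->
  continuous phi.
Proof.
move=> h a0 x; apply/cvgrPdist_lt => e e0.
have b0 : 0 < `|b| + 1 by rewrite ltr_wpDl.
have d0 : 0 < e / (`|b| + 1) by rewrite divr_gt0.
apply/nbhs_ballP; exists (e / (`|b| + 1)) => //= y; rewrite /ball /= => xy.
have /andP[_ h2] := bilipschitz_dist x y h a0; apply: (le_lt_trans h2).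
rewrite ltr_pdivlMr // mulrC in xy; apply: le_lt_trans xy.
by rewrite ler_wpM2r // (le_trans (ler_norm b)) // lerDl.
Qed.

Lemma bilipschitz_surj phi a b v : bilipschitz phi a b -> 0 < a ->
  exists t, phi t = v.
Proof.
(* On [[-s, s]] the lower slope bound makes [phi] move away from [phi 0] by at least [|v - phi 0|]
   on each side, so the intermediate value theorem applies. *)
move=> h a0; pose s := (`|v - phi 0|) / a.
have s0 : 0 <= s by rewrite divr_ge0 // ltW.
have as' : a * s = `|v - phi 0| by rewrite /s mulrC divfK // gt_eqF.
have ss : - s <= s by lra.
have Ns : - s <= 0 by lra.
have /andP[h1 _] := h _ _ s0; have /andP[h2 _] := h _ _ Ns.
rewrite subr0 as' in h1; rewrite sub0r opprK as' in h2.
have v1 : v <= phi s by have := ler_norm (v - phi 0); lra.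
have v2 : phi (- s) <= v by have := ler_norm (- (v - phi 0)); rewrite normrN; lra.
have [||c _ <-] := @IVT R phi (- s) s v ss.
- by apply: continuous_subspaceT; exact: bilipschitz_continuous h a0.
- by rewrite ge_min v2 /= le_max v1 orbT.
- by exists c.
Qed.

(** At the nodes, where [phi t = pi/2 + k pi], these are the terms of the partial fraction expansion
    of [cos^2 / cos^2 = 1] at [phi x]. *)
Definition node_weight phi x t := cos (phi x) ^+ 2 / (phi x - phi t) ^+ 2.

Lemma node_weight_ge0 phi x t : 0 <= node_weight phi x t.
Proof. by rewrite divr_ge0 // sqr_ge0. Qed.

Lemma le_sum_subseq J D (F : R -> R) : uniq J -> uniq D -> {subset J <= D} ->
  (forall t, 0 <= F t) -> \sum_(t <- J) F t <= \sum_(t <- D) F t.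
Proof.
move=> uJ uD JD F0; rewrite [leRHS](bigID (mem J)) /=.
have -> : \sum_(t <- J) F t = \sum_(t <- D | t \in J) F t.
  rewrite -[RHS]big_filter; apply: perm_big; apply: uniq_perm => //.
    exact: filter_uniq.
  by move=> t; rewrite mem_filter; case: (boolP (t \in J)) => // /JD ->.
by rewrite lerDl sumr_ge0.
Qed.

(** The window consists of the [2^(N+1)] nodes whose phase is within [2^N pi] of [phi x]; their
    weights are the terms of [sum_inv_sqr]. *)
Lemma node_window phi a b x N : bilipschitz phi a b -> 0 < a ->
  cos (phi x) != 0 -> exists D, [/\ uniq D,
    forall t, cos (phi t) = 0 -> `|phi x - phi t| < 2 ^+ N * pi -> t \in D,
    forall t, t \in D -> cos (phi t) = 0 /\ `|phi x - phi t| < 2 ^+ N * pi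
    & 1 - 2^-1 ^+ N <= \sum_(t <- D) node_weight phi x t <= 1].
Proof.
move=> h a0 cx; have p0 := pi_gt0 R.
pose m : int := Num.floor ((phi x - pi / 2) / pi).
have /andP[m1 m2] : m%:~R <= (phi x - pi / 2) / pi < (m + 1)%:~R by apply: floor_itv.
(* Shifting by [pi/2] turns the cosine into a sine, and reducing modulo [pi] brings the argument
   into the open interval from 0 to [pi]. *)
pose t0 := phi x - pi / 2 - m%:~R * pi.
have sx : sin t0 ^+ 2 = cos (phi x) ^+ 2.
  by rewrite -(sin_sqrDpiz m) /t0 subrK sinBpihalf sqrrN.
have t00 : 0 < t0 < pi.
  have : t0 != 0 by apply: contraNneq cx => e; rewrite -sqrf_eq0 -sx e sin0 expr0n.
  rewrite ler_pdivlMr // in m1; have m2' := m2; rewrite ltr_pdivrMr // intrD (_ : 1%:~R = 1) // in m2'.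
  by move=> n0; rewrite lt_def n0 /= /t0; apply/andP; split; lra.
have := sum_inv_sqr N t00.
pose v (k : nat) := phi x - (t0 + k%:R * pi - 2 ^+ N * pi).
pose psi s := get [set t | phi t = s].
have psiK s : phi (psi s) = s.
  have [t ht] := bilipschitz_surj s h a0.
  exact: (@getPex _ [set t | phi t = s] (ex_intro _ t ht)).
pose D := [seq psi (v k) | k <- index_iota 0 (2 ^ N.+1)].
have vE k : v k = pi / 2 + (m - k%:Z + (2 ^ N)%:Z)%:~R * pi.
  by rewrite /v /t0 !intrD rmorphN /= -!pmulrn natrX; ring.
have ve k : phi x - v k = t0 + k%:R * pi - 2 ^+ N * pi by rewrite /v; ring.
have vnode k : cos (v k) = 0.
  by apply/eqP; rewrite -sqrf_eq0 vE cos_sqrDpiz cos_pihalf expr0n.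
have DP t : t \in D -> exists2 k, (k < 2 ^ N.+1)%N & phi t = v k.
  by move=> /mapP[k]; rewrite mem_index_iota => /andP[_ kN] ->; exists k.
have n2 : (2 ^ N.+1)%:R = 2 * 2 ^+ N :> R by rewrite natrX exprS.
move=> B; exists D; split.
- rewrite map_inj_uniq ?iota_uniq // => i j /(congr1 phi); rewrite !psiK !vE.
  move=> /addrI /mulIf; rewrite gt_eqF // => /(_ isT) /intr_inj.
  by move=> /addIr /addrI /oppr_inj [].
- move=> t /cos_eq0P[j jE]; rewrite ltr_norml => hw.
  have e : phi x - phi t = t0 + (m - j)%:~R * pi.
    by rewrite jE /t0 intrB; ring.
  (* With this shift the window becomes exactly the index range from 0 to [2^(N+1) - 1]. *)
  pose q : int := m - j + (2 ^ N)%:Z.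
  have e2 : phi x - phi t = t0 + q%:~R * pi - 2 ^+ N * pi.
    by rewrite e /q (intrD _ (m - j)) -pmulrn natrX; ring.
  have q1 : -1 < q.
    rewrite -(ltr_int R) -(ltr_pM2r p0); move: hw; rewrite e2; lra.
  have q2 : q < (2 ^ N.+1)%:Z.
    rewrite -(ltr_int R) -pmulrn n2 -(ltr_pM2r p0); move: hw; rewrite e2; lra.
  have [k kE] : exists k : nat, q = k%:Z.
    by case: (q) q1 => k; [exists k|rewrite NegzE; lia].
  apply/mapP; exists k; first by rewrite mem_index_iota /=; move: q2; rewrite kE.
  apply: (bilipschitz_inj h a0); rewrite psiK /v.
  by move: e2; rewrite kE -pmulrn; lra.
- move=> t /DP[k kN ->]; split=> //; rewrite ve ltr_norml.
  have k0 : 0 <= k%:R :> R by [].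
  have k1 : k%:R + 1 <= 2 * 2 ^+ N :> R by rewrite natr1 -n2 ler_nat.
  have := ler_wpM2r (ltW p0) k1; have := mulr_ge0 k0 (ltW p0).
  by move=> *; apply/andP; split; lra.
- rewrite big_map; move: B; rewrite sx; congr (is_true (_ && _)).
    by congr (_ <= _); apply: eq_bigr => k _; rewrite /node_weight psiK ve.
  by congr (_ <= _); apply: eq_bigr => k _; rewrite /node_weight psiK ve.
Qed.

(** A finite set of nodes is contained in some window, and the weights are nonnegative. *)
Lemma sum_node_weight_le1 phi a b x J : bilipschitz phi a b -> 0 < a ->
  cos (phi x) != 0 -> uniq J -> (forall t, t \in J -> cos (phi t) = 0) ->
  \sum_(t <- J) node_weight phi x t <= 1.
Proof.
move=> h a0 cx uJ nJ; have p0 := pi_gt0 R.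
have [N hN] : exists N, forall t, t \in J -> `|phi x - phi t| < 2 ^+ N * pi.
  elim: J {uJ nJ} => [|t J [N IH]]; first by exists 0%N.
  have [M hM] : exists M : nat, `|phi x - phi t| < 2 ^+ M * pi.
    exists (Num.truncn (`|phi x - phi t| / pi)).+1.
    rewrite -ltr_pdivrMr //; apply: lt_le_trans (real_truncnS_gt (num_real _)) _.
    by rewrite -natrX ler_nat ltnW // ltn_expl.
  exists (maxn M N) => s; rewrite inE => /orP[/eqP ->|/IH hs].
    apply: (lt_le_trans hM); rewrite ler_pM2r // ler_weXn2l ?leq_maxl //; lra.
  apply: (lt_le_trans hs); rewrite ler_pM2r // ler_weXn2l ?leq_maxr //; lra.
have [D [uD DJ _ /andP[_ D1]]] := node_window N h a0 cx.
apply: le_trans D1; apply: le_sum_subseq => // [t tJ|t]; last exact: node_weight_ge0.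
by apply: DJ; [exact: nJ|exact: hN].
Qed.

(** Far nodes are disjoint from the window, which already carries [1 - 2^-N] of a total of at most
    1. *)
Lemma sum_far_nodes phi a b x N J : bilipschitz phi a b -> 0 < a ->
  cos (phi x) != 0 -> uniq J ->
  (forall t, t \in J -> cos (phi t) = 0 /\ 2 ^+ N * pi <= `|phi x - phi t|) ->
  \sum_(t <- J) node_weight phi x t <= 2^-1 ^+ N.
Proof.
move=> h a0 cx uJ hJ.
have [D [uD _ hD /andP[D1 _]]] := node_window N h a0 cx.
have : \sum_(t <- J ++ D) node_weight phi x t <= 1.
  apply: (sum_node_weight_le1 h a0 cx).
    rewrite cat_uniq uJ uD andbT /=; apply/hasPn => t /hD[_ tD].
    by apply/negP => /hJ[_]; rewrite leNgt tD.
  by move=> t; rewrite mem_cat => /orP[/hJ[]|/hD[]].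
rewrite big_cat /=; lra.
Qed.

End PhaseNodes.

(** * [A] on the real line in terms of the phase, and the terms of the series *)

Section HermiteBiehler.
Context {R : realType}.
Local Notation C := (Cplx R).
Implicit Types (z w : C) (x y t : R).

(** The phase is the restriction of an analytic function that is real on the real line, so the real
    part of the complex slope is a real slope. *)
Lemma phase_is_derive (E : C -> C) (phi : R -> R) x :
  is_phase E phi -> is_derive x 1 phi (derive1 phi x).
Proof.
move=> [_ [U [Phi [_ Ux Phid PhiE]]]].
have [q [qc qd qE]] := derivable_cdiff (Phid _ (Ux x)).
suff [a ha] : exists a, is_derive x 1 phi a.
  by have [pd _] := ha; apply: DeriveDef => //; rewrite derive1E.
exists (complex.Re (q x%:C)); apply/is_derive1_caratheodory.
exists (fun y => complex.Re (q y%:C)); split=> //.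
  move=> y; have := qE y%:C; rewrite !PhiE -realcB => /(congr1 (@complex.Re R)) /= ->.
  by rewrite -realcB cReM /= mulr0 subr0.
apply: ccvg_Re; apply: ccvg_comp qc.
by apply: ccvg_real; exact: cvg_id.
Qed.

Lemma bilipschitz_derive (phi : R -> R) (a b : R) :
  (forall x, is_derive x 1 phi (derive1 phi x)) ->
  (forall x, a <= derive1 phi x <= b) -> bilipschitz phi a b.
Proof.
move=> pd pb x y xy.
have [|c _ ->] := @MVT_segment R phi (derive1 phi) x y xy (fun s _ => pd s).
  by apply: derivable_within_continuous => z _; have [] := pd z.
by have /andP[h1 h2] := pb c; rewrite !ler_wpM2r ?subr_ge0.
Qed.

Context (E : C -> C) (phi : R -> R) (L1 L2 : R).
Context (E_HB : hermite_biehler E) (E0 : forall x : R, E x%:C != 0).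
Context (E_phase : is_phase E phi).
Context (L1_gt0 : 0 < L1) (phi_bnd : forall x, L1 <= derive1 phi x <= L2).

Local Notation A := (partA E : C -> C).

Lemma phi_bilip : bilipschitz phi L1 L2.
Proof. by apply: bilipschitz_derive => // x; exact: phase_is_derive E_phase. Qed.

Lemma E_cdiff (z : C) : exists d, cdiff E z d.
Proof. by eexists; apply: derivable_cdiff; case: E_HB => h _; exact: h. Qed.

Lemma A_cdiff z : cdiff A z (derive1 A z).
Proof.
have [d h] : exists d, cdiff A z d.
  have [a ha] := E_cdiff z; have [b hb] := E_cdiff (z^*).
  by exists (2^-1 * (a + b^*)); apply: cdiffZ; apply: cdiffD => //; exact: cdiff_star.
by have [_ ->] := cdiff_derivable h.
Qed.

Lemma A_ccont : ccontinuous A.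
Proof. by move=> z; exact: cdiff_ccvg (A_cdiff z). Qed.

Lemma star_A z : star A z = A z.
Proof.
have -> : star A z = ((2^-1 : C)^* : C) * ((E (z^*))^* + ((E ((z^*)^*))^*)^*).
  by rewrite /star /partA /star; apply: etrans (cconjM _ _) _; congr (_ * _); exact: cconjD.
rewrite /partA /star [X in _ = _ * X]addrC; congr (_ * (_ + _)).
- exact: etrans (conjc_inv _) (congr1 _ (conjc_nat _ _)).
- exact: etrans (conjcK _) (congr1 E (conjcK z)).
Qed.

Lemma A_real x : A x%:C = (complex.Re (E x%:C))%:C.
Proof.
rewrite /partA /star conjc_real.
transitivity ((2^-1 : R)%:C * (E x%:C + ((E x%:C)^* : C)) : C).
  by congr (_ * _); rewrite realcV rmorph_nat.
by case: (E x%:C) => a b; apply: complex_eq; rewrite ?cReM ?cImM /=; lra.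
Qed.

(** With [E = a + i b], the phase condition reads [a sin phi = - b cos phi]; square it and add
    [a^2 cos^2 phi] to both sides. *)
Lemma sqr_ReE x : complex.Re (E x%:C) ^+ 2 = cmod (E x%:C) ^+ 2 * cos (phi x) ^+ 2.
Proof.
have [h _] := E_phase; have := h x; rewrite cImM /= cmod_sqr => e.
have cs := cos2Dsin2 (phi x).
set a := complex.Re _ in e *; set b := complex.Im _ in e *.
set c := cos _ in e cs *; set s := sin _ in e cs *.
have e2 : a * s = - (b * c) by lra.
have : (a * s) ^+ 2 = (b * c) ^+ 2 by rewrite e2 sqrrN.
rewrite !exprMn => e3.
have : a ^+ 2 * (c ^+ 2 + s ^+ 2) = a ^+ 2 by rewrite cs mulr1.
by rewrite mulrDr e3 => {1}<-; ring.
Qed.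

Lemma sqr_A_real x : A x%:C ^+ 2 = (cmod (E x%:C) ^+ 2 * cos (phi x) ^+ 2)%:C.
Proof. by rewrite A_real -sqr_ReE realcM expr2. Qed.

Lemma sqr_cmod_A_real x : cmod (A x%:C) ^+ 2 = cmod (E x%:C) ^+ 2 * cos (phi x) ^+ 2.
Proof. by rewrite A_real cmodR real_normK ?num_real // sqr_ReE. Qed.

Lemma nodesP t : nodes E t <-> cos (phi t) = 0.
Proof.
have := sqr_cmod_A_real t; rewrite /nodes /= => e; split=> h.
  move/eqP: e; rewrite h cmod0 expr0n eq_sym mulf_eq0 sqrf_eq0 cmod_eq0 (negbTE (E0 t)) /=.
  by rewrite sqrf_eq0 => /eqP.
by move/eqP: e; rewrite h expr0n mulr0 sqrf_eq0 cmod_eq0 => /eqP.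
Qed.

(** Divide [A(y)^2 = |E(y)|^2 cos^2 phi(y)] by [(y - t)^2] and let [y] tend to [t], where
    [sin^2 phi(t) = 1]. Working with squares leaves aside the sign relating [A] to [|E| cos phi]. *)
Lemma sqr_dA t : nodes E t ->
  derive1 A (t%:C : C) ^+ 2 = (cmod (E t%:C) ^+ 2 * derive1 phi t ^+ 2)%:C.
Proof.
move=> nt; have /nodesP ct := nt.
have [q [qc qd qE]] := A_cdiff t%:C.
have dcos : is_derive t 1 (fun y => cos (phi y)) (- sin (phi t) * derive1 phi t).
  have dp := phase_is_derive t E_phase.
  by apply: is_derive1_comp.
have [g [gE gc gt]] := (is_derive1_caratheodory _ _ _).1 dcos.
have rc : ccvg (nbhs t) (fun y => y%:C) (t%:C) by apply: ccvg_real; exact: cvg_id.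
(* The difference of the two squared slopes, of [A] and of [|E| cos phi]: it vanishes to the right
   of [t], hence at [t] by continuity. *)
pose m y : C := q y%:C ^+ 2 - (cmod (E y%:C) ^+ 2 * g y ^+ 2)%:C.
have Ec : ccontinuous E by move=> z; have [d /cdiff_ccvg] := E_cdiff z.
have mc : ccvg (nbhs t) m (m t).
  apply: ccvgB.
    by apply: ccvgX; apply: ccvg_comp rc _ qc.
  apply: ccvg_real; apply: cvgM.
    have h : (fun y => cmod (E y%:C)) @ t --> cmod (E t%:C).
      by apply: ccvg_cmod; exact: ccvg_comp rc _ (Ec _).
    by rewrite expr2; apply: cvgM.
  by rewrite expr2; apply: cvgM.
have m0 : m t = 0.
  apply: (@ccvg_const_right _ m t (t + 1)) => //; first by lra.
  move=> y /andP[ty _].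
  have yt : (y - t) != 0 by lra.
  have := qE y%:C; rewrite (nt : A t%:C = 0) subr0 -realcB => Ay.
  have := gE y; rewrite ct subr0 => cy.
  have := sqr_A_real y; rewrite Ay cy !exprMn.
  have X2 : ((y - t)%:C : C) ^+ 2 = ((y - t) ^+ 2)%:C by rewrite !expr2 realcM.
  rewrite X2 => e; rewrite /m; apply/eqP; rewrite subr_eq0; apply/eqP.
  apply: (@mulIf _ ((y - t) ^+ 2)%:C).
    by rewrite -cmod_eq0 cmodR normr_eq0 sqrf_eq0.
  by rewrite e mulrA realcM.
rewrite -qd; move/eqP: m0; rewrite /m subr_eq0 => /eqP ->; congr (_%:C); congr (_ * _).
rewrite gt exprMn sqrrN; have := cos2Dsin2 (phi t); rewrite ct expr0n /= add0r => ->.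
by rewrite mul1r.
Qed.

Lemma dphi_gt0 t : 0 < derive1 phi t.
Proof. by apply: lt_le_trans L1_gt0 _; case/andP: (phi_bnd t). Qed.

Lemma dA_neq0 t : nodes E t -> derive1 A (t%:C : C) != 0.
Proof.
move=> nt; rewrite -sqrf_eq0 sqr_dA // -cmod_eq0 cmodR normr_eq0.
by rewrite mulf_neq0 // expf_neq0 ?cmod_eq0 ?E0 // gt_eqF ?dphi_gt0.
Qed.

Lemma sqr_cmod_dA t : nodes E t ->
  cmod (derive1 A (t%:C : C)) ^+ 2 = cmod (E t%:C) ^+ 2 * derive1 phi t ^+ 2.
Proof.
move=> nt; rewrite -cmodX sqr_dA // cmodR ger0_norm //.
by rewrite mulr_ge0 // sqr_ge0.
Qed.

(** The quotient [k = A / (z - t)] is entire because its singularity is removable, and the term is a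
    constant times [k^2]. This replaces the case distinction and the limit in [Gterm] by one formula
    valid everywhere. *)
Lemma Gterm_slope t : nodes E t -> exists k : C -> C,
  [/\ forall z, exists d, cdiff k z d, forall z, A z = k z * (z - t%:C),
      k t%:C = derive1 A (t%:C : C) &
      forall f z, Gterm E f t z = f t / derive1 A (t%:C : C) ^+ 2 * k z ^+ 2].
Proof.
move=> nt; have [k [kc kd kE]] := A_cdiff t%:C.
have kA z : A z = k z * (z - t%:C) by rewrite -kE (nt : A t%:C = 0) subr0.
have kq z : z != t%:C -> k z = A z / (z - t%:C).
  by move=> zt; rewrite kA mulfK // subr_eq0.
have zN z : z != t%:C -> nbhs z [set w : C | k w = A w / (w - t%:C)].
  move=> zt; apply/nbhsCP; exists (cmod (z - t%:C)); first by rewrite cmod_gt0 subr_eq0.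
  move=> w wz /=; apply: kq; apply: contraTneq wz => ->; by rewrite cmodB ltxx.
have dq z : z != t%:C -> exists d, cdiff (fun w => A w / (w - t%:C)) z d.
  move=> zt; eexists; apply: cdiff_div; first by rewrite subr_eq0.
    exact: A_cdiff.
  by apply: cdiffB; [exact: cdiff_id|exact: cdiff_cst].
have kdiff z : z != t%:C -> exists d, cdiff k z d.
  move=> zt; have [d hd] := dq z zt; exists d; apply: cdiff_near hd.
  by apply: filterS (zN z zt) => w /= ->.
have kcont : ccontinuous k.
  move=> z; have [->//|zt] := eqVneq z t%:C.
  by have [d /cdiff_ccvg] := kdiff z zt.
exists k; split=> //.
  move=> z; have [->|zt] := eqVneq z t%:C; last exact: kdiff.
  exact: removable_singularity.
move=> f z; set d := derive1 A (t%:C : C) in kd *.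
have d0 : d != 0 by exact: dA_neq0.
have gE w : w != t%:C ->
    f t * (A w ^+ 2 / (d ^+ 2 * (w - t%:C) ^+ 2)) = f t / d ^+ 2 * k w ^+ 2.
  move=> wt; have n : w - t%:C != 0 by rewrite subr_eq0.
  by rewrite kA; field; rewrite n d0.
rewrite /Gterm; case: eqVneq => [->|zt]; last exact: gE.
apply: cvg_lim; first exact: norm_hausdorff.
apply/ccvgP.
apply: (@ccvg_near _ _ _ _ (fun w => f t / d ^+ 2 * k w ^+ 2)).
  by apply/nbhsCP; exists 1 => // w _ wt /=; rewrite gE.
apply: ccvgM; first exact: ccvg_cst.
apply: ccvgX; apply: ccvg_sub (kcont t%:C).
by move=> P; apply: filterS => w Pw _.
Qed.

End HermiteBiehler.

(** * Bounds for finite sums of the series *)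

Section InterpolationTerms.
Context {R : realType}.
Local Notation C := (Cplx R).
Context (E : C -> C) (phi : R -> R) (L1 L2 : R) (f : R -> C) (M : R).
Context (E_HB : hermite_biehler E) (E0 : forall x : R, E x%:C != 0).
Context (E_phase : is_phase E phi).
Context (L1_gt0 : 0 < L1) (phi_bnd : forall x, L1 <= derive1 phi x <= L2).
Context (f_bnd : forall x : R, cmod (f x) / cmod (E x%:C) ^+ 2 <= M).
Implicit Types (t : R) (z : C) (J D : seq R).

Local Notation A := (partA E : C -> C).

Local Notation bl := (phi_bilip E_phase phi_bnd).
Local Notation K := (M / L1 ^+ 2).
Local Notation B := (M * (L2 / L1) ^+ 2).

Lemma L2_ge : L1 <= L2.
Proof. by have /andP[h1 h2] := phi_bnd 0; exact: le_trans h2. Qed.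

Lemma L2_gt0 : 0 < L2.
Proof. exact: lt_le_trans L1_gt0 L2_ge. Qed.

Lemma cmodE_gt0 (x : R) : 0 < cmod (E x%:C) ^+ 2.
Proof. by rewrite exprn_gt0 // cmod_gt0. Qed.

Lemma M_ge0 : 0 <= M.
Proof. by apply: le_trans (f_bnd 0); rewrite divr_ge0 ?cmod_ge0 // ltW // cmodE_gt0. Qed.

Lemma f_le (x : R) : cmod (f x) <= M * cmod (E x%:C) ^+ 2.
Proof. by rewrite -ler_pdivrMr // cmodE_gt0. Qed.

Lemma coef_le t : nodes E t -> cmod (f t) / cmod (derive1 A (t%:C : C)) ^+ 2 <= K.
Proof.
move=> nt; rewrite (sqr_cmod_dA E_HB E0 E_phase) // invfM mulrA.
have /andP[h1 _] := phi_bnd t.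
apply: ler_pM; rewrite ?f_bnd //.
- by rewrite divr_ge0 ?cmod_ge0 // ltW // cmodE_gt0.
- by rewrite invr_ge0 sqr_ge0.
- have d0 : 0 < derive1 phi t by exact: lt_le_trans h1.
  by rewrite lef_pV2 ?posrE ?exprn_gt0 // ler_pXn2r ?nnegrE ?(ltW d0) ?(ltW L1_gt0).
Qed.

Lemma cmod_Gterm_le t z : nodes E t -> z != t%:C ->
  cmod (Gterm E f t z) <= K * (cmod (A z) ^+ 2 / cmod (z - t%:C) ^+ 2).
Proof.
move=> nt zt; have [k [_ kA _ ->]] := Gterm_slope E_HB E0 E_phase L1_gt0 phi_bnd nt.
have -> : k z = A z / (z - t%:C) by rewrite kA mulfK // subr_eq0.
rewrite cmodM cmod_div !cmodX cmod_div expr_div_n ler_wpM2r ?coef_le //.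
by rewrite divr_ge0 ?sqr_ge0.
Qed.

(** The bound [|phi x - phi t| <= L2 |x - t|] trades [1/(x - t)^2] for [L2^2 / (phi x - phi t)^2];
    the coefficient contributes [M / L1^2]. *)
Lemma cmod_Gterm_real_le t (x : R) : nodes E t -> cos (phi x) != 0 ->
  cmod (Gterm E f t x%:C) <= B * node_weight phi x t * cmod (E x%:C) ^+ 2.
Proof.
move=> nt cx; have ct := (nodesP E0 E_phase t).1 nt.
have xt : x != t by apply: contraNneq cx => ->; rewrite ct.
have xt0 : 0 < `|x - t| by rewrite normr_gt0 subr_eq0.
have pxt : 0 < `|phi x - phi t|.
  rewrite normr_gt0 subr_eq0; apply: contra_neq xt; exact: (bilipschitz_inj bl L1_gt0).
have xtC : (x%:C : C) != t%:C by rewrite -subr_eq0 -realcB -cmod_eq0 cmodR gt_eqF.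
apply: (le_trans (cmod_Gterm_le nt xtC)).
rewrite (sqr_cmod_A_real E_phase) -realcB cmodR /node_weight.
rewrite -[(phi x - phi t) ^+ 2]real_normK ?num_real //.
have /andP[_ h2] := bilipschitz_dist x t bl L1_gt0.
set p := `|phi x - phi t| in pxt h2 *; set q := `|x - t| in xt0 h2 *.
set e := cmod _ ^+ 2; set c := cos _ ^+ 2.
have l2 := L2_gt0.
have -> : M / L1 ^+ 2 * (e * c / q ^+ 2) = (M / L1 ^+ 2 * c * e) * q ^- 2 by ring.
have -> : M * (L2 / L1) ^+ 2 * (c / p ^+ 2) * e = (M / L1 ^+ 2 * c * e) * (L2 ^+ 2 / p ^+ 2).
  by rewrite expr_div_n; ring.
rewrite ler_wpM2l //.
  apply: mulr_ge0; last exact: sqr_ge0.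
  apply: mulr_ge0; last exact: sqr_ge0.
  by apply: divr_ge0; [exact: M_ge0|exact: sqr_ge0].
rewrite ler_pdivlMr ?exprn_gt0 // mulrC ler_pdivrMr ?exprn_gt0 // -exprMn.
by rewrite ler_pXn2r ?nnegrE ?mulr_ge0 ?(ltW pxt) ?(ltW l2) ?(ltW xt0).
Qed.

Lemma Gterm_node t (x : R) : nodes E t -> nodes E x ->
  Gterm E f t x%:C = if x == t then f x else 0.
Proof.
move=> nt nx; have [k [_ kA kd ->]] := Gterm_slope E_HB E0 E_phase L1_gt0 phi_bnd nt.
case: eqVneq => [->|xt].
  by rewrite kd divfK // expf_neq0 // (dA_neq0 E_HB E0 E_phase L1_gt0 phi_bnd).
have := kA x%:C; rewrite (nx : A x%:C = 0) => /esym/eqP; rewrite mulf_eq0.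
rewrite -(realcB x) -[X in _ || X]cmod_eq0 cmodR normr_eq0 subr_eq0 (negbTE xt) orbF.
by move=> /eqP ->; rewrite expr0n mulr0.
Qed.

(** The counterpart of [Gpartial] over plain lists, which allows induction on the list of nodes. *)
Definition Gsum J z := \sum_(t <- J) Gterm E f t z.

Lemma Gsum_cdiff J z : (forall t, t \in J -> nodes E t) ->
  exists d, cdiff (Gsum J) z d.
Proof.
elim: J => [|t J IH] nJ.
  by exists 0; rewrite /Gsum; under eq_fun do rewrite big_nil; exact: cdiff_cst.
have [|d hd] := IH; first by move=> s sJ; apply: nJ; rewrite inE sJ orbT.
have nt : nodes E t by apply: nJ; rewrite inE eqxx.
have [k [kc _ _ kE]] := Gterm_slope E_HB E0 E_phase L1_gt0 phi_bnd nt.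
have [a ha] := kc z; have [b hb] := cdiffX 2 ha.
exists (f t / derive1 A (t%:C : C) ^+ 2 * b + d).
rewrite /Gsum; under eq_fun do rewrite big_cons kE.
by apply: cdiffD => //; exact: cdiffZ.
Qed.

Lemma Gsum_node J (x : R) : uniq J -> (forall t, t \in J -> nodes E t) ->
  nodes E x -> Gsum J x%:C = if x \in J then f x else 0.
Proof.
move=> uJ nJ nx.
have -> : Gsum J x%:C = \sum_(t <- J) (if x == t then f x else 0).
  rewrite /Gsum big_seq [RHS]big_seq; apply: eq_bigr => t tJ.
  by rewrite Gterm_node //; exact: nJ.
case: ifPn => xJ.
  rewrite (bigD1_seq x) //= eqxx big1 ?addr0 // => t tx.
  by rewrite eq_sym (negbTE tx).
rewrite big_seq big1 // => t tJ; case: eqP => // xt.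
by rewrite xt tJ in xJ.
Qed.

(** Off the nodes the weights sum to at most 1. At a node the sum is [f x] or 0 by interpolation,
    and [M <= M (L2/L1)^2]. *)
Lemma cmod_Gsum_real_le J (x : R) : uniq J -> (forall t, t \in J -> nodes E t) ->
  cmod (Gsum J x%:C) <= B * cmod (E x%:C) ^+ 2.
Proof.
move=> uJ nJ; have l2 := L2_gt0.
have MB : M <= B.
  rewrite -[leLHS]mulr1 ler_wpM2l ?M_ge0 // -(expr1n _ 2) ler_pXn2r ?nnegrE //.
    by rewrite ler_pdivlMr // mul1r L2_ge.
  by rewrite divr_ge0 // ltW.
have B0 : 0 <= B by apply: le_trans MB; exact: M_ge0.
have [cx|cx] := eqVneq (cos (phi x)) 0.
  rewrite Gsum_node //; last exact/(nodesP E0 E_phase).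
  case: ifP => _; last by rewrite cmod0 mulr_ge0 // ltW // cmodE_gt0.
  by apply: (le_trans (f_le x)); rewrite ler_wpM2r // ltW // cmodE_gt0.
apply: (le_trans (cmod_sum _ _ _)).
apply: (@le_trans _ _ (\sum_(t <- J) B * node_weight phi x t * cmod (E x%:C) ^+ 2)).
  by rewrite big_seq [leRHS]big_seq; apply: ler_sum => t tJ; apply: cmod_Gterm_real_le => //; exact: nJ.
rewrite -mulr_suml -mulr_sumr -mulrA ler_wpM2l // -[leRHS]mul1r ler_wpM2r //.
  by rewrite ltW // cmodE_gt0.
apply: (sum_node_weight_le1 bl L1_gt0 cx uJ) => t tJ.
exact: ((nodesP E0 E_phase t).1 (nJ t tJ)).
Qed.

Lemma E_uhp_neq0 z : 0 <= complex.Im z -> E z != 0.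
Proof.
rewrite le_eqVlt => /orP[/eqP z0|z0]; first by rewrite (realc (esym z0)).
have [_ h] := E_HB; have := h z z0; rewrite -cmod_gt0.
by apply: le_lt_trans; exact: cmod_ge0.
Qed.

Lemma cmod_A_le z : 0 <= complex.Im z -> cmod (A z) <= cmod (E z).
Proof.
move=> z0; rewrite /partA cmodM.
have -> : cmod (2^-1 : C) = 2^-1.
  have -> : (2^-1 : C) = (2^-1 : R)%:C by rewrite realcV rmorph_nat.
  by rewrite cmodR ger0_norm.
have h : cmod (star E z) <= cmod (E z).
  rewrite /star cmod_conj; move: z0; rewrite le_eqVlt => /orP[/eqP z0|z0].
    by rewrite (realc (esym z0)) conjc_real.
  by have [_ h] := E_HB; exact: ltW (h z z0).
have := cmodD (E z) (star E z).
rewrite mulrC ler_pdivrMr //; lra.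
Qed.

Lemma cmod_A_conj z : cmod (A (z^*)) = cmod (A z).
Proof. by rewrite -[in RHS]star_A /star cmod_conj. Qed.

Lemma pow2_unbounded (X : R) : exists N : nat, X <= 2 ^+ N.
Proof.
exists (Num.truncn X).+1.
apply: le_trans (ltW (real_truncnS_gt (num_real X))) _.
by rewrite -natrX ler_nat ltnW // ltn_expl.
Qed.

(** Each of the finitely many terms is at most a constant times [|A|^2 / |z - t|^2]. *)
Lemma Gsum_small_at_infinity J (e : R) : (forall t, t \in J -> nodes E t) -> 0 < e ->
  exists r, forall z, r < cmod z -> cmod (Gsum J z) <= e * cmod (A z) ^+ 2.
Proof.
move=> + e0; elim: J e e0 => [|t J IH] e e0 nJ.
  by exists 0 => z _; rewrite /Gsum big_nil cmod0 mulr_ge0 ?(ltW e0) // sqr_ge0.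
have e2 : 0 < e / 2 by lra.
have [|r hr] := IH _ e2; first by move=> s sJ; apply: nJ; rewrite inE sJ orbT.
have nt : nodes E t by apply: nJ; rewrite inE eqxx.
have K0 : 0 <= K by rewrite divr_ge0 ?M_ge0 ?sqr_ge0.
(* At distance at least [s] from [t], [K <= (e/2) s <= (e/2) |z - t|^2], the last inequality because
   [s >= 1]. *)
pose s := 1 + K / (e / 2).
have s1 : 1 <= s by rewrite /s lerDl divr_ge0 // ltW.
exists (Num.max r (`|t| + s)) => z; rewrite gt_max => /andP[rz tz].
rewrite /Gsum big_cons; apply: (le_trans (cmodD _ _)).
have zt : s <= cmod (z - t%:C).
  by have := le_cmodB z t%:C; rewrite cmodR; lra.
have zt0 : z != t%:C by rewrite -subr_eq0 -cmod_gt0; lra.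
have h1 : cmod (Gterm E f t z) <= e / 2 * cmod (A z) ^+ 2.
  apply: (le_trans (cmod_Gterm_le nt zt0)).
  rewrite mulrA mulrAC ler_wpM2r ?sqr_ge0 //.
  rewrite ler_pdivrMr ?exprn_gt0 //; last by lra.
  have : K <= e / 2 * s.
    by rewrite /s mulrDr (mulrC _ (K / _)) divfK ?gt_eqF //; lra.
  have ss : s <= cmod (z - t%:C) ^+ 2.
    by apply: (le_trans zt); rewrite expr2 ler_peMl //; lra.
  by move=> h; apply: (le_trans h); rewrite ler_wpM2l // ltW.
have := hr z rz; rewrite /Gsum; lra.
Qed.

(** The maximum principle applied to the finite sum and to its conjugate reflection, each divided by
    [E^2]. The constant does not depend on [J], which lets the bound pass to the limit. *)
Lemma Gsum_uhp_le J z : uniq J -> (forall t, t \in J -> nodes E t) ->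
  0 <= complex.Im z ->
  cmod (Gsum J z) <= B * cmod (E z) ^+ 2 /\
  cmod (Gsum J (z^*)) <= B * cmod (E z) ^+ 2.
Proof.
move=> uJ nJ z0.
have gen (g : C -> C) : (forall w, exists d, cdiff g w d) ->
    (forall w, cmod (g w) <= cmod (Gsum J w) \/ cmod (g w) <= cmod (Gsum J (w^*))) ->
    cmod (g z) <= B * cmod (E z) ^+ 2.
  move=> gd gw.
  have Ez : 0 < cmod (E z) ^+ 2 by rewrite exprn_gt0 // cmod_gt0 E_uhp_neq0.
  rewrite -ler_pdivrMr // -cmodX -cmod_div.
  apply: (@maximum_modulus_halfplane R (fun w => g w / E w ^+ 2)) => //.
  - move=> w w0; have [a ha] := gd w; have [b hb] := E_cdiff E_HB w.
    have [c hc] := cdiffX 2 hb.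
    by eexists; apply: cdiff_div ha hc; rewrite expf_neq0 // E_uhp_neq0.
  - move=> e e0; have [r hr] := Gsum_small_at_infinity nJ e0.
    exists r => w w0 rw; rewrite cmod_div cmodX ler_pdivrMr; last first.
      by rewrite exprn_gt0 // cmod_gt0 E_uhp_neq0.
    have h1 : e * cmod (A w) ^+ 2 <= e * cmod (E w) ^+ 2.
      rewrite ler_wpM2l ?(ltW e0) // ler_pXn2r ?nnegrE ?cmod_ge0 //.
      exact: cmod_A_le.
    apply: le_trans h1; case: (gw w) => h; apply: (le_trans h); first exact: hr.
    by rewrite -cmod_A_conj; apply: hr; rewrite cmod_conj.
  - move=> x; rewrite cmod_div cmodX ler_pdivrMr ?cmodE_gt0 //.
    by case: (gw x%:C) => h; apply: (le_trans h); rewrite ?conjc_real; exact: cmod_Gsum_real_le.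
split; first by apply: gen => w; [exact: Gsum_cdiff|left].
rewrite -[leLHS]cmod_conj; apply: (gen (star (Gsum J))) => w.
  have [d hd] := Gsum_cdiff (w^*) nJ.
  by exists (d^*); exact: cdiff_star.
by right; rewrite /star cmod_conj.
Qed.

(* Compared with the far nodes seen from a point where the cosine of the phase
   is 1, where the sum of the node weights is known. *)
Lemma Gterm_tail (r e : R) : 0 < e -> exists D, [/\ uniq D,
  forall t, t \in D -> nodes E t &
  forall J z, uniq J -> (forall t, t \in J -> nodes E t /\ t \notin D) ->
    cmod z <= r -> \sum_(t <- J) cmod (Gterm E f t z) <= e].
Proof.
move=> e0; have [x0 px0] := bilipschitz_surj 0 bl L1_gt0.
have cx0 : cos (phi x0) = 1 by rewrite px0 cos0.
have cx0' : cos (phi x0) != 0 by rewrite cx0 oner_eq0.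
have l2 := L2_gt0; have p0 := pi_gt0 R.
have [BA hBA] := bounded_on_disc r (A_ccont E_HB).
have K0 : 0 <= K by rewrite divr_ge0 ?M_ge0 ?sqr_ge0.
(* For [|z| <= r] a remote term is at most [K BA^2 / |z - t|^2]. Since [|phi x0 - phi t| <= L2 |x0 -
   t| <= 4 L2 |z - t|], it is at most [Q] times the weight of [t] seen from [x0]. *)
pose Q := K * BA ^+ 2 * (16 * L2 ^+ 2).
have Q0 : 0 <= Q.
  apply: mulr_ge0; first by apply: mulr_ge0 => //; exact: sqr_ge0.
  by apply: mulr_ge0 => //; exact: sqr_ge0.
(* If [|t| >= T] and [|z| <= r], then [|z - t| >= |t| - r > 0] and
   [|x0 - t| <= |x0| + |t| <= 4 |z - t|]. *)
pose T := 2 * `|r| + `|x0| + 1.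
(* The first summand makes [Q 2^-N <= e]; the second makes nodes outside the window satisfy
   [|x0 - t| >= T + |x0|], hence [|t| >= T]. *)
have [N hN] := pow2_unbounded (Q / e + L2 * (T + `|x0|)).
have T0 : 0 <= L2 * (T + `|x0|).
  by rewrite mulr_ge0 ?(ltW l2) // /T !addr_ge0 // mulr_ge0.
have Qe0 : 0 <= Q / e by rewrite divr_ge0 // ltW.
have [D [uD DN ND _]] := node_window N bl L1_gt0 cx0'.
exists D; split=> //.
  by move=> t /ND[ct _]; exact/(nodesP E0 E_phase).
move=> J z uJ hJ zr.
have far t : t \in J -> 2 ^+ N * pi <= `|phi x0 - phi t|.
  move=> /hJ[/(nodesP E0 E_phase) ct tD]; rewrite leNgt; apply: contra tD => h.
  exact: DN.
have hsum := sum_far_nodes bl L1_gt0 cx0' uJ (fun t tJ =>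
  conj ((nodesP E0 E_phase t).1 (hJ t tJ).1) (far t tJ)).
apply: (@le_trans _ _ (\sum_(t <- J) Q * node_weight phi x0 t)).
  rewrite big_seq [leRHS]big_seq; apply: ler_sum => t tJ.
  have nt := (hJ t tJ).1.
  have /andP[_ d2] := bilipschitz_dist x0 t bl L1_gt0.
  have pi1 : 1 <= pi :> R by have := pi_ge2 R; lra.
  have big : T + `|x0| <= `|x0 - t|.
    rewrite -(ler_pM2l l2); apply: (le_trans _ d2); apply: (le_trans _ (far t tJ)).
    have h2 : 0 <= (2 : R) ^+ N by rewrite exprn_ge0.
    have : (2 : R) ^+ N * 1 <= 2 ^+ N * pi by rewrite ler_wpM2l.
    lra.
  have tT : T <= `|t|.
    by have := ler_normB x0 t; lra.
  have rr := ler_norm r; have x00 := normr_ge0 x0; have r00 := normr_ge0 r.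
  have ztl : `|t| - r <= cmod (z - t%:C).
    by have := le_cmodB (t%:C) z; rewrite cmodR cmodB; lra.
  have ztp : 0 < cmod (z - t%:C) by rewrite /T in tT; lra.
  have zt0 : z != t%:C by rewrite -subr_eq0 -cmod_gt0.
  have x0t : `|x0 - t| <= 4 * cmod (z - t%:C).
    by have := ler_normB x0 t; rewrite /T in tT; lra.
  have pp : 0 < `|phi x0 - phi t|.
    by apply: lt_le_trans (far t tJ); rewrite mulr_gt0 // exprn_gt0.
  apply: (le_trans (cmod_Gterm_le nt zt0)).
  rewrite /Q /node_weight cx0 expr1n mul1r -[(phi x0 - phi t) ^+ 2]real_normK ?num_real //.
  apply: (@le_trans _ _ (K * (BA ^+ 2 * (16 * L2 ^+ 2 / `|phi x0 - phi t| ^+ 2)))); last first.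
    by rewrite le_eqVlt; apply/orP; left; apply/eqP; ring.
  rewrite ler_wpM2l //.
  apply: ler_pM; rewrite ?sqr_ge0 ?invr_ge0 ?sqr_ge0 //.
    rewrite ler_pXn2r ?nnegrE ?cmod_ge0 ?hBA //.
    by apply: le_trans (hBA z zr); exact: cmod_ge0.
  rewrite ler_pdivlMr ?exprn_gt0 // mulrC ler_pdivrMr ?exprn_gt0 //.
  have -> : 16 * L2 ^+ 2 * cmod (z - t%:C) ^+ 2 = (L2 * (4 * cmod (z - t%:C))) ^+ 2 by ring.
  rewrite ler_pXn2r ?nnegrE ?(ltW pp) //; last by rewrite !mulr_ge0 ?cmod_ge0 // ltW.
  by apply: (le_trans d2); rewrite ler_wpM2l // ltW.
rewrite -mulr_sumr; apply: (@le_trans _ _ (Q * 2^-1 ^+ N)).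
  by rewrite ler_wpM2l.
have n2 : 0 < (2 : R) ^+ N by rewrite exprn_gt0.
rewrite exprVn ler_pdivrMr // mulrC -ler_pdivrMr //; lra.
Qed.

End InterpolationTerms.

(** * Convergence of the series and membership in the space of [E^2] *)

Section InterpolationSeriesLimit.
Context {R : realType}.
Local Notation C := (Cplx R).

Lemma cauchy_ccvg (T : Type) (F : set_system T) (u : T -> C) : ProperFilter F ->
  (forall e : R, 0 < e -> exists x0, F [set x | cmod (u x - u x0) < e]) ->
  exists l, ccvg F u l.
Proof.
move=> PF h.
have [a ha] : exists a : R, (fun x => complex.Re (u x)) @ F --> a.
  apply/cvg_ex/cauchy_cvgP/cauchy_exP => e e0; have [x0 hx0] := h e e0.
  exists (complex.Re (u x0)).
  have h1 : F [set x | `|complex.Re (u x0) - complex.Re (u x)| < e].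
    apply: filterS hx0 => x /=; rewrite distrC -cReB; apply: le_lt_trans.
    exact: le_Re_cmod.
  exact: h1.
have [b hb] : exists b : R, (fun x => complex.Im (u x)) @ F --> b.
  apply/cvg_ex/cauchy_cvgP/cauchy_exP => e e0; have [x0 hx0] := h e e0.
  exists (complex.Im (u x0)).
  have h1 : F [set x | `|complex.Im (u x0) - complex.Im (u x)| < e].
    apply: filterS hx0 => x /=; rewrite distrC -cImB; apply: le_lt_trans.
    exact: le_Im_cmod.
  exact: h1.
exists (a +i* b); apply: ccvg_near (ccvg_ReIm ha hb).
by apply: filterE => x /=; case: (u x).
Qed.

Lemma compact_cmod_bounded (K : set C) : compact K ->
  exists r : R, forall z, K z -> cmod z <= r.
Proof.
move=> /compact_near_coveringP/(_ R (+oo%R : set_system R) (fun r z => cmod z < r) _).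
case=> [z Kz|r [_ hr]].
  exists ([set w : C | cmod w < cmod z + 1], [set r : R | cmod z + 1 < r]).
    split; last by exists (cmod z + 1); split; [exact: num_real|].
    apply/nbhsCP; exists 1 => // w wz /=.
    by rewrite -[w](subrK z) addrC; apply: (le_lt_trans (cmodD _ _)); rewrite ltrD2l.
  by move=> [w r] /= [h1 h2]; exact: lt_trans h2.
by exists (r + 1) => z Kz; apply: ltW; apply: (hr (r + 1) _ z Kz); rewrite ltrDl.
Qed.

Lemma family_compact_ccvg (T : Type) (F : set_system T) (u : T -> C -> C) (g : C -> C) :
  Filter F ->
  (forall r e : R, 0 < e -> F [set x | forall z, cmod z <= r -> cmod (u x z - g z) <= e]) ->
  {family compact, u @ F --> g}.
Proof.
move=> FF h; apply/fam_cvgP => K cK P /uniform_nbhs[S [entS SP]].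
have [r hr] := compact_cmod_bounded cK.
rewrite -entourage_ballE in entS; have [[e i] /=] := entS.
rewrite ltcE /= => /andP[/eqP -> e0] eS.
have e2 : 0 < e / 2 by lra.
apply: filterS (h r _ e2) => x hx; apply: SP => z Kz; apply: eS => /=.
rewrite -ball_normE /ball_ /= cmodE ltcR cmodB.
by apply: le_lt_trans (hx z (hr z Kz)) _; lra.
Qed.

Context (E : C -> C) (phi : R -> R) (L1 L2 : R) (f : R -> C) (M : R).
Context (E_HB : hermite_biehler E) (E0 : forall x : R, E x%:C != 0).
Context (E_phase : is_phase E phi).
Context (L1_gt0 : 0 < L1) (phi_bnd : forall x, L1 <= derive1 phi x <= L2).
Context (f_bnd : forall x : R, cmod (f x) / cmod (E x%:C) ^+ 2 <= M).
Implicit Types (J : {fset R}) (z : C).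

Local Notation FN := (finite_subsets (nodes E)).
Local Notation B := (M * (L2 / L1) ^+ 2).

(** The Cauchy criterion, uniform on a disc: adding nodes to [J0] only adds terms controlled by
    [Gterm_tail]. *)
Lemma Gpartial_close (r e : R) : 0 < e ->
  exists J0 : {fset R}, [set` J0] `<=` nodes E /\
    forall J : {fset R}, [set` J0] `<=` [set` J] -> [set` J] `<=` nodes E ->
      forall z, cmod z <= r -> cmod (Gpartial E f J z - Gpartial E f J0 z) <= e.
Proof.
move=> e0.
have [D [uD DN tail]] := Gterm_tail E_HB E0 E_phase L1_gt0 phi_bnd f_bnd r e0.
exists (seq_fset tt D); split=> [t tD|J J0J JN z zr].
  by apply: DN; have : t \in seq_fset tt D := tD; rewrite seq_fsetE.
rewrite /Gpartial [X in X - _](bigID (fun t => t \in seq_fset tt D)) /=.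
have -> : \sum_(t <- J | t \in seq_fset tt D) Gterm E f t z =
    \sum_(t <- seq_fset tt D) Gterm E f t z.
  rewrite -[LHS]big_filter; apply: perm_big; apply: uniq_perm.
  - by rewrite filter_uniq // fset_uniq.
  - exact: fset_uniq.
  - move=> t; rewrite mem_filter; case: (boolP (t \in seq_fset tt D)) => //= tD.
    by have := J0J t tD.
set a := \sum_(t <- seq_fset tt D) _; set b := \sum_(t <- J | _) _.
have -> : a + b - a = b by ring.
rewrite /b -big_filter; apply: (le_trans (cmod_sum _ _ _)).
apply: tail => //; first by rewrite filter_uniq // fset_uniq.
move=> t; rewrite mem_filter => /andP[tD tJ]; split; first exact: JN.
by rewrite -(seq_fsetE tt).
Qed.

Lemma Gpartial_ccvg z : ccvg FN (fun J => Gpartial E f J z) (G E f z).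
Proof.
have [l hl] : exists l, ccvg FN (fun J => Gpartial E f J z) l.
  apply: cauchy_ccvg => e e0; have e2 : 0 < e / 2 by lra.
  have [J0 [J0N hJ0]] := Gpartial_close (cmod z) e2.
  exists J0; exists J0 => // J [J0J JN] /=.
  by apply: le_lt_trans (hJ0 J J0J JN z (lexx _)) _; lra.
suff -> : G E f z = l by [].
apply: cvg_lim; first exact: norm_hausdorff.
exact/ccvgP.
Qed.

Lemma Gpartial_uniform (r e : R) : 0 < e ->
  FN [set J : {fset R} | [set` J] `<=` nodes E /\
    forall z, cmod z <= r -> cmod (Gpartial E f J z - G E f z) <= e].
Proof.
move=> e0; have e4 : 0 < e / 4 by lra.
have [J0 [J0N hJ0]] := Gpartial_close r e4.
exists J0 => // J [J0J JN]; split=> // z zr.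
have h1 : FN [set J : {fset R} | [set` J0] `<=` [set` J] /\ [set` J] `<=` nodes E] by exists J0.
(* [J1] depends on [z]: it is close to the limit at that point only, while the comparisons with [J0]
   are uniform on the disc. *)
have [J1 [/= [J01 J1N] hJ1]] := filter_ex (filterI h1 (Gpartial_ccvg z e4)).
have a1 := hJ0 J J0J JN z zr; have a2 := hJ0 J1 J01 J1N z zr.
have -> : Gpartial E f J z - G E f z = (Gpartial E f J z - Gpartial E f J0 z)
  - (Gpartial E f J1 z - Gpartial E f J0 z) + (Gpartial E f J1 z - G E f z) by ring.
apply: (le_trans (cmodD _ _)).
have := cmodD (Gpartial E f J z - Gpartial E f J0 z) (- (Gpartial E f J1 z - Gpartial E f J0 z)).
rewrite cmodN; lra.
Qed.

Theorem Gpartial_family_compact :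
  {family compact, Gpartial E f @ FN --> G E f}.
Proof.
apply: family_compact_ccvg => r e e0.
by apply: filterS (Gpartial_uniform r e0) => J [].
Qed.

Lemma G_cdiff z : exists d, cdiff (G E f) z d.
Proof.
(* [weierstrass_limit] wants every member of the family to be entire, which is known only for sets
   of nodes. The other finite sets, negligible for the filter, get the zero function. *)
pose u (J : {fset R}) := if `[< [set` J] `<=` nodes E >] then Gpartial E f J else fun=> 0.
apply: (@weierstrass_limit _ _ FN u) => [J w|r e e0].
  rewrite /u; case: asboolP => [JN|_]; last by exists 0; exact: cdiff_cst.
  exact: (Gsum_cdiff f E_HB E0 E_phase L1_gt0 phi_bnd w JN).
apply: filterS (Gpartial_uniform r e0) => J [JN hJ] /= w wr.
by rewrite /u asboolT //; exact: hJ.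
Qed.

Lemma G_uhp_le z : 0 <= complex.Im z ->
  cmod (G E f z) <= B * cmod (E z) ^+ 2 /\
  cmod (G E f (z^*)) <= B * cmod (E z) ^+ 2.
Proof.
move=> z0.
have h w b : (forall J : {fset R}, [set` J] `<=` nodes E -> cmod (Gpartial E f J w) <= b) ->
    cmod (G E f w) <= b.
  move=> hb; apply/ler_addgt0Pr => e e0.
  have [J [JN hJ]] := filter_ex (Gpartial_uniform (cmod w) e0).
  have := hJ w (lexx _); have := hb J JN; have := le_cmodB (G E f w) (Gpartial E f J w).
  rewrite cmodB; lra.
by split; apply: h => J JN;
  have [] := Gsum_uhp_le E_HB E0 E_phase L1_gt0 phi_bnd f_bnd (fset_uniq J) JN z0.
Qed.

Theorem G_Hinf : Hinf (fun z => E z ^+ 2) (G E f).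
Proof.
have En z : uhp z -> E z ^+ 2 != 0.
  by move=> /ltW z0; rewrite expf_neq0 // (E_uhp_neq0 E_HB E0).
have dq g z : (exists d, cdiff g z d) -> uhp z -> derivable (fun w => g w / E w ^+ 2 : C) z 1.
  move=> [a ha] zu; have [b hb] := E_cdiff E_HB z; have [c hc] := cdiffX 2 hb.
  by have /cdiff_derivable[] := (@cdiff_div _ g (fun w => E w ^+ 2) z a c (En z zu) ha hc).
split.
- by move=> z; have [d /cdiff_derivable[]] := G_cdiff z.
- split; first by move=> z; apply: dq; exact: G_cdiff.
  exists B => z zu; have [h _] := G_uhp_le (ltW zu).
  by rewrite cmod_div cmodX ler_pdivrMr // -cmodX cmod_gt0 En.
- split.
    move=> z; apply: dq; have [d hd] := G_cdiff (z^*).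
    by exists (d^*); exact: cdiff_star.
  exists B => z zu; have [_ h] := G_uhp_le (ltW zu).
  rewrite cmod_div cmodX ler_pdivrMr; last by rewrite -cmodX cmod_gt0 En.
  by rewrite /star cmod_conj.
Qed.

End InterpolationSeriesLimit.

(** * The pointwise interpolation error *)

Section InterpolationError.
Context {R : realType}.
Local Notation C := (Cplx R).
Context (E : C -> C) (phi : R -> R) (L1 L2 : R) (f : R -> C) (M : R).
Context (E_HB : hermite_biehler E) (E0 : forall x : R, E x%:C != 0).
Context (E_phase : is_phase E phi).
Context (L1_gt0 : 0 < L1) (phi_bnd : forall x, L1 <= derive1 phi x <= L2).
Context (f_bnd : forall x : R, cmod (f x) / cmod (E x%:C) ^+ 2 <= M).
Implicit Types (x t : R) (J : seq R).

Local Notation kappa := ((L2 / L1) ^+ 2).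
Local Notation bl := (phi_bilip E_phase phi_bnd).
Local Notation a t := (f t / (cmod (E t%:C) ^+ 2)%:C).

(** The square of the mean slope of [phi] between [t] and [x] over its slope at [t]; it is 1 for an
    affine phase. *)
Definition slope_ratio x t :=
  (phi x - phi t) ^+ 2 / (derive1 phi t ^+ 2 * (x - t) ^+ 2).

Lemma cmod_a_le t : cmod (a t) <= M.
Proof. by rewrite cmod_div cmodR (ger0_norm (sqr_ge0 _)). Qed.

(** The ratio of two slopes lies between [L1/L2] and [L2/L1], so its square lies between [1/kappa]
    and [kappa], and [1/kappa >= 2 - kappa]. *)
Lemma slope_ratio_bounds x t : x != t ->
  0 <= slope_ratio x t <= kappa /\ `|slope_ratio x t - 1| <= kappa - 1.
Proof.
move=> xt; have q0 : 0 < `|x - t| by rewrite normr_gt0 subr_eq0.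
have l2 := L2_gt0 L1_gt0 phi_bnd.
have /andP[h1 h2] := bilipschitz_dist x t bl L1_gt0.
have /andP[s1 s2] := phi_bnd t.
set s := derive1 phi t in s1 s2; have s0 : 0 < s by exact: lt_le_trans s1.
pose v := `|phi x - phi t| / (s * `|x - t|).
have vE : slope_ratio x t = v ^+ 2.
  rewrite /slope_ratio /v expr_div_n exprMn -/s.
  by rewrite -[(x - t) ^+ 2]real_normK ?num_real // -[(_ - _) ^+ 2]real_normK ?num_real.
have sq0 : 0 < s * `|x - t| by rewrite mulr_gt0.
have v1 : v <= L2 / L1.
  rewrite ler_pdivrMr //; apply: (le_trans h2).
  rewrite -[L2 / L1 * _]mulrA ler_pM2l // mulrA ler_peMl ?(ltW q0) //.
  by rewrite ler_pdivlMl // mulr1.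
have v2 : L1 / L2 <= v.
  rewrite ler_pdivlMr //; apply: le_trans h1.
  rewrite -[L1 / L2 * _]mulrA ler_pM2l // mulrA ler_piMl ?(ltW q0) //.
  by rewrite ler_pdivrMl // mulr1.
have v0 : 0 <= v by rewrite divr_ge0 // ltW.
have r0 : 0 < L1 / L2 by rewrite divr_gt0.
have b1 : v ^+ 2 <= kappa by rewrite ler_pXn2r ?nnegrE // (le_trans v0).
have b2 : (L1 / L2) ^+ 2 <= v ^+ 2 by rewrite ler_pXn2r ?nnegrE // ltW.
have k0 : 0 < kappa by rewrite exprn_gt0 // divr_gt0.
have kV : (L1 / L2) ^+ 2 = kappa^-1 by rewrite -exprVn invf_div.
have k2 : 2 - kappa <= kappa^-1.
  rewrite -[leRHS]mul1r ler_pdivlMr //; have := sqr_ge0 (kappa - 1); nra.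
rewrite vE; split; first by rewrite sqr_ge0.
by rewrite ler_norml; apply/andP; split; move: b2; rewrite kV; lra.
Qed.

Lemma Gterm_realE x t : nodes E t -> cos (phi x) != 0 ->
  Gterm E f t x%:C =
    (cmod (E x%:C) ^+ 2)%:C * (a t * (slope_ratio x t * node_weight phi x t)%:C).
Proof.
move=> nt cx; have ct := (nodesP E0 E_phase t).1 nt.
have xt : x != t by apply: contraNneq cx => ->; rewrite ct.
have pxt : phi x - phi t != 0.
  rewrite subr_eq0; apply: contra_neq xt; exact: (bilipschitz_inj bl L1_gt0).
have s0 : derive1 phi t != 0 by rewrite gt_eqF // (dphi_gt0 L1_gt0 phi_bnd).
have xt0 : x - t != 0 by rewrite subr_eq0.
have nz (y : R) : y != 0 -> (y%:C : C) != 0 by rewrite -cmod_eq0 cmodR normr_eq0.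
have [k [_ kA _ ->]] := Gterm_slope E_HB E0 E_phase L1_gt0 phi_bnd nt.
have -> : k x%:C = partA E x%:C / (x - t)%:C.
  by rewrite kA realcB mulfK // -realcB nz.
rewrite (sqr_dA E_HB E0 E_phase nt) expr_div_n (sqr_A_real E_phase).
have -> : slope_ratio x t * node_weight phi x t =
    cos (phi x) ^+ 2 / (derive1 phi t ^+ 2 * (x - t) ^+ 2).
  by rewrite /slope_ratio /node_weight; field; rewrite pxt xt0 s0.
have X2 (y : R) : (y%:C : C) ^+ 2 = (y ^+ 2)%:C by rewrite !expr2 realcM.
have en := cmodE_gt0 E0 t.
rewrite X2 !realcM !realcV !realcM !invfM; ring.
Qed.

(** The sum is compared with the mean of the constant [a x] under the weights. Near nodes cost
    [e kappa + M (kappa - 1)], far nodes [2 M kappa 2^-N], and the weight missing from [J] costs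
    [M 2^-N]. *)
Lemma Gsum_error x J N (e d : R) : cos (phi x) != 0 -> uniq J ->
  (forall t, t \in J -> nodes E t) ->
  (forall t, nodes E t -> `|phi x - phi t| < 2 ^+ N * pi -> t \in J) ->
  0 <= e -> 2 ^+ N * pi <= L1 * d ->
  (forall t, `|x - t| < d -> cmod (a x - a t) <= e) ->
  cmod (Gsum E f J x%:C - f x) <=
    cmod (E x%:C) ^+ 2 * (e * kappa + M * (kappa - 1) + (2 * M * kappa + M) * 2^-1 ^+ N).
Proof.
move=> cx uJ nJ JN e0 Nd ae.
have M0 := M_ge0 E0 f_bnd.
have en := cmodE_gt0 E0 x.
have cJ t : t \in J -> cos (phi t) = 0 by move=> /nJ; exact: (nodesP E0 E_phase t).1.
have xJ t : t \in J -> x != t by move=> /cJ ct; apply: contraNneq cx => ->; rewrite ct.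
have k0 : 0 <= kappa by exact: sqr_ge0.
pose w := node_weight phi x; pose l := slope_ratio x.
have w0 t : 0 <= w t by exact: node_weight_ge0.
set W := \sum_(t <- J) w t.
have W1 : W <= 1 by apply: (sum_node_weight_le1 bl L1_gt0 cx uJ cJ).
have W2 : 1 - 2^-1 ^+ N <= W.
  have [D [uD _ hD /andP[D1 _]]] := node_window N bl L1_gt0 cx.
  apply: (le_trans D1); apply: le_sum_subseq => // t /hD[ct tw].
  by apply: JN => //; exact/(nodesP E0 E_phase).
have k1 : 0 <= kappa - 1.
  have l2 := L2_gt0 L1_gt0 phi_bnd.
  rewrite subr_ge0 -(expr1n _ 2) ler_pXn2r ?nnegrE ?ler01 ?divr_ge0 ?(ltW l2) ?(ltW L1_gt0) //.
  by rewrite ler_pdivlMr // mul1r (L2_ge phi_bnd).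
pose far t := d <= `|x - t|.
(* For a near node, [a(t) l - a(x) = a(x) (l - 1) - (a(x) - a(t)) l]. For a far node both parts are
   bounded outright, using [M <= M kappa]. *)
have term t : t \in J -> cmod (a t * (l t)%:C - a x) * w t <=
    (e * kappa + M * (kappa - 1)) * w t + (if far t then 2 * M * kappa * w t else 0).
  move=> tJ; have [/andP[l0 lk] l1] := slope_ratio_bounds (xJ t tJ).
  have hh : cmod (a t * (l t)%:C - a x) <=
      (e * kappa + M * (kappa - 1)) + (if far t then 2 * M * kappa else 0).
    case: ifP => [_|/negbT]; last first.
      rewrite -ltNge addr0 => /ae ht.
      have -> : a t * (l t)%:C - a x = a x * (l t - 1)%:C - (a x - a t) * (l t)%:C.
        by rewrite realcB; ring.
      apply: (le_trans (cmodD _ _)); rewrite cmodN (cmodM (a x)) (cmodM (a x - a t)) !cmodR (ger0_norm l0).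
      have h1 : cmod (a x) * `|l t - 1| <= M * (kappa - 1).
        by apply: ler_pM => //; [exact: cmod_ge0|exact: cmod_a_le].
      have h2 : cmod (a x - a t) * slope_ratio x t <= e * kappa.
        by apply: ler_pM => //; exact: cmod_ge0.
      lra.
    apply: (le_trans (cmodD _ _)); rewrite cmodN (cmodM (a t)) cmodR (ger0_norm l0).
    have h1 : cmod (a t) * slope_ratio x t <= M * kappa by apply: ler_pM => //; [exact: cmod_ge0|exact: cmod_a_le].
    have h2 := cmod_a_le x.
    have h3 : M <= M * kappa by rewrite ler_peMr //; lra.
    have h4 : 0 <= e * kappa by rewrite mulr_ge0.
    have h5 : 0 <= M * (kappa - 1) by rewrite mulr_ge0.
    lra.
  have := ler_wpM2r (w0 t) hh; rewrite mulrDl.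
  by case: ifP; rewrite ?mul0r.
have sumE : Gsum E f J x%:C - f x = (cmod (E x%:C) ^+ 2)%:C *
    (\sum_(t <- J) (a t * (l t)%:C - a x) * (w t)%:C - a x * (1 - W)%:C).
  have -> : Gsum E f J x%:C = (cmod (E x%:C) ^+ 2)%:C * \sum_(t <- J) a t * (l t * w t)%:C.
    rewrite mulr_sumr /Gsum big_seq [RHS]big_seq; apply: eq_bigr => t tJ.
    by rewrite Gterm_realE //; exact: nJ.
  have {1}-> : f x = (cmod (E x%:C) ^+ 2)%:C * a x.
    by rewrite mulrC divfK // -cmod_eq0 cmodR normr_eq0 gt_eqF.
  rewrite -mulrBr; congr (_ * _).
  have -> : (1 - W)%:C = 1 - \sum_(t <- J) (w t)%:C :> C.
    by rewrite realcB /W; congr (_ - _); exact: (raddf_sum (real_complex R)).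
  have -> : \sum_(t <- J) (a t * (l t)%:C - a x) * (w t)%:C =
      \sum_(t <- J) a t * (l t * w t)%:C - a x * \sum_(t <- J) (w t)%:C.
    by rewrite mulr_sumr -sumrB; apply: eq_bigr => t _; rewrite realcM; ring.
  by ring.
rewrite sumE cmodM cmodR (ger0_norm (ltW en)) ler_wpM2l ?(ltW en) //.
apply: (le_trans (cmodD _ _)); rewrite cmodN (cmodM (a x)) cmodR.
have A1 : cmod (\sum_(t <- J) (a t * (l t)%:C - a x) * (w t)%:C) <=
    e * kappa + M * (kappa - 1) + 2 * M * kappa * 2^-1 ^+ N.
  apply: (le_trans (cmod_sum _ _ _)).
  apply: (@le_trans _ _ (\sum_(t <- J) ((e * kappa + M * (kappa - 1)) * w t
      + (if far t then 2 * M * kappa * w t else 0)))).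
    rewrite big_seq [leRHS]big_seq; apply: ler_sum => t tJ.
    by rewrite cmodM cmodR (ger0_norm (w0 t)); exact: term.
  rewrite big_split /= -mulr_sumr -/W -big_mkcond /= -big_filter -mulr_sumr.
  apply: lerD.
    by rewrite ler_piMr //; apply: addr_ge0; exact: mulr_ge0.
  rewrite (ler_wpM2l (mulr_ge0 (mulr_ge0 (ler0n _ 2) M0) k0)) //.
  apply: (sum_far_nodes bl L1_gt0 cx); first exact: filter_uniq.
  move=> t; rewrite mem_filter => /andP[tf tJ]; split; first exact: cJ.
  have /andP[h1 _] := bilipschitz_dist x t bl L1_gt0.
  by apply: (le_trans Nd); apply: le_trans h1; rewrite ler_pM2l.
have A2 : cmod (a x) * `|1 - W| <= M * 2^-1 ^+ N.
  apply: ler_pM; rewrite ?cmod_ge0 ?cmod_a_le // ger0_norm; lra.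
lra.
Qed.

(** The bound passes to the limit along finite sets that contain the window of [x] and whose sums
    are close to [G] at [x]. If [x] is itself a node, sums containing it equal [f x] exactly. *)
Theorem G_error x N (e d : R) : 0 <= e -> 2 ^+ N * pi <= L1 * d ->
  (forall t, `|x - t| < d -> cmod (a x - a t) <= e) ->
  cmod (G E f x%:C - f x) <=
    cmod (E x%:C) ^+ 2 * (e * kappa + M * (kappa - 1) + (2 * M * kappa + M) * 2^-1 ^+ N).
Proof.
move=> e0 Nd ae.
have M0 := M_ge0 E0 f_bnd.
have l2 := L2_gt0 L1_gt0 phi_bnd.
have Gc := Gpartial_ccvg E_HB E0 E_phase L1_gt0 phi_bnd f_bnd x%:C.
apply/ler_addgt0Pr => b b0.
suff [J [hJ1 hJ2]] : exists J : {fset R}, cmod (Gpartial E f J x%:C - G E f x%:C) < b /\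
    cmod (Gpartial E f J x%:C - f x) <=
    cmod (E x%:C) ^+ 2 * (e * kappa + M * (kappa - 1) + (2 * M * kappa + M) * 2^-1 ^+ N).
  have -> : G E f x%:C - f x = (Gpartial E f J x%:C - f x) - (Gpartial E f J x%:C - G E f x%:C).
    by ring.
  by apply: (le_trans (cmodD _ _)); rewrite cmodN; lra.
have FJ (D : seq R) : (forall t, t \in D -> nodes E t) -> exists J : {fset R},
    [/\ cmod (Gpartial E f J x%:C - G E f x%:C) < b, [set` J] `<=` nodes E &
      forall t, t \in D -> t \in J].
  move=> DN; have h1 : finite_subsets (nodes E) [set J : {fset R} |
      [set` seq_fset tt D] `<=` [set` J] /\ [set` J] `<=` nodes E].
    exists (seq_fset tt D) => // t tD.
    by apply: DN; have : t \in seq_fset tt D := tD; rewrite seq_fsetE.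
  have [J [/= [DJ JN] hJ]] := filter_ex (filterI h1 (Gc b b0)).
  by exists J; split=> // t tD; apply: DJ; change (t \in seq_fset tt D); rewrite seq_fsetE.
have [cx|cx] := eqVneq (cos (phi x)) 0.
  have nx : nodes E x by exact/(nodesP E0 E_phase).
  have [t|J [hJ JN Jx]] := FJ [:: x]; first by rewrite inE => /eqP ->.
  exists J; split=> //.
  have := Gsum_node f E_HB E0 E_phase L1_gt0 phi_bnd (fset_uniq J) JN nx.
  rewrite Jx ?inE // /Gsum /Gpartial => ->.
  rewrite subrr cmod0 mulr_ge0 ?sqr_ge0 //.
  have k1 : 1 <= kappa.
    rewrite -(expr1n _ 2) ler_pXn2r ?nnegrE ?ler01 ?divr_ge0 ?(ltW l2) ?(ltW L1_gt0) //.
    by rewrite ler_pdivlMr // mul1r (L2_ge phi_bnd).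
  have h0 : (0 : R) <= 2^-1 ^+ N by rewrite exprn_ge0.
  have p1 : 0 <= e * kappa by apply: mulr_ge0 => //; exact: sqr_ge0.
  have p2 : 0 <= M * (kappa - 1) by apply: mulr_ge0 => //; rewrite subr_ge0.
  have p3 : 0 <= (2 * M * kappa + M) * 2^-1 ^+ N.
    apply: mulr_ge0 => //; apply: addr_ge0 => //.
    by apply: mulr_ge0; [exact: mulr_ge0|exact: sqr_ge0].
  by apply: addr_ge0 => //; exact: addr_ge0.
have [D [uD DN ND _]] := node_window N bl L1_gt0 cx.
have [t /ND[ct _]|J [hJ JN DJ]] := FJ D; first exact/(nodesP E0 E_phase).
exists J; split=> //; apply: (Gsum_error (d := d)) => //; first exact: fset_uniq.
by move=> t nt ht; apply: DJ; apply: DN => //; exact: (nodesP E0 E_phase t).1.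
Qed.

End InterpolationError.

(** * Uniform smallness, supremum norms and the limit in [tau] *)

Lemma Linfty_norm_cvg0 (R : realType) (h : R -> R -> Cplx R) :
  (forall e : R, 0 < e -> \forall tau \near +oo, forall x, cmod (h tau x) <= e) ->
  Linfty_norm (h tau) @[tau --> +oo] --> 0%E.
Proof.
move=> hb.
have bnd (e tau : R) : 0 < e -> (forall x, cmod (h tau x) <= e) ->
    (0 <= Linfty_norm (h tau) <= e%:E)%E.
  move=> e0 he; apply/andP; split; first exact: Lnorm_ge0.
  rewrite /Linfty_norm unlock; case: ifPn => _; last by rewrite lee_fin ltW.
  apply/ess_supP; apply/nearW => x /=.
  by rewrite lee_fin ger0_norm ?cmod_ge0.
apply/fine_cvgP; split.
  apply: filterS (hb 1 ltr01) => tau /(bnd _ _ ltr01) /andP[h0 h1].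
  by rewrite ge0_fin_numE // (le_lt_trans h1) // ltry.
apply/cvgrPdist_le => e e0; apply: filterS (hb e e0) => tau /(bnd _ _ e0) /=.
case: (Linfty_norm (h tau)) => [r| |]; rewrite ?lee_fin ?leye_eq //=; last by move=> /andP[].
by move=> /andP[r0 re]; rewrite sub0r normrN ger0_norm.
Qed.

(** Since [(tau + c)^2 = (tau - c)^2 + 4 tau c], it suffices that
    [4 tau c <= s (tau/2)^2 <= s (tau - c)^2]; these are the two lower bounds on [tau]. *)
Lemma ratio_sqr_near1 (R : realType) (tau c s : R) : 0 < s -> 0 < c ->
  2 * c <= tau -> 16 * c / s <= tau ->
  ((tau + c) / (tau - c)) ^+ 2 <= 1 + s.
Proof.
move=> s0 c0 h1 h2; have d0 : 0 < tau - c by lra.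
rewrite ler_pdivrMr // mulrC in h2.
rewrite expr_div_n ler_pdivrMr ?exprn_gt0 //.
have h3 : (tau / 2) ^+ 2 <= (tau - c) ^+ 2.
  by rewrite ler_pXn2r ?nnegrE //; lra.
have h4 : s * (tau / 2) ^+ 2 <= s * (tau - c) ^+ 2 by rewrite ler_wpM2l // ltW.
have h5 : tau * (16 * c) <= tau * (s * tau) by rewrite ler_wpM2l //; lra.
have -> : (tau + c) ^+ 2 = (tau - c) ^+ 2 + 4 * tau * c by ring.
have h6 : s * (tau / 2) ^+ 2 = tau * (s * tau) / 4 by field.
lra.
Qed.

Unset Implicit Arguments.

(** For [C < tau] the derivative of the phase is bounded below by [tau - C > 0], as the bilipschitz
    estimates require; the limits concern such [tau] only. *)
Theorem theorem2 (R : realType) (E : R -> Cplx R -> Cplx R)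
  (phi : R -> R -> R) (C : R)
  (E_HB : forall tau : R, 0 < tau -> hermite_biehler (E tau))
  (E_type : forall tau : R, 0 < tau -> has_exp_type tau (E tau))
  (E_real_zeros : forall tau : R, 0 < tau -> forall x : R, E tau x%:C != 0)
  (E_phase : forall tau : R, 0 < tau -> is_phase (E tau) (phi tau))
  (C_gt0 : 0 < C)
  (phase_bound : forall (tau x : R), 0 < tau ->
     `|derive1 (phi tau) x - tau| <= C)
  (f : R -> Cplx R)
  (f_equicontinuous : forall eps : R, 0 < eps ->
     exists2 delta : R, 0 < delta & exists2 tau0 : R, 0 < tau0 &
       forall x t tau : R, tau0 <= tau -> `|x - t| < delta ->
         cmod (f x / (cmod (E tau x%:C) ^+ 2)%:C
               - f t / (cmod (E tau t%:C) ^+ 2)%:C) < eps)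
  (f_bounded : exists2 M : R, 0 < M &
     forall x tau : R, 0 < tau ->
       cmod (f x) / cmod (E tau x%:C) ^+ 2 <= M) :
  [/\ forall tau : R, C < tau ->
        {family compact,
          Gpartial (E tau) f @ finite_subsets (nodes (E tau)) --> G (E tau) f},
      forall tau : R, C < tau ->
        Hinf (fun z => E tau z ^+ 2) (G (E tau) f)
    & Linfty_norm (fun x : R => (G (E tau) f x%:C - f x) / E tau x%:C ^+ 2)
        @[tau --> +oo] --> 0%E]
  /\
  (forall w : R -> R, weight w ->
     (exists c d tau0 : R, [/\ 0 < c, 0 < d, 0 < tau0 &
        forall x tau : R, tau0 <= tau ->
          c <= cmod (E tau x%:C) ^+ 2 * w x <= d]) ->
     Linfty_norm (fun x : R => (G (E tau) f x%:C - f x) * (w x)%:C)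
       @[tau --> +oo] --> 0%E).
Proof.
have [M M0 hM] := f_bounded.
have tau0 tau : C < tau -> 0 < tau by move=> ?; lra.
have L1_gt0 tau : C < tau -> 0 < tau - C by move=> ?; lra.
have bnd tau : C < tau -> forall x, tau - C <= derive1 (phi tau) x <= tau + C.
  by move=> ht x; have := phase_bound tau x (tau0 _ ht); rewrite ler_norml; lra.
(* The error relative to [|E|^2], uniform in [x]. With [kappa <= 2], the three contributions in
   [G_error] are at most [e/4] each: [2 e/8], [M s], and [5 M 2^-N] with [M 2^-N <= e/20]. *)
have key (e : R) : 0 < e -> exists2 T : R, C < T & forall tau x : R, T < tau ->
    cmod (G (E tau) f x%:C - f x) <= e * cmod (E tau x%:C) ^+ 2.
  move=> e0; have e8 : 0 < e / 8 by lra.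
  have [d d0 [T0 T00 fc]] := f_equicontinuous _ e8.
  have [N hN] := pow2_unbounded (20 * M / e).
  pose s := Num.min 1 (e / (4 * M)).
  have M4 : 0 < 4 * M by lra.
  have s0 : 0 < s by rewrite lt_min ltr01 divr_gt0.
  have s1 : s <= 1 by rewrite ge_min lexx.
  have sM : M * s <= e / 4.
    have : s <= e / (4 * M) by rewrite ge_min lexx orbT.
    by rewrite ler_pdivlMr //; lra.
  (* For [tau > C + X] the window of phase radius [2^N pi] fits inside the interval of radius
     [d]. *)
  pose X := 2 ^+ N * pi / d.
  exists (Num.max (Num.max T0 (2 * C)) (Num.max (16 * C / s) (C + X))).
    by rewrite !lt_max; apply/orP; left; apply/orP; right; lra.
  move=> tau x; rewrite !gt_max => /andP[/andP[h1 h2] /andP[h3 h4]].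
  have ht : C < tau by lra.
  have tp := tau0 _ ht.
  have k1 := ratio_sqr_near1 s0 C_gt0 (ltW h2) (ltW h3).
  have Nd : 2 ^+ N * pi <= (tau - C) * d.
    rewrite -ler_pdivrMr // -/X; lra.
  have := G_error (E_HB _ tp) (E_real_zeros _ tp) (E_phase _ tp) (L1_gt0 _ ht) (bnd _ ht)
    (fun y => hM y tau tp) (ltW e8) Nd (fun t xt => ltW (fc x t tau (ltW h1) xt)).
  move=> h; apply: (le_trans h); rewrite mulrC ler_wpM2r ?sqr_ge0 //.
  set k := (_ / _) ^+ 2 in k1 *.
  have n2 : 0 < (2 : R) ^+ N by rewrite exprn_gt0.
  have nh : M * 2^-1 ^+ N <= e / 20.
    rewrite exprVn ler_pdivrMr //; rewrite ler_pdivrMr // in hN; lra.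
  have n0 : 0 <= (2^-1 : R) ^+ N by rewrite exprn_ge0.
  have a1 : e / 8 * k <= e / 8 * 2 by rewrite ler_wpM2l //; lra.
  have a2 : M * (k - 1) <= M * s by rewrite ler_wpM2l //; lra.
  have a3 : (2 * M * k + M) * 2^-1 ^+ N <= 5 * (M * 2^-1 ^+ N).
    rewrite mulrA ler_wpM2r //.
    have : M * k <= M * 2 by rewrite ler_wpM2l //; lra.
    lra.
  lra.
split; [split|].
- move=> tau ht; have tp := tau0 _ ht.
  exact: (Gpartial_family_compact (E_HB _ tp) (E_real_zeros _ tp) (E_phase _ tp)
    (L1_gt0 _ ht) (bnd _ ht) (fun y => hM y tau tp)).
- move=> tau ht; have tp := tau0 _ ht.
  exact: (G_Hinf (E_HB _ tp) (E_real_zeros _ tp) (E_phase _ tp)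
    (L1_gt0 _ ht) (bnd _ ht) (fun y => hM y tau tp)).
- apply: Linfty_norm_cvg0 => e e0; have [T CT hT] := key e e0.
  exists T; split; first exact: num_real.
  move=> tau Ttau x; have tp : 0 < tau by lra.
  rewrite cmod_div cmodX ler_pdivrMr; first exact: hT.
  by rewrite exprn_gt0 // cmod_gt0 E_real_zeros.
- move=> w [_ w0] [c [d [t0 [c0 d0 t00 cd]]]].
  apply: Linfty_norm_cvg0 => e e0.
  have ed : 0 < e / d by rewrite divr_gt0.
  have [T CT hT] := key _ ed.
  exists (Num.max T t0); split; first exact: num_real.
  move=> tau; rewrite gt_max => /andP[Ttau t0tau] x.
  rewrite cmodM cmodR (ger0_norm (w0 x)).
  have /andP[_ h2] := cd x tau (ltW t0tau).
  (* The weight turns the relative error [(e/d) |E|^2] into at most [e], through [|E|^2 w <= d]. *)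
  apply: (@le_trans _ _ (e / d * cmod (E tau x%:C) ^+ 2 * w x)).
    by rewrite ler_wpM2r //; exact: hT.
  rewrite -mulrA; apply: (@le_trans _ _ (e / d * d)); last by rewrite divfK ?gt_eqF.
  by rewrite (ler_wpM2l (ltW ed)).
Qed.
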